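(* If $\phi$ satisfies (A1) and (A2), then $V(\phi,\mathbb{Z})=V(L_\phi,\mathbb{Z})$.
   Context: Fourier transform: $\widehat f(\xi)=\frac{1}{\sqrt{2\pi}}\int_{\mathbb{R}}f(x)e^{-i\xi x}\,dx$. $\mathbb{T}=[-\pi,\pi)$. $\|g\|_{W(L_\infty,\ell_1)}:=\sum_{k}\|g(\cdot+2\pi k)\|_{L_\infty(\mathbb{T})}$. A function $\phi$ satisfies (A1) if $\phi\in L_2(\mathbb{R})$ is positive definite; (A2) if $\widehat\phi\in W(L_\infty,\ell_1)$, $\inf_{\xi\in\mathbb{T}}|\widehat\phi(\xi)|>0$ and $\sum_{j\neq0}\|\widehat\phi(\cdot+2\pi j)\|_{L_\infty(\mathbb{T})}/\inf_{\xi\in\mathbb{T}}|\widehat\phi(\xi)|<\infty$. $L_\phi$ is the inverse Fourier transform of $\widehat{L_\phi}(\xi)=\frac{1}{\sqrt{2\pi}}\widehat\phi(\xi)/\sum_{j\in\mathbb{Z}}\widehat\phi(\xi+2\pi j)$. For a function $g$, $V(g,\mathbb{Z})$ is the closure in $L_2(\mathbb{R})$ of the linear span of $\{g(\cdot-j):j\in\mathbb{Z}\}$. *)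

(* Defs.v *)
From HB Require Import structures.
From mathcomp Require Import all_boot all_order all_algebra.
From mathcomp.real_closed Require Import complex.
From mathcomp Require Import all_classical all_reals all_analysis.
From mathcomp Require Import ess_sup_inf.

Set Implicit Arguments.
Unset Strict Implicit.
Unset Printing Implicit Defensive.

Import Order.TTheory GRing.Theory Num.Theory.
Import numFieldNormedType.Exports.

Local Open Scope classical_set_scope.
Local Open Scope ring_scope.

Section Defs.
Context {R : realType}.
Local Notation C := (complex.complex R).

(* The (completed) Lebesgue measure on R: measurability below means
   Lebesgue measurability. *)
Definition LT : Type := ltac:(let t := type of (@completed_lebesgue_measure R) in
  match t with set ?X -> _ => exact X end).
Definition leb : set LT -> \bar R := @completed_lebesgue_measure R.

(* view a function on R as a function on the (Lebesgue-)measurable space LT;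
   LT is definitionally R *)
Definition lf {A : Type} (f : R -> A) : LT -> A := f.
Definition ls (D : set R) : set LT := D.

Definition cmod (z : C) : R := Num.sqrt (complex.Re z ^+ 2 + complex.Im z ^+ 2).

Definition Cmeasurable (D : set R) (f : R -> C) :=
  measurable_fun (ls D) (lf (fun x => complex.Re (f x))) /\
  measurable_fun (ls D) (lf (fun x => complex.Im (f x))).

Definition Cintegrable (D : set R) (f : R -> C) :=
  leb.-integrable (ls D) (lf (fun x => (complex.Re (f x))%:E)) /\
  leb.-integrable (ls D) (lf (fun x => (complex.Im (f x))%:E)).

Definition Cint (D : set R) (f : R -> C) : C :=
  complex.Complex (Rintegral leb (ls D) (lf (fun x => complex.Re (f x))))
          (Rintegral leb (ls D) (lf (fun x => complex.Im (f x)))).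

Definition expi (t : R) : C := complex.Complex (cos t) (sin t).

Definition RtoC (r : R) : C := complex.Complex r 0.

Definition L2 (f : R -> C) :=
  Cmeasurable setT f /\
  (\int[leb]_x lf (fun x => ((cmod (f x)) ^+ 2)%:E) x < +oo)%E.

Definition L2dist2 (f g : R -> C) : \bar R :=
  (\int[leb]_x lf (fun x => ((cmod (f x - g x)) ^+ 2)%:E) x)%E.

Definition posdef (phi : R -> C) :=
  forall (n : nat) (x : 'I_n -> R) (c : 'I_n -> C),
    0 <= \sum_(j < n) \sum_(k < n) c j * (c k)^* * phi (x j - x k).

Definition FTtrunc (f : R -> C) (n : nat) (xi : R) : C :=
  RtoC (Num.sqrt (2 * pi))^-1 *
  Cint `[- (n%:R), n%:R] (fun x => f x * expi (- (xi * x))).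

Definition is_FT (f fhat : R -> C) :=
  L2 fhat /\ (fun n => L2dist2 (FTtrunc f n) fhat) @ \oo --> 0%E.

Definition invFT (g : R -> C) (x : R) : C :=
  RtoC (Num.sqrt (2 * pi))^-1 * Cint setT (fun xi => g xi * expi (xi * x)).

Definition Tset : set R := `[- pi, pi[.

Lemma measurable_Tset : measurable (Tset : set (measurableTypeR R)).
Proof. exact: measurable_itv. Qed.

Definition lebT := mrestr (@lebesgue_measure R) measurable_Tset.

Definition locnorm (g : R -> C) (k : int) : \bar R :=
  ess_sup lebT (fun x => (cmod (g (x + 2 * pi * k%:~R)))%:E).

Definition Wnorm (g : R -> C) : \bar R :=
  (\esum_(k in [set: int]) locnorm g k)%E.

Definition inW (g : R -> C) := Cmeasurable setT g /\ (Wnorm g < +oo)%E.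

Definition infT (g : R -> C) : \bar R :=
  ess_inf lebT (fun x => (cmod (g x))%:E).

Definition condA2 (ghat : R -> C) :=
  inW ghat /\ (0 < infT ghat)%E /\
  ((\esum_(k in [set k : int | (k != 0)%R]) locnorm ghat k) / infT ghat < +oo)%E.

Definition persum (g : R -> C) (xi : R) (n : nat) : C :=
  \sum_(i < (2 * n).+1) g (xi + 2 * pi * ((i : nat)%:R - n%:R)).

Definition periodization (g : R -> C) (xi : R) : C :=
  complex.Complex (limn (fun n => complex.Re (persum g xi n)))
          (limn (fun n => complex.Im (persum g xi n))).

Definition Lhat (phihat : R -> C) (xi : R) : C :=
  RtoC (Num.sqrt (2 * pi))^-1 * (phihat xi / periodization phihat xi).

Definition Lphi (phihat : R -> C) : R -> C := invFT (Lhat phihat).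

Definition Vspace (g : R -> C) : set (R -> C) :=
  [set f | L2 f /\ forall eps : R, 0 < eps ->
     exists (s : seq int) (c : int -> C),
       (L2dist2 f (fun x => (\sum_(j <- s) c j * g (x - j%:~R))%R) < eps%:E)%E].

End Defs.

(* Main.v *)
(* Positive definiteness makes phihat real and nonnegative almost everywhere: for a
   nonnegative test function u, the pairing of phihat with u is the integral of
   phi times the transform of u, an integrable positive definite function, and
   such integrals are nonnegative.  By (A2) phihat is integrable, so that phi is
   the inverse Fourier transform of phihat, and its periodization P is a real
   2 pi-periodic function with 0 < delta <= P <= B almost everywhere.  Hence
   phihat = sqrt(2 pi) P Lhat and Lhat = P^-1 phihat / sqrt(2 pi) with bounded
   periodic multipliers.  A bounded 2 pi-periodic Q is a limit of trigonometric
   polynomials in L2 of any finite measure W dx (the functions with this property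
   are stable under products and bounded limits and contain sine and cosine), and
   multiplication by a trigonometric polynomial on the Fourier side is a combination
   of integer translations; so each of the two spaces contains the other. *)
Require Import Defs.
From HB Require Import structures.
From mathcomp Require Import all_boot all_order all_algebra.
From mathcomp.real_closed Require Import complex.
From mathcomp Require Import all_classical all_reals all_analysis.
From mathcomp Require Import ess_sup_inf measurable_realfun.
From mathcomp Require Import ring lra zify.
Set Implicit Arguments.
Unset Strict Implicit.
Unset Printing Implicit Defensive.
Import Order.TTheory GRing.Theory Num.Theory.
Import numFieldNormedType.Exports.
Local Open Scope classical_set_scope.
Local Open Scope ring_scope.

(** * Real-valued integrals *)

(** Nonnegativity of [phihat] excludes cancellation in the periodization: a single term of size at
    least [delta] bounds the whole sum from below, and (A2) supplies such a term in every class
    modulo 2 pi. The hypothesis [is_FT] describes [phihat] only as an L2 limit of truncated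
    integrals, so what is known of it is extracted from pairings with test functions [u]. Moving the
    transform onto [u] requires that the transform of an integrable and square integrable function
    be square integrable. Only such a bound is used, not an isometry, so constants may be lost; it
    is proved for the cosine and sine kernels separately, damped by exp(-eps |x|), whose cosine
    transform is a Poisson kernel. The same damping yields inversion, since the Poisson integral of
    an interval is a difference of arctangents. Measurability means Lebesgue measurability, whereas
    generating families reach only Borel sets; each Lebesgue set is therefore replaced by a Borel
    set up to a null set. *)

Section RealIntegrals.
Context d (T : measurableType d) (R : realType) (m : {measure set T -> \bar R}).
Implicit Types f g : T -> R.

Definition integ f := m.-integrable setT (EFin \o f).

Lemma integ_measurable f : integ f -> measurable_fun setT f.
Proof. by move=> /integrableP[/measurable_EFinP]. Qed.

Lemma integ_fin f : integ f -> (\int[m]_x (f x)%:E)%E = (\int[m]_x f x)%:E.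
Proof. by move=> fi; rewrite /Rintegral fineK//; exact: integrable_fin_num. Qed.

Lemma integ_ge0P f : measurable_fun setT f -> (forall x, 0 <= f x) ->
  (\int[m]_x (f x)%:E < +oo)%E -> integ f.
Proof.
move=> mf f0 fi; apply/integrableP; split; first exact/measurable_EFinP.
by under eq_integral => x _ do rewrite /= ger0_norm//.
Qed.

Lemma integ_le f g : measurable_fun setT f -> integ g ->
  (forall x, `|f x| <= g x) -> integ f.
Proof.
move=> mf gi fg; apply: (le_integrable _ _ _ gi) => //.
  exact/measurable_EFinP.
by move=> x _ /=; rewrite lee_fin (le_trans (fg x)) ?ler_norm.
Qed.

Lemma integD f g : integ f -> integ g -> integ (fun x => f x + g x).
Proof.
move=> fi gi; rewrite /integ.
rewrite (_ : EFin \o _ = (EFin \o f) \+ (EFin \o g))%E; first exact: integrableD.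
by apply/funext => x /=; rewrite EFinD.
Qed.

Lemma integZ k f : integ f -> integ (fun x => k * f x).
Proof. by move=> fi; have := integrableZl measurableT k fi. Qed.

Lemma integN f : integ f -> integ (fun x => - f x).
Proof.
by move=> /(integZ (-1)); congr integ; apply/funext => x; rewrite mulN1r.
Qed.

Lemma integB f g : integ f -> integ g -> integ (fun x => f x - g x).
Proof. by move=> fi gi; apply: integD => //; exact: integN. Qed.

Lemma integ_mulb f g M : integ f -> measurable_fun setT g ->
  (forall x, `|g x| <= M) -> integ (fun x => f x * g x).
Proof.
move=> fi mg gM; have mf := integ_measurable fi.
apply: (@integ_le _ (fun x => M * `|f x|)).
- exact: measurable_funM.
- by apply: integZ; exact: integrable_norm.
- by move=> x; rewrite normrM mulrC ler_wpM2r.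
Qed.

Lemma integM2 f g : measurable_fun setT f -> measurable_fun setT g ->
  integ (fun x => f x ^+ 2) -> integ (fun x => g x ^+ 2) ->
  integ (fun x => f x * g x).
Proof.
move=> mf mg f2 g2; apply: (integ_le _ (integD f2 g2)).
  exact: measurable_funM.
move=> x; rewrite ler_norml; have := sqr_ge0 (f x + g x).
have := sqr_ge0 (f x - g x); have := sqr_ge0 (f x); have := sqr_ge0 (g x).
by move=> ? ? ? ?; apply/andP; split; nra.
Qed.

Lemma integ_sqrD f g : measurable_fun setT f -> measurable_fun setT g ->
  integ (fun x => f x ^+ 2) -> integ (fun x => g x ^+ 2) ->
  integ (fun x => (f x + g x) ^+ 2).
Proof.
move=> mf mg f2 g2.
apply: (integ_le _ (integZ 2 (integD f2 g2))).
  by apply: measurable_funX; exact: measurable_funD.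
move=> x; rewrite ger0_norm ?sqr_ge0//; have := sqr_ge0 (f x - g x); nra.
Qed.

Lemma integ_ae f g : measurable_fun setT f -> integ g ->
  {ae m, forall x, f x = g x} -> integ f.
Proof.
move=> mf gi fg; apply/integrableP; split; first exact/measurable_EFinP.
have /integrableP[mg] := gi; apply: le_lt_trans.
rewrite (ae_eq_integral (abse \o (EFin \o g)))//.
- by apply: measurableT_comp => //; exact/measurable_EFinP.
- by apply: measurableT_comp.
- by apply: filterS fg => x /= -> _.
Qed.

Lemma eq_Rint f g : f =1 g -> \int[m]_x f x = \int[m]_x g x.
Proof. by move=> fg; apply: eq_Rintegral => x _; exact: fg. Qed.

Lemma Rint_indic (D : set T) f :
  \int[m]_(x in D) f x = \int[m]_x (\1_D x * f x).
Proof.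
rewrite Rintegral_mkcond; apply: eq_Rint => x.
by rewrite patchE indicE; case: ifPn => _; rewrite ?mul1r ?mul0r.
Qed.

Lemma eq_ae_Rint f g : measurable_fun setT f -> measurable_fun setT g ->
  {ae m, forall x, f x = g x} -> \int[m]_x f x = \int[m]_x g x.
Proof.
move=> mf mg fg; congr fine; apply: ae_eq_integral => //.
- exact/measurable_EFinP.
- exact/measurable_EFinP.
- by apply: filterS fg => x -> _.
Qed.

Lemma le_Rint f g : integ f -> integ g -> (forall x, f x <= g x) ->
  \int[m]_x f x <= \int[m]_x g x.
Proof. by move=> fi gi fg; apply: le_Rintegral => // x _; exact: fg. Qed.

Lemma Rint_ge0 f : (forall x, 0 <= f x) -> 0 <= \int[m]_x f x.
Proof. by move=> f0; apply: Rintegral_ge0. Qed.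

Lemma RintD f g : integ f -> integ g ->
  \int[m]_x (f x + g x) = \int[m]_x f x + \int[m]_x g x.
Proof. exact: RintegralD. Qed.

Lemma RintB f g : integ f -> integ g ->
  \int[m]_x (f x - g x) = \int[m]_x f x - \int[m]_x g x.
Proof. exact: RintegralB. Qed.

Lemma RintZ k f : integ f -> \int[m]_x (k * f x) = k * \int[m]_x f x.
Proof. by move=> fi; apply: RintegralZl. Qed.

Lemma integ0 : integ (fun=> 0).
Proof.
apply: (integ_ge0P (measurable_cst (0 : R))) => //.
by rewrite integral0 ltry.
Qed.

Lemma integ_sum I (r : seq I) (f : I -> T -> R) : (forall i, integ (f i)) ->
  integ (fun x => \sum_(i <- r) f i x).
Proof.
move=> fi; elim: r => [|i r IH].
  by under [X in integ X]eq_fun do rewrite big_nil; exact: integ0.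
by under [X in integ X]eq_fun do rewrite big_cons; exact: integD.
Qed.

Lemma Rint_sum I (r : seq I) (f : I -> T -> R) : (forall i, integ (f i)) ->
  \int[m]_x \sum_(i <- r) f i x = \sum_(i <- r) \int[m]_x f i x.
Proof.
move=> fi; elim: r => [|i r IH].
  under eq_Rint do rewrite big_nil.
  by rewrite big_nil /Rintegral integral0.
under eq_Rint do rewrite big_cons.
by rewrite big_cons RintD ?IH//; exact: integ_sum.
Qed.

Lemma sqr_int0_ae f : measurable_fun setT f -> integ (fun x => f x ^+ 2) ->
  \int[m]_x f x ^+ 2 <= 0 -> {ae m, forall x, f x = 0}.
Proof.
move=> mf f2 le0; have mf2 := integ_measurable f2.
have : (\int[m]_x `|(f x ^+ 2)%:E| = 0)%E.
  under eq_integral => x _ do rewrite gee0_abs ?lee_fin ?sqr_ge0//.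
  rewrite integ_fin//; congr EFin; apply/eqP; rewrite eq_le le0 /=.
  by apply: Rint_ge0 => x; exact: sqr_ge0.
move/(ae_eq_integral_abs m measurableT (proj2 (measurable_EFinP _ _) mf2)).
by apply: filterS => x /(_ I) [] /eqP; rewrite sqrf_eq0 => /eqP.
Qed.

Lemma le_norm_Rint f g : measurable_fun setT f -> integ g ->
  (forall x, `|f x| <= g x) -> `|\int[m]_x f x| <= \int[m]_x g x.
Proof.
move=> mf gi fg; have fi := integ_le mf gi fg.
by apply: le_trans (le_normr_Rintegral _ _) (le_Rint _ _ _) => //;
  exact: integrable_norm.
Qed.

Lemma Rint_dct (f_ : nat -> T -> R) f g :
  (forall n, measurable_fun setT (f_ n)) -> measurable_fun setT f -> integ g ->
  {ae m, forall x, f_ n x @[n --> \oo] --> f x} ->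
  (forall n x, `|f_ n x| <= g x) ->
  integ f /\ \int[m]_x f_ n x @[n --> \oo] --> \int[m]_x f x.
Proof.
move=> mf_ mf gi cf fg.
have [||||fi _ cfi] := @dominated_convergence _ _ _ m setT measurableT
   (fun n => EFin \o f_ n) (EFin \o f) (EFin \o g) _ _ _ gi _.
- by move=> n; exact/measurable_EFinP.
- exact/measurable_EFinP.
- by apply: filterS cf => x cx _; apply/fine_cvgP; split; [exact: nearW|].
- by apply: aeW => x n _ /=; rewrite lee_fin.
split => //; move: cfi; rewrite (integ_fin fi) => /fine_cvgP[_].
by [].
Qed.

(** Fatou's lemma in the form that passes a uniform bound on the integrals to the limit; it serves
    to remove dampings and truncations. *)
Lemma le_integral_fatou (f_ : nat -> T -> R) f (M : \bar R) :
  (forall n, measurable_fun setT (f_ n)) ->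
  (forall n x, 0 <= f_ n x) -> (forall x, f_ n x @[n --> \oo] --> f x) ->
  (forall n, (\int[m]_x (f_ n x)%:E <= M)%E) ->
  (\int[m]_x (f x)%:E <= M)%E.
Proof.
move=> mf f0 cf fM.
have mE n : measurable_fun setT (EFin \o f_ n) by exact/measurable_EFinP.
have c x : limn_einf (fun n => (f_ n x)%:E) = (f x)%:E.
  by rewrite (cvg_limn_einf_sup (l := (f x)%:E))//; apply: cvg_EFin;
    [exact: nearW|exact: cf].
have := fatou m measurableT mE (fun n x _ => f0 n x).
under eq_integral => x _ do rewrite /= c.
move=> /le_trans; apply.
rewrite limn_einf_lim; apply: lime_le.
  exact: is_cvg_einfs.
apply: nearW => n; rewrite /einfs /=.
by apply: le_trans (ereal_inf_lbound _) (fM n); exists n => /=.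
Qed.

End RealIntegrals.

(** * Integral operators with bounded kernels *)

Section IntegralKernels.
Context d1 d2 (T1 : measurableType d1) (T2 : measurableType d2) (R : realType).
Variables (m1 : {sigma_finite_measure set T1 -> \bar R})
          (m2 : {sigma_finite_measure set T2 -> \bar R}).
Implicit Types (k : T1 -> T2 -> R) (f : T1 -> R) (g : T2 -> R).

(** Joint measurability and a uniform bound make [f x * (k x y * g y)] integrable on the product as
    soon as [f] and [g] are integrable. *)
Definition kernel k (M : R) := [/\ measurable_fun setT (fun z : T1 * T2 => k z.1 z.2)
  & forall x y, `|k x y| <= M].

Lemma kernel_measurable1 k M x : kernel k M -> measurable_fun setT (k x).
Proof.
by move=> [mk _]; have := measurableT_comp mk (measurable_pair1 x).
Qed.

Lemma kernel_measurable2 k M y : kernel k M -> measurable_fun setT (k ^~ y).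
Proof.
by move=> [mk _]; have := measurableT_comp mk (measurable_pair2 y).
Qed.

Lemma kernel_integ k M g x : kernel k M -> integ m2 g ->
  integ m2 (fun y => k x y * g y).
Proof.
move=> kk gi; under [X in integ m2 X]eq_fun do rewrite mulrC.
exact: (integ_mulb gi (kernel_measurable1 x kk) (kk.2 x)).
Qed.

(** The inner integral is the difference of the integrals of the positive and negative parts, each
    measurable by Tonelli. *)
Lemma measurable_kernel_int k M g : kernel k M -> measurable_fun setT g ->
  measurable_fun setT (fun x => \int[m2]_y (k x y * g y)).
Proof.
move=> [mk _] mg; apply: measurableT_comp => //=.
pose h (z : T1 * T2) : \bar R := (k z.1 z.2 * g z.2)%:E.
have mh : measurable_fun setT h.
  apply/measurable_EFinP; apply: measurable_funM => //.
  exact: measurableT_comp.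
rewrite (_ : (fun x => _) =
  (fubini_F m2 h^\+)%E \- (fubini_F m2 h^\-)%E)%E; last first.
  apply/funext => x; rewrite [LHS]integralE.
  by congr (_ - _)%E; apply: eq_integral => y _; rewrite ?funeposE ?funenegE.
by apply: emeasurable_funB; apply: measurable_fun_fubini_tonelli_F => //;
  [exact: measurable_funepos|exact: measurable_funeneg].
Qed.

Lemma kernel_int_bound k M g x : kernel k M -> integ m2 g ->
  `|\int[m2]_y (k x y * g y)| <= M * \int[m2]_y `|g y|.
Proof.
move=> kk gi; have mg := integ_measurable gi.
have gn : integ m2 (fun y => `|g y|) by exact: integrable_norm.
rewrite -RintZ//; apply: le_norm_Rint.
- by apply: measurable_funM => //; exact: (kernel_measurable1 x kk).
- exact: integZ.
- by move=> y; rewrite normrM ler_wpM2r// kk.2.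
Qed.

(** Fubini, the integrand being dominated by M |f x| |g y|. This adjoint relation is the exchange
    behind both the Schur test and [TR_swap]. *)
Lemma kernel_swap k M f g : kernel k M -> integ m1 f -> integ m2 g ->
  \int[m1]_x (f x * \int[m2]_y (k x y * g y)) =
  \int[m2]_y (g y * \int[m1]_x (k x y * f x)).
Proof.
move=> kk fi gi; have [mk kM] := kk.
have mf := integ_measurable fi; have mg := integ_measurable gi.
have fn : integ m1 (fun x => `|f x|) by exact: integrable_norm.
have gn : integ m2 (fun y => `|g y|) by exact: integrable_norm.
pose h (z : T1 * T2) : \bar R := (f z.1 * (k z.1 z.2 * g z.2))%:E.
have mh : measurable_fun setT h.
  apply/measurable_EFinP; apply: measurable_funM; first exact: measurableT_comp.
  by apply: measurable_funM => //; exact: measurableT_comp.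
have hi : (m1 \x m2)%E.-integrable setT h.
  apply/integrable12ltyP => //.
  apply: (@le_lt_trans _ _ (\int[m1]_x ((M * \int[m2]_y `|g y|) * `|f x|)%:E)%E).
    apply: ge0_le_integral => //.
    - by move=> x _; exact: integral_ge0.
    - apply: (measurable_fun_fubini_tonelli_F (abse \o h)) => //=.
      exact: measurableT_comp.
    - by apply/measurable_EFinP; apply: measurable_funM => //; exact: measurableT_comp.
    - move=> x _.
      have gk : integ m2 (fun y => M * (`|g y| * `|f x|)).
        apply: integZ; under [X in integ _ X]eq_fun do rewrite mulrC.
        exact: integZ.
      apply: (@le_trans _ _ (\int[m2]_y (M * (`|g y| * `|f x|))%:E)%E).
        apply: ge0_le_integral => //.
        + apply: measurableT_comp => //; apply/measurable_EFinP.
          apply: measurable_funM => /=; first exact: measurable_cst.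
          by apply: measurable_funM => //; exact: (kernel_measurable1 x kk).
        + by apply/measurable_EFinP; exact: integ_measurable gk.
        + move=> y _; rewrite /h /= lee_fin !normrM mulrC -mulrA.
          by apply: ler_wpM2r; [exact: mulr_ge0|exact: kM].
      rewrite integ_fin// lee_fin -mulrA RintZ; last first.
        by under [X in integ _ X]eq_fun do rewrite mulrC; exact: integZ.
      by rewrite RintegralZr.
  rewrite integ_fin ?ltry//; exact: integZ.
transitivity (fine (\int[m1]_x \int[m2]_y h (x, y))%E).
  congr fine; apply: eq_integral => x _.
  have kgi := kernel_integ x kk gi.
  by rewrite -RintZ// -integ_fin//; exact: integZ.
rewrite Fubini//; congr fine; apply: eq_integral => y _.
have kfi : integ m1 (fun x => k x y * f x).
  under [X in integ m1 X]eq_fun do rewrite mulrC.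
  exact: (integ_mulb fi (kernel_measurable2 y kk) (kk.2 ^~ y)).
rewrite -RintZ// -integ_fin; last exact: integZ.
by apply: eq_integral => x _; rewrite /h /=; congr EFin; ring.
Qed.

End IntegralKernels.

(** * The completed Lebesgue measure under affine maps *)

Section Scaling.
Context d (T : measurableType d) (R : realType) (m : {measure set T -> \bar R}).
Variables (phi : T -> T) (c : R).
Hypotheses (c0 : 0 <= c) (mphi : measurable_fun setT phi).
Hypothesis phiE : forall A, measurable A -> m (phi @^-1` A) = (c%:E * m A)%E.

(** The hypothesis [phiE] says that the pushforward of [m] along [phi] is the multiple [c] of
    [m]. *)
Lemma ge0_integral_scaling (f : T -> \bar R) :
  measurable_fun setT f -> (forall x, (0 <= f x)%E) ->
  (\int[m]_x f (phi x) = c%:E * \int[m]_x f x)%E.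
Proof.
move=> mf f0.
have := @ge0_integral_pushforward _ _ _ _ R _ mphi m setT f measurableT mf.
rewrite preimage_setT => <-; last by move=> x _; exact: f0.
transitivity (\int[mscale (NngNum c0) m]_x f x)%E; last by rewrite ge0_integral_mscale.
by apply: eq_measure_integral => A mA _; exact: (phiE mA).
Qed.

Lemma integ_scaling (f : T -> R) : integ m f -> integ m (fun x => f (phi x)).
Proof.
move=> fi; have mf := integ_measurable fi; have /integrableP[_ foo] := fi.
apply/integrableP; split; first by apply/measurable_EFinP; exact: (measurableT_comp mf mphi).
rewrite (ge0_integral_scaling (f := fun x => `|(f x)%:E|%E))//.
  by rewrite -ge0_fin_numE ?mule_ge0 ?integral_ge0// fin_numM// ge0_fin_numE ?integral_ge0.
by apply: measurableT_comp => //; exact/measurable_EFinP.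
Qed.

Lemma Rint_scaling (f : T -> R) : integ m f ->
  \int[m]_x f (phi x) = c * \int[m]_x f x.
Proof.
move=> fi; have mf := integ_measurable fi.
(* The nonnegative case is applied to |f| and |f| + f, whose difference gives [f]. *)
have pos (g : T -> R) : (forall x, 0 <= g x) -> integ m g ->
    \int[m]_x g (phi x) = c * \int[m]_x g x.
  move=> g0 gi; apply: EFin_inj; rewrite EFinM -!integ_fin//; last exact: integ_scaling.
  by apply: (ge0_integral_scaling (f := EFin \o g)) => //; apply/measurable_EFinP; exact: integ_measurable gi.
have fn : integ m (fun x => `|f x|) by exact: integrable_norm.
have fp : integ m (fun x => `|f x| + f x) by exact: integD.
have fp0 x : 0 <= `|f x| + f x by have := ler_norm (- f x); rewrite normrN; lra.
have fn' : integ m (fun x => `|f (phi x)|) := integ_scaling fn.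
have := pos _ fp0 fp; rewrite RintD//; last exact: integ_scaling.
rewrite (pos _ _ fn)// RintD// mulrDr.
exact: addrI.
Qed.

End Scaling.

Section Lebesgue.
Context {R : realType}.
Notation mu := (@lebesgue_measure R).
Notation BT := (measurableTypeR R).
Notation LT := (@LT R).
Notation leb := (@leb R).

Lemma borel_LT (A : set R) : measurable (A : set BT) -> measurable (A : set LT).
Proof. exact: sub_caratheodory. Qed.

Lemma measurable_id_LT : measurable_fun [set: LT] (idfun : LT -> BT).
Proof. by move=> _ B mB; rewrite setTI; exact: borel_LT. Qed.

Lemma measurable_LT d (T : measurableType d) (f : BT -> T) :
  measurable_fun setT f -> measurable_fun [set: LT] (f : LT -> T).
Proof. by move=> mf; exact: (measurableT_comp mf measurable_id_LT). Qed.

Lemma continuous_LT (f : R -> R) : continuous f ->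
  measurable_fun [set: LT] (f : LT -> R).
Proof. by move=> cf; apply: measurable_LT; exact: continuous_measurable_fun. Qed.

(** The identity from the completed to the Borel sigma-algebra is measurable and pushes [leb]
    forward to [mu]. Integrals of Borel functions can thus be computed for [mu], where the
    fundamental theorem of calculus applies. *)
Lemma ge0_integral_leb (D : set R) (f : R -> \bar R) :
  measurable (D : set BT) -> measurable_fun (D : set BT) (f : BT -> \bar R) ->
  (forall x, D x -> (0 <= f x)%E) ->
  (\int[leb]_(x in D) f x = \int[mu]_(x in D) f x)%E.
Proof.
move=> mD mf f0.
have := @ge0_integral_pushforward _ _ _ _ R _ measurable_id_LT leb D f mD mf.
rewrite /= => <-; last by move=> x /set_mem; exact: f0.
by apply: eq_measure_integral => [|A mA _]; [exact: measurable_id_LT|].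
Qed.

(** Lebesgue sets form the completion of the Borel sets. What [A] has beyond its Borel part lies in
    a Borel null set, which reduces statements on Lebesgue sets to Borel ones. *)
Lemma LT_decomp (A : set LT) : measurable A -> exists B N : set R,
  [/\ measurable (B : set BT), measurable (N : set BT), mu N = 0%E &
  B `<=` A /\ A `\` B `<=` N].
Proof.
move=> mA.
have : (measurable_realfun.completed_algebra_gen mu) A.
  by rewrite -g_sigma_completed_algebra_genE completed_caratheodory_measurable.
move=> [/= B mB [N [N' [mN' N'0 NN']]] <-].
exists B, N'; split => //; split; first exact: subsetUl.
by move=> x [[//|Nx] _]; exact: NN'.
Qed.

Lemma leb_negligible (N : set R) (B : set R) : measurable (B : set BT) ->
  mu B = 0%E -> N `<=` B -> measurable (N : set LT) /\ leb N = 0%E.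
Proof.
move=> mB B0 NB.
have nN : (leb).-negligible (N : set LT).
  by exists B; split => //; exact: borel_LT.
have mN := completed_lebesgue_measure_is_complete nN.
by split => //; apply/(negligibleP _ mN).
Qed.

Lemma leb_null_borel (N : set LT) : (leb).-negligible N ->
  exists B : set R, [/\ measurable (B : set BT), mu B = 0%E & N `<=` B].
Proof.
move=> [A [mA A0 NA]]; have [B [M [mB mM M0 [BA AM]]]] := LT_decomp mA.
exists (B `|` M); split; first exact: measurableU.
- apply/eqP; rewrite eq_le measure_ge0 andbT.
  apply: (le_trans (measureU2 mu mB mM)); rewrite [X in (_ + X)%E]M0 adde0 -A0.
  by apply: (@le_measure _ _ _ leb) => //; rewrite inE; first exact: borel_LT.
- move=> x /NA Ax; have [Bx|Bx] := pselect (B x); first by left.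
  by right; exact: AM.
Qed.

Definition aff (a b x : R) := a * x + b.

Lemma aff_itv (a b c d : R) : a != 0 ->
  mu (aff a b @^-1` `]c, d]) = (`|a|^-1%:E * mu `]c, d])%E.
Proof.
move=> a0; have [cd|dc] := ltP c d; last first.
  have -> : (`]c, d]%classic = set0 :> set R).
    by rewrite set_itv_ge// bnd_simp -leNgt.
  by rewrite preimage_set0 measure0 mule0.
rewrite lebesgue_measure_itv /= lte_fin cd.
move: a0; rewrite neq_lt => /orP[a0|a0].
- have -> : aff a b @^-1` `]c, d] = `[(d - b) / a, (c - b) / a[%classic.
    apply/seteqP; split => x /=; rewrite !in_itv/= /aff.
    + by move=> /andP[h1 h2]; rewrite ler_ndivrMr// ltr_ndivlMr//; apply/andP; split; lra.
    + by rewrite ler_ndivrMr// ltr_ndivlMr// => /andP[h1 h2]; apply/andP; split; lra.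
  rewrite lebesgue_measure_itv /= lte_fin ltr_ndivlMr// divfK ?lt_eqF//.
  rewrite ltrD2r cd -!EFinB -EFinM; congr EFin.
  by rewrite ltr0_norm// invrN; field; rewrite lt_eqF.
- have -> : aff a b @^-1` `]c, d] = `](c - b) / a, (d - b) / a]%classic.
    apply/seteqP; split => x /=; rewrite !in_itv/= /aff.
    + by move=> /andP[h1 h2]; rewrite ltr_pdivrMr// ler_pdivlMr//; apply/andP; split; lra.
    + by rewrite ltr_pdivrMr// ler_pdivlMr// => /andP[h1 h2]; apply/andP; split; lra.
  rewrite lebesgue_measure_itv /= lte_fin ltr_pdivrMr// divfK ?gt_eqF//.
  rewrite ltrD2r cd -!EFinB -EFinM; congr EFin.
  by rewrite gtr0_norm//; field; rewrite gt_eqF.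
Qed.

Lemma continuous_aff a b : continuous (aff a b).
Proof.
move=> x; apply: continuousD; last exact: cst_continuous.
by apply: continuousM; [exact: cst_continuous|exact: cvg_id].
Qed.

Lemma measurable_aff_BT a b : measurable_fun [set: BT] (aff a b : BT -> BT).
Proof. exact: (continuous_measurable_fun (@continuous_aff a b)). Qed.

(** By uniqueness of Lebesgue measure: |a| times its pushforward along [aff a b] agrees with it on
    half-open intervals. *)
Lemma aff_borel (a b : R) (A : set R) : a != 0 -> measurable (A : set BT) ->
  mu (aff a b @^-1` A) = (`|a|^-1%:E * mu A)%E.
Proof.
move=> a0 mA.
have na : 0 <= `|a| by [].
pose nu := mscale (NngNum na)
  (measure_function_pushforward__canonical__measure_function_Measure mu
    (measurable_aff_BT a b)).
have -> : mu A = nu A.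
  apply: lebesgue_measure_unique => //.
  move=> X [[c d] _ <-]; 
  change (mu `]c, d] = `|a|%:E * mu (aff a b @^-1` `]c, d]))%E; rewrite aff_itv//.
  by rewrite muleA -EFinM divff ?mul1e// normr_eq0.
change (mu (aff a b @^-1` A) =
  `|a|^-1%:E * (`|a|%:E * mu (aff a b @^-1` A)))%E.
by rewrite muleA -EFinM mulVf ?mul1e// normr_eq0.
Qed.

Lemma aff_null (a b : R) (N : set LT) : a != 0 -> (leb).-negligible N ->
  (leb).-negligible (aff a b @^-1` N).
Proof.
move=> a0 /leb_null_borel[B [mB B0 NB]].
exists (aff a b @^-1` B); split.
- by apply: borel_LT; rewrite -[X in measurable X]setTI; exact: measurable_aff_BT.
- by rewrite [LHS](aff_borel b a0 mB) B0 mule0.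
- by move=> x; exact: NB.
Qed.

Lemma aff_ae (a b : R) (P : R -> Prop) : a != 0 ->
  {ae leb, forall x, P x} -> {ae leb, forall x, P (aff a b x)}.
Proof. by move=> a0; exact: (aff_null b a0). Qed.

(** The Borel case handles [B]; the rest of [A] lies in the Borel null set [N], whose preimage is
    again null. *)
Lemma aff_LT (a b : R) (A : set LT) : a != 0 -> measurable A ->
  measurable (aff a b @^-1` A : set LT) /\
  leb (aff a b @^-1` A) = (`|a|^-1%:E * leb A)%E.
Proof.
move=> a0 mA; have [B [N [mB mN N0 [BA AN]]]] := LT_decomp mA.
have AE : A = B `|` (A `\` B).
  by rewrite setDUK.
have maff (E : set R) : measurable (E : set BT) -> measurable (aff a b @^-1` E : set BT).
  by move=> mE; rewrite -[X in measurable X]setTI; exact: measurable_aff_BT.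
have [mAB AB0] := leb_negligible mN N0 AN.
have [mAB' AB0'] : measurable (aff a b @^-1` (A `\` B) : set LT) /\
    leb (aff a b @^-1` (A `\` B)) = 0%E.
  apply: (leb_negligible (maff _ mN)); first by rewrite aff_borel// N0 mule0.
  by move=> x; exact: AN.
have E : aff a b @^-1` A = aff a b @^-1` B `|` aff a b @^-1` (A `\` B).
  by rewrite {1}AE preimage_setU.
have mB' := borel_LT (maff _ mB).
split; first by rewrite E; exact: measurableU.
have U (C D : set LT) : measurable C -> measurable D -> leb D = 0%E ->
    leb (C `|` D) = leb C.
  by move=> mC mD D0; exact: measureU0.
have -> : leb A = leb B by rewrite {1}AE U//; exact: borel_LT.
by rewrite E U//; exact: aff_borel.
Qed.

Lemma measurable_aff (a b : R) : a != 0 ->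
  measurable_fun [set: LT] (aff a b : LT -> LT).
Proof. by move=> a0 _ A mA; rewrite setTI; exact: (aff_LT b a0 mA).1. Qed.

Lemma integ_aff (a b : R) (f : LT -> R) : a != 0 -> integ leb f ->
  integ leb (fun x => f (aff a b x)).
Proof.
move=> a0; apply: (integ_scaling (normr_ge0 a^-1) (measurable_aff b a0)) => A mA.
by rewrite normfV; exact: (aff_LT b a0 mA).2.
Qed.

Lemma Rint_aff (a b : R) (f : LT -> R) : a != 0 -> integ leb f ->
  \int[leb]_x f (aff a b x) = `|a|^-1 * \int[leb]_x f x.
Proof.
move=> a0; rewrite -normfV.
apply: (Rint_scaling (normr_ge0 a^-1) (measurable_aff b a0)) => A mA.
by rewrite normfV; exact: (aff_LT b a0 mA).2.
Qed.

End Lebesgue.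

(** * Sine and cosine transforms in L2 *)

Section PoissonKernel.
Context {R : realType}.
Notation mu := (@lebesgue_measure R).
Notation LT := (@LT R).
Notation leb := (@leb R).
Implicit Types eps t x : R.

Lemma is_derive_mulr (c x : R) : is_derive x 1 (fun y => c * y) c.
Proof.
have := @is_deriveZ R R R id c x 1 1 (is_derive_id x 1).
by rewrite /GRing.scale /= mulr1.
Qed.

(** An even integrable factor that tends to 1 as [eps] tends to 0 and whose cosine transform
    [pois eps] is elementary. *)
Definition damp eps x : R := expR (- (eps * `|x|)).

Lemma damp_gt0 eps x : 0 < damp eps x. Proof. exact: expR_gt0. Qed.

Lemma continuous_mulr (c : R) : continuous (fun x : R => c * x).
Proof. by move=> x; apply: continuousM; [exact: cst_continuous|exact: cvg_id]. Qed.

Lemma continuous_damp eps : continuous (damp eps).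
Proof.
move=> x; rewrite /damp; apply: (@continuous_comp _ _ _ (fun x => - (eps * `|x|)) expR).
  apply: continuousN; apply: (@continuous_comp _ _ _ (fun x : R => `|x|) (fun y => eps * y)).
    exact: norm_continuous.
  exact: continuous_mulr.
exact: continuous_expR.
Qed.

Lemma damp_le1 eps x : 0 <= eps -> damp eps x <= 1.
Proof. by move=> e0; rewrite /damp -expR0 ler_expR oppr_le0 mulr_ge0. Qed.

(** This is 2 pi times the Poisson kernel of the upper half-plane at height [eps]. *)
Definition pois eps t : R := 2 * eps / (eps ^+ 2 + t ^+ 2).

Lemma pois_ge0 eps t : 0 <= eps -> 0 <= pois eps t.
Proof. by move=> e0; rewrite divr_ge0 ?addr_ge0 ?sqr_ge0 ?mulr_ge0. Qed.

Lemma cvg_expRN_mul eps : 0 < eps -> expR (- (eps * x)) @[x --> +oo] --> (0 : R).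
Proof.
move=> e0; have h : (fun x => eps * x) x @[x --> +oo] --> +oo.
  exact: gt0_cvgMry.
exact: (cvg_comp _ _ h (@cvgr_expR R)).
Qed.

(** The summand 1 makes the integrand nonnegative, so that its integral over the half-line can be
    read off a primitive. The case [t = 0] gives twice the integral of [damp eps], and
    [Rint_damp_cos] subtracts that integral afterwards. *)
Lemma damp_cos_primitive eps t x : 0 < eps ->
  is_derive x 1 (fun x => - (expR (- (eps * x)) / eps) +
     expR (- (eps * x)) * ((t * sin (t * x) - eps * cos (t * x)) / (eps ^+ 2 + t ^+ 2)))
   (expR (- (eps * x)) * (1 + cos (t * x))).
Proof.
move=> e0.
have dE : is_derive x 1 (fun x => expR (- (eps * x))) (expR (- (eps * x)) * - eps).
  apply: (@is_derive1_comp R expR (fun x => - (eps * x))).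
  by apply: is_deriveN; exact: is_derive_mulr.
have dS : is_derive x 1 (fun x => sin (t * x)) (cos (t * x) * t).
  by apply: (@is_derive1_comp R sin (fun x => t * x)); exact: is_derive_mulr.
have dC : is_derive x 1 (fun x => cos (t * x)) (- sin (t * x) * t).
  by apply: (@is_derive1_comp R cos (fun x => t * x)); exact: is_derive_mulr.
have D0 : eps ^+ 2 + t ^+ 2 != 0.
  by rewrite gt_eqF// ltr_pwDl ?sqr_ge0// exprn_gt0.
pose k1 : R := - eps^-1; pose k2 := t / (eps ^+ 2 + t ^+ 2); pose k3 := eps / (eps ^+ 2 + t ^+ 2).
have := is_deriveD (is_deriveZ k1 dE)
   (is_deriveM dE (is_deriveB (is_deriveZ k2 dS) (is_deriveZ k3 dC))).
have -> : (k1 *: (fun x0 : R => expR (- (eps * x0))) + (fun x0 : R => expR (- (eps * x0))) *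
    (k2 *: (fun x0 : R => sin (t * x0)) - k3 *: (fun x0 : R => cos (t * x0)))) =
  (fun x => - (expR (- (eps * x)) / eps) +
     expR (- (eps * x)) * ((t * sin (t * x) - eps * cos (t * x)) / (eps ^+ 2 + t ^+ 2))).
  have aux (E S C : R) : - eps^-1 * E + E * (t / (eps ^+ 2 + t ^+ 2) * S -
      eps / (eps ^+ 2 + t ^+ 2) * C) =
      - (E / eps) + E * ((t * S - eps * C) / (eps ^+ 2 + t ^+ 2)).
    by field; rewrite D0 gt_eqF.
  by apply/funext => y; exact: aux.
move/is_derive_eq; apply.
have aux (E S C : R) : - eps^-1 * (E * - eps) + (E * (t / (eps ^+ 2 + t ^+ 2) * (C * t) -
      eps / (eps ^+ 2 + t ^+ 2) * (- S * t)) + (t / (eps ^+ 2 + t ^+ 2) * S -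
      eps / (eps ^+ 2 + t ^+ 2) * C) * (E * - eps)) = E * (1 + C).
  by field; rewrite D0 gt_eqF.
exact: aux.
Qed.

Lemma integral_damp_1cos eps t : 0 < eps ->
  (\int[mu]_x (damp eps x * (1 + cos (t * x)))%:E = (2 / eps + pois eps t)%:E)%E.
Proof.
move=> e0.
have D0 : 0 < eps ^+ 2 + t ^+ 2 by rewrite ltr_pwDl ?sqr_ge0// exprn_gt0.
have f0 x : 0 <= damp eps x * (1 + cos (t * x)).
  by rewrite mulr_ge0 ?(ltW (damp_gt0 _ _))//; have := cos_geN1 (t * x); lra.
have cf : continuous (fun x => damp eps x * (1 + cos (t * x))).
  move=> x; apply: continuousM; first exact: continuous_damp.
  apply: continuousD; first exact: cst_continuous.
  by apply: (@continuous_comp _ _ _ (fun x => t * x) cos);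
    [exact: continuous_mulr|exact: continuous_cos].
rewrite ge0_symfun_integralT//; last first.
  by move=> x /=; rewrite /damp normrN mulrN cosN.
rewrite -set_itvcy.
pose F x := - (expR (- (eps * x)) / eps) +
     expR (- (eps * x)) * ((t * sin (t * x) - eps * cos (t * x)) / (eps ^+ 2 + t ^+ 2)).
have Fx x : 0 < x -> is_derive x 1 F (damp eps x * (1 + cos (t * x))).
  by move=> x0; rewrite /damp gtr0_norm//; exact: damp_cos_primitive.
have cF : F x @[x --> 0] --> F 0.
  have [dF _] := damp_cos_primitive t 0 e0.
  by apply: differentiable_continuous; apply/derivable1_diffP.
have cvgF : F x @[x --> +oo] --> (0 : R).
  have E := cvg_expRN_mul e0.
  have E1 : - (expR (- (eps * x)) / eps) @[x --> +oo] --> (0 : R).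
    rewrite -[X in _ --> X]oppr0 -[X in _ --> - X](mul0r eps^-1).
    by apply: cvgN; apply: cvgMl.
  rewrite -[X in _ --> X]addr0; apply: cvgD => //.
  apply/norm_cvg0P.
  pose K := (`|t| + eps) / (eps ^+ 2 + t ^+ 2).
  apply: (@squeeze_cvgr _ _ _ _ (cst 0) (fun x => K * expR (- (eps * x)))); last 2 first.
  - exact: cvg_cst.
  - by rewrite -[X in _ --> X](mulr0 K); apply: cvgMr.
  near=> x; rewrite normr_ge0 /= normrM (ger0_norm (expR_ge0 _)) mulrC.
  apply: ler_wpM2r; first exact: expR_ge0.
  rewrite normrM [X in _ * X <= _]ger0_norm ?invr_ge0 ?(ltW D0)//.
  apply: ler_wpM2r; first by rewrite invr_ge0 (ltW D0).
  apply: (le_trans (ler_normB _ _)); rewrite !normrM (gtr0_norm e0); apply: lerD.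
    by rewrite -[leRHS]mulr1 ler_wpM2l// sin_max.
  by rewrite -[leRHS]mulr1 ler_wpM2l ?(ltW e0)// cos_max.
rewrite (ge0_continuous_FTC2y (F := F) (l := 0)).
- rewrite /F mulr0 oppr0 expR0 mulr0 sin0 cos0 mulr0 mulr1 sub0r -EFinB -EFinM.
  by congr EFin; rewrite /pois; field; rewrite !gt_eqF.
- by move=> x _.
- exact: continuous_subspaceT.
- exact: cvgF.
- by move=> x x0; have [] := Fx x x0.
- exact: cvg_at_right_filter.
- by move=> x; rewrite in_itv/= andbT => x0; rewrite derive1E; have [] := Fx x x0.
Unshelve. all: by end_near. Qed.

Lemma ge0_continuous_leb (f : R -> R) (v : R) : continuous f ->
  (forall x, 0 <= f x) -> (\int[mu]_x (f x)%:E = v%:E)%E ->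
  integ leb f /\ \int[leb]_x f x = v.
Proof.
move=> cf f0 fv; have mf := continuous_measurable_fun cf.
have E : (\int[leb]_x (f x)%:E = v%:E)%E.
  rewrite -fv; apply: ge0_integral_leb => //.
    by apply/measurable_EFinP.
  by move=> x _; rewrite lee_fin.
split; last by rewrite /Rintegral E.
by apply: (integ_ge0P (continuous_LT cf) f0); rewrite E ltry.
Qed.

Lemma damp_int eps : 0 < eps ->
  integ leb (damp eps) /\ \int[leb]_x damp eps x = 2 / eps.
Proof.
move=> e0.
have c : continuous (fun x => damp eps x * (1 + cos (0 * x))).
  under eq_fun do rewrite mul0r cos0.
  by move=> x; apply: continuousM; [exact: continuous_damp|exact: cst_continuous].
have p x : 0 <= damp eps x * (1 + cos (0 * x)).
  by rewrite mul0r cos0 mulr_ge0// ltW// damp_gt0.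
have [] := ge0_continuous_leb c p (integral_damp_1cos 0 e0).
under [X in integ _ X -> _]eq_fun do rewrite mul0r cos0.
move=> fi H0; have di : integ leb (damp eps).
  have := integZ (1 + 1)^-1 fi; congr (integ leb _); apply/funext => x.
  by field.
move: H0; under eq_Rint do rewrite mul0r cos0.
have -> : \int[leb]_x (damp eps x * (1 + 1)) = (1 + 1) * \int[leb]_x damp eps x.
  by rewrite -RintZ//; apply: eq_Rint => x; rewrite mulrC.
move=> H; split => //; move: H => /(congr1 (fun z => 2^-1 * z)).
rewrite mulrA (_ : 2^-1 * (1 + 1) = 1); last by field.
by rewrite mul1r => ->; rewrite /pois; field; rewrite gt_eqF.
Qed.

Lemma Rint_damp_cos eps t : 0 < eps ->
  \int[leb]_x (damp eps x * cos (t * x)) = pois eps t.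
Proof.
move=> e0; have [di dv] := damp_int e0.
have cc : continuous (fun x => cos (t * x)).
  by move=> x; apply: (@continuous_comp _ _ _ (fun x => t * x) cos);
    [exact: continuous_mulr|exact: continuous_cos].
have c : continuous (fun x => damp eps x * (1 + cos (t * x))).
  move=> x; apply: continuousM; first exact: continuous_damp.
  by apply: continuousD; [exact: cst_continuous|exact: cc].
have p x : 0 <= damp eps x * (1 + cos (t * x)).
  apply: mulr_ge0; first exact: ltW (damp_gt0 _ _).
  by rewrite -lerBlDl sub0r cos_geN1.
have [] := ge0_continuous_leb c p (integral_damp_1cos t e0).
have ci : integ leb (fun x => damp eps x * cos (t * x)).
  apply: (integ_mulb di (M := 1)); first exact: continuous_LT.
  by move=> x; exact: cos_max.
move=> _; under eq_Rint do rewrite mulrDr mulr1.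
by rewrite RintD// dv => /addrI.
Qed.

Lemma pois_aff eps x y : 0 < eps ->
  pois eps (x + y) = 2 / eps * (1 + (aff eps^-1 (y / eps) x) ^+ 2)^-1.
Proof.
move=> e0; rewrite /pois /aff.
have D0 : eps ^+ 2 + (x + y) ^+ 2 != 0.
  by rewrite gt_eqF// ltr_pwDl ?sqr_ge0// exprn_gt0.
have -> : 1 + (eps^-1 * x + y / eps) ^+ 2 = (eps ^+ 2 + (x + y) ^+ 2) / eps ^+ 2.
  by field; rewrite gt_eqF.
by field; rewrite D0 gt_eqF.
Qed.

Lemma oneDsqrV_int : integ leb (fun x => (1 + x ^+ 2)^-1) /\
  \int[leb]_x (1 + x ^+ 2)^-1 = pi.
Proof.
have c : continuous (fun x : R => (1 + x ^+ 2)^-1) by exact: continuous_oneDsqrV.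
have p x : 0 <= (1 + x ^+ 2)^-1 :> R by rewrite invr_ge0 addr_ge0// sqr_ge0.
apply: (ge0_continuous_leb c p).
rewrite ge0_symfun_integralT//; last by move=> x /=; rewrite sqrrN.
by rewrite -set_itvcy integral0y_oneDsqr -EFinM; congr EFin; field.
Qed.

(** An affine substitution reduces the kernel to 1 / (1 + x^2). That the mass does not depend on
    [eps] is what keeps the Schur bound uniform while the damping is removed. *)
Lemma pois_int eps y : 0 < eps -> integ leb (fun x => pois eps (x + y)) /\
  \int[leb]_x pois eps (x + y) = 2 * pi.
Proof.
move=> e0; have [oi ov] := oneDsqrV_int.
have e1 : eps^-1 != 0 by rewrite invr_eq0 gt_eqF.
have ai := integ_aff (y / eps) e1 oi.
under [X in integ _ X]eq_fun do rewrite (pois_aff _ _ e0).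
split; first exact: integZ.
under eq_Rint do rewrite (pois_aff _ _ e0).
rewrite RintZ// (Rint_aff (y / eps) e1 oi) ov gtr0_norm ?invr_gt0//.
by field; rewrite gt_eqF.
Qed.

Lemma poisN eps t : pois eps (- t) = pois eps t.
Proof. by rewrite /pois sqrrN. Qed.

End PoissonKernel.

(** * Schur test: the kernel [k] composed with its adjoint under the weight [e] is dominated by a
    symmetric [K] of mass at most [N] *)

Section SchurTest.
Context d1 d2 (T1 : measurableType d1) (T2 : measurableType d2) (R : realType).
Variables (m1 : {sigma_finite_measure set T1 -> \bar R})
          (m2 : {sigma_finite_measure set T2 -> \bar R}).
Variables (k : T1 -> T2 -> R) (K : T2 -> T2 -> R) (e : T1 -> R) (h : T2 -> R).
Variables (M MK N : R).
Hypotheses (kk : kernel k M) (ei : integ m1 e) (kK : kernel K MK).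
Hypotheses (K0 : forall x y, 0 <= K x y) (Ksym : forall x y, K x y = K y x).
Hypotheses (Ki : forall x, integ m2 (K x)) (KN : forall x, \int[m2]_y K x y <= N).
Hypothesis keK : forall x y, `|\int[m1]_z (k z y * (k z x * e z))| <= K x y.
Hypotheses (hi : integ m2 h) (h2i : integ m2 (fun y => h y ^+ 2)).

Let H x := \int[m2]_y (k x y * h y).
Let J x := \int[m2]_y (K x y * h y ^+ 2).

(** By Tonelli and the symmetry of [K], integrating [J] leaves [h y ^+ 2] times the mass of
    [K y]. *)
Let J_int : integ m2 J /\ \int[m2]_x J x <= N * \int[m2]_y h y ^+ 2.
Proof.
have mh2 := integ_measurable h2i; have [mK _] := kK.
have mJ : measurable_fun setT J by exact: measurable_kernel_int _ kK mh2.
have J0 x : 0 <= J x by apply: Rint_ge0 => y; rewrite mulr_ge0 ?sqr_ge0.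
have le : (\int[m2]_x (J x)%:E <= (N * \int[m2]_y h y ^+ 2)%:E)%E.
  pose F (z : T2 * T2) := (K z.1 z.2 * h z.2 ^+ 2)%:E : \bar R.
  have E x : (J x)%:E = (\int[m2]_y F (x, y))%E.
    by rewrite /J -integ_fin//; exact: kernel_integ kK _.
  under eq_integral => x _ do rewrite E.
  rewrite fubini_tonelli; last 2 first.
  - apply/measurable_EFinP; apply: measurable_funM => //.
    exact: (measurableT_comp mh2).
  - by move=> z; rewrite lee_fin mulr_ge0 ?sqr_ge0.
  have E2 y : (\int[m2]_x F (x, y) = (h y ^+ 2 * \int[m2]_x K y x)%:E)%E.
    rewrite -RintZ// -integ_fin; last exact: integZ.
    by apply: eq_integral => x _; rewrite /F /= mulrC Ksym.
  under eq_integral => y _ do rewrite E2.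
  rewrite -RintZ// -integ_fin; last exact: integZ.
  apply: ge0_le_integral => //.
  - by move=> y _; rewrite lee_fin mulr_ge0 ?sqr_ge0// Rint_ge0.
  - apply/measurable_EFinP; apply: measurable_funM => //.
    have : measurable_fun setT (fun y => \int[m2]_x (K y x * 1)).
      exact: (measurable_kernel_int _ kK (measurable_cst (1 : R))).
    by congr (measurable_fun _ _); apply/funext => y; apply: eq_Rint => x; rewrite mulr1.
  - by apply/measurable_EFinP; exact: measurable_funM.
  - by move=> y _; rewrite lee_fin mulrC ler_wpM2r ?sqr_ge0.
have Ji : integ m2 J by apply: integ_ge0P => //; rewrite (le_lt_trans le)// ltry.
by split => //; rewrite -lee_fin -integ_fin.
Qed.

(* Expanding the square of H leaves h x * h y against a kernel dominated by K, and
   |h x * h y| <= (h x ^+ 2 + h y ^+ 2) / 2. *)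
Lemma schur_test : integ m1 (fun x => H x ^+ 2 * e x) /\
  \int[m1]_x (H x ^+ 2 * e x) <= N * \int[m2]_y h y ^+ 2.
Proof.
have mh := integ_measurable hi; have me := integ_measurable ei.
have mH : measurable_fun setT H by exact: measurable_kernel_int _ kk mh.
have Hb x : `|H x| <= M * \int[m2]_y `|h y| by exact: kernel_int_bound kk hi.
have eHi : integ m1 (fun x => e x * H x) by exact: integ_mulb ei mH Hb.
split.
  have := integ_mulb eHi mH Hb; congr (integ m1 _).
  by apply/funext => x; rewrite expr2; ring.
have [Ji Jle] := J_int.
rewrite (@eq_Rint _ _ _ _ _ (fun x => (e x * H x) * \int[m2]_y (k x y * h y))); last first.
  by move=> x; rewrite -/(H x); ring.
rewrite (kernel_swap kk eHi hi).
(* Integrating [K x y * (h x ^+ 2 + h y ^+ 2) / 2] in [y] gives at most [g x], because [K x] has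
   mass at most [N]. *)
pose g x := 2^-1 * (N * h x ^+ 2) + 2^-1 * J x.
have gi : integ m2 g by apply: integD; apply: integZ => //; exact: integZ.
apply: (@le_trans _ _ (\int[m2]_x g x)); last first.
  rewrite RintD; [|by apply: integZ; exact: integZ|exact: integZ].
  by rewrite !RintZ//; [lra|exact: integZ].
apply: le_trans (ler_norm _) _; apply: le_norm_Rint => //.
  apply: measurable_funM => //.
  have kk' : kernel (fun y x => k x y) M.
    split; last by move=> x y; exact: kk.2.
    by have := measurableT_comp kk.1 (@measurable_swap _ _ T2 T1).
  exact: (measurable_kernel_int _ kk' (integ_measurable eHi)).
move=> x.
have kei : integ m1 (fun z => k z x * e z).
  under [X in integ m1 X]eq_fun do rewrite mulrC.
  exact: integ_mulb ei (kernel_measurable2 x kk) (kk.2 ^~ x).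
rewrite (@eq_Rint _ _ _ _ _ (fun z => (k z x * e z) * \int[m2]_y (k z y * h y))); last first.
  by move=> z; rewrite -/(H z); ring.
rewrite (kernel_swap kk kei hi).
have Kh2 : integ m2 (fun y => K x y * h y ^+ 2) by exact: kernel_integ kK _.
have Ri : integ m2 (fun y => 2^-1 * (h x ^+ 2 * K x y) + 2^-1 * (K x y * h y ^+ 2)).
  by apply: integD; apply: integZ => //; exact: integZ.
have mq : measurable_fun setT (fun y => \int[m1]_z (k z y * (k z x * e z))).
  have kk' : kernel (fun y x => k x y) M.
    split; last by move=> a b; exact: kk.2.
    by have := measurableT_comp kk.1 (@measurable_swap _ _ T2 T1).
  exact: (measurable_kernel_int _ kk' (integ_measurable kei)).
have hqi : integ m2 (fun y => h y * \int[m1]_z (k z y * (k z x * e z))).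
  apply: (integ_mulb hi mq (M := MK)) => y.
  by apply: le_trans (keK x y) _; apply: le_trans (ler_norm _) (kK.2 _ _).
rewrite -RintZ//.
apply: (@le_trans _ _ (\int[m2]_y (2^-1 * (h x ^+ 2 * K x y) + 2^-1 * (K x y * h y ^+ 2)))).
  apply: le_norm_Rint => //.
    by apply: measurable_funM => //; exact: measurable_funM.
  move=> y; rewrite mulrA normrM.
  apply: le_trans (ler_wpM2l (normr_ge0 _) (keK x y)) _.
  rewrite normrM; have := K0 x y; have := sqr_ge0 (`|h x| - `|h y|).
  rewrite -(real_normK (num_real (h x))) -(real_normK (num_real (h y))).
  nra.
rewrite RintD; [|by apply: integZ; exact: integZ|exact: integZ].
rewrite !RintZ//; last exact: integZ.
rewrite /g lerD2r ler_wpM2l// mulrC ler_wpM2r ?sqr_ge0//.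
Qed.

End SchurTest.

(** * Cosine and sine transforms and their L2 bound *)

Section Plancherel.
Context {R : realType}.
Notation LT := (@LT R).
Notation leb := (@leb R).

(** With this encoding [(-1) ^+ b] is the parity of the function, and cosine and sine share their
    proofs. *)
Definition cs (b : bool) (t : R) : R := if b then sin t else cos t.

Lemma cs_max b t : `|cs b t| <= 1.
Proof. by case: b; [exact: sin_max|exact: cos_max]. Qed.

Lemma continuous_cs b : continuous (cs b).
Proof. by case: b; [exact: continuous_sin|exact: continuous_cos]. Qed.

Lemma measurable_fst_LT : measurable_fun [set: LT * LT] (fun z : LT * LT => z.1 : R).
Proof.
exact: (measurableT_comp (continuous_LT (f := idfun) (fun x => cvg_id)) measurable_fst).
Qed.

Lemma measurable_snd_LT : measurable_fun [set: LT * LT] (fun z : LT * LT => z.2 : R).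
Proof.
exact: (measurableT_comp (continuous_LT (f := idfun) (fun x => cvg_id)) measurable_snd).
Qed.

Lemma kernel_cs b : kernel (fun x y : LT => cs b ((x : R) * (y : R))) 1.
Proof.
split; last by move=> x y; exact: cs_max.
apply: (measurableT_comp (continuous_measurable_fun (@continuous_cs b))).
exact: (measurable_funM measurable_fst_LT measurable_snd_LT).
Qed.

(** This kernel dominates both transforms: by [Rint_cscs] the composed kernel is the half sum of the
    two Poisson kernels for the cosine and their half difference for the sine. *)
Lemma kernel_pois eps : 0 < eps -> kernel (fun x y : LT =>
  2^-1 * (pois eps ((x : R) - (y : R)) + pois eps ((x : R) + (y : R)))) (2 / eps).
Proof.
move=> e0.
have D0 (t : R) : 0 < eps ^+ 2 + t ^+ 2 by rewrite ltr_pwDl ?sqr_ge0// exprn_gt0.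
have pb (t : R) : pois eps t <= 2 / eps.
  rewrite /pois ler_pdivrMr// mulrAC ler_pdivlMr//.
  by rewrite -mulrA ler_wpM2l// -expr2 lerDl sqr_ge0.
have cp : continuous (fun t : R => 2 * eps / (eps ^+ 2 + t ^+ 2)).
  move=> t; apply: (@continuousM _ _ (fun=> 2 * eps) (fun t : R => (eps ^+ 2 + t ^+ 2)^-1)).
    exact: cst_continuous.
  apply: (@continuousV _ _ (fun t : R => eps ^+ 2 + t ^+ 2)); first by rewrite gt_eqF.
  by apply: continuousD; [exact: cst_continuous|exact: exprn_continuous].
have mp := continuous_measurable_fun cp.
split.
  apply: measurable_funM; first exact: measurable_cst.
  apply: measurable_funD; apply: (measurableT_comp mp).
    exact: (measurable_funB measurable_fst_LT measurable_snd_LT).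
  exact: (measurable_funD measurable_fst_LT measurable_snd_LT).
move=> x y; rewrite ger0_norm; last first.
  by rewrite mulr_ge0// addr_ge0// pois_ge0// ltW.
by have := pb (x - y); have := pb (x + y); lra.
Qed.

Definition TR b (h : R -> R) (x : R) : R := \int[leb]_y (cs b (x * y) * h y).

Lemma measurable_TR b (h : LT -> R) : measurable_fun setT h ->
  measurable_fun [set: LT] (TR b h).
Proof. exact: measurable_kernel_int _ (kernel_cs b). Qed.

Lemma TR_bound b (h : LT -> R) (x : LT) : integ leb h -> `|TR b h x| <= \int[leb]_y `|h y|.
Proof.
by move=> hi; have := kernel_int_bound x (kernel_cs b) hi; rewrite mul1r.
Qed.

(** The product-to-sum formulas reduce both cases to the cosine transform of [damp eps]. *)
Lemma Rint_cscs b eps x y : 0 < eps ->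
  \int[leb]_z (cs b (z * y) * (cs b (z * x) * damp eps z)) =
  2^-1 * (pois eps (x - y) + (-1) ^+ b * pois eps (x + y)).
Proof.
move=> e0; have [di _] := damp_int e0.
have ic t : integ leb (fun z => damp eps z * cos (t * z)).
  apply: (integ_mulb di (M := 1)); last by move=> z; exact: cos_max.
  apply: continuous_LT => z; apply: (@continuous_comp _ _ _ (fun z => t * z) cos).
    exact: continuous_mulr.
  exact: continuous_cos.
rewrite -!Rint_damp_cos// -RintZ// -RintD//; last exact: integZ.
rewrite -RintZ; last by apply: integD => //; exact: integZ.
apply: eq_Rint => z; rewrite (mulrC z y) (mulrC z x).
have -> : (x - y) * z = x * z - y * z by ring.
have -> : (x + y) * z = x * z + y * z by ring.
rewrite cosB cosD.
by case: b; rewrite /cs /= ?expr1 ?expr0; field.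
Qed.

Lemma cvg_damp1 (x : R) : damp n.+1%:R^-1 x @[n --> \oo] --> (1 : R).
Proof.
have : - (n.+1%:R^-1 * `|x|) @[n --> \oo] --> - (0 * `|x|).
  by apply: cvgN; apply: cvgM; [exact: cvg_harmonic|exact: cvg_cst].
rewrite mul0r oppr0 => h; have := cvg_comp _ _ h (@continuous_expR R 0).
by rewrite expR0.
Qed.

(* With the damping factor the kernel of the Schur test is a combination of Poisson
   kernels, of mass at most 2 pi; Fatou's lemma removes the damping. *)
Lemma TR_L2 b (h : LT -> R) : integ leb h -> integ leb (fun x => h x ^+ 2) ->
  integ leb (fun x => TR b h x ^+ 2) /\
  \int[leb]_x TR b h x ^+ 2 <= 2 * pi * \int[leb]_x h x ^+ 2.
Proof.
move=> hi h2i; have mh := integ_measurable hi.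
have mT := measurable_TR b mh.
have key (n : nat) : integ leb (fun x => TR b h x ^+ 2 * damp n.+1%:R^-1 x) /\
    \int[leb]_x (TR b h x ^+ 2 * damp n.+1%:R^-1 x) <= 2 * pi * \int[leb]_x h x ^+ 2.
  have e0 : 0 < n.+1%:R^-1 :> R by rewrite invr_gt0.
  move: (n.+1%:R^-1) e0 => eps e0.
  have [di _] := damp_int e0.
  pose K (x y : LT) := 2^-1 * (pois eps ((x : R) - (y : R)) + pois eps ((x : R) + (y : R))).
  have Kint x : integ leb (K x) /\ \int[leb]_y K x y = 2 * pi.
    have [p1 v1] := pois_int (- x) e0; have [p2 v2] := pois_int x e0.
    have E : K x = (fun y => 2^-1 * (pois eps (y - x) + pois eps (y + x))).
      by apply/funext => y; rewrite /K -(poisN _ (x - y)) opprB (addrC x).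
    rewrite E; split; first by apply: integZ; exact: integD.
    by rewrite RintZ ?RintD ?v1 ?v2//; [field|exact: integD].
  have K0 x y : 0 <= K x y.
    by rewrite /K mulr_ge0// addr_ge0// pois_ge0// ltW.
  have Ks x y : K x y = K y x.
    by rewrite /K -(poisN _ (x - y)) opprB (addrC x y).
  apply: (schur_test (kernel_cs b) di (kernel_pois e0) K0 Ks
    (fun x => (Kint x).1) _ _ hi h2i).
    by move=> x; rewrite (Kint x).2.
  move=> x y; rewrite Rint_cscs// normrM ger0_norm// ler_wpM2l//.
  apply: (le_trans (ler_normD _ _)); rewrite normrMsign.
  by rewrite !ger0_norm// pois_ge0// ltW.
have le : (\int[leb]_x (TR b h x ^+ 2)%:E <= (2 * pi * \int[leb]_x h x ^+ 2)%:E)%E.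
  apply: (@le_integral_fatou _ LT R leb (fun (n : nat) (x : LT) => TR b h x ^+ 2 * damp n.+1%:R^-1 x) (fun x : LT => TR b h x ^+ 2)).
  - by move=> n; exact: integ_measurable (key n).1.
  - by move=> n x; rewrite mulr_ge0 ?sqr_ge0// ltW// damp_gt0.
  - move=> x; rewrite -[X in _ --> X]mulr1; apply: cvgM; first exact: cvg_cst.
    exact: cvg_damp1.
  - by move=> n; rewrite integ_fin ?lee_fin; [exact: (key n).2|exact: (key n).1].
have Ti : integ leb (fun x => TR b h x ^+ 2).
  apply: (integ_ge0P (measurable_funX 2 mT) (fun x => sqr_ge0 _)).
  by rewrite (le_lt_trans le)// ltry.
by split => //; rewrite -lee_fin -integ_fin.
Qed.

End Plancherel.

Section L2Pairing.
Context d (T : measurableType d) (R : realType) (m : {measure set T -> \bar R}).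

(** The weighted inequality p q <= (l p^2 + q^2 / l) / 2 plays the part of Cauchy-Schwarz. *)
Lemma cvg_Rint_L2 (g_ : nat -> T -> R) (w u : T -> R) :
  (forall n, measurable_fun setT (g_ n)) -> measurable_fun setT w ->
  measurable_fun setT u -> integ m (fun x => w x ^+ 2) ->
  integ m (fun x => u x ^+ 2) ->
  (\int[m]_x ((g_ n x - w x) ^+ 2)%:E)%E @[n --> \oo] --> 0%E ->
  \int[m]_x (g_ n x * u x) @[n --> \oo] --> \int[m]_x (w x * u x).
Proof.
move=> mg mw mu w2 u2 gw; apply/cvgrPdist_le => e e0.
set U := \int[m]_x u x ^+ 2.
have U0 : 0 <= U by apply: Rint_ge0 => x; exact: sqr_ge0.
(* With this [l] one has [U / l <= e], and the threshold [e / l] makes the other term at most [e];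
   both enter with the factor 1/2. The summand 1 keeps [l] positive when [U] is 0. *)
pose l := (U + 1) / e.
have l0 : 0 < l by rewrite divr_gt0// ltr_pwDr.
have el0 : 0 < e / l by rewrite divr_gt0.
have : \forall n \near \oo, (\int[m]_x ((g_ n x - w x) ^+ 2)%:E < (e / l)%:E)%E.
  have /fine_cvgP[fn /cvgrPdist_lt/(_ _ el0) fc] := gw.
  apply: filterS2 fn fc => n fn; rewrite sub0r normrN => fc.
  by rewrite -(fineK fn) lte_fin (le_lt_trans (ler_norm _)).
apply: filterS => n D.
have mgw : measurable_fun setT (fun x => g_ n x - w x) by exact: measurable_funB.
have d2 : integ m (fun x => (g_ n x - w x) ^+ 2).
  apply: integ_ge0P; first exact: measurable_funX.
    by move=> x; exact: sqr_ge0.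
  by rewrite (lt_le_trans D)// leey.
have du := integM2 mgw mu d2 u2.
have wu := integM2 mw mu w2 u2.
have gu : integ m (fun x => g_ n x * u x).
  have := integD du wu; congr (integ m _).
  by apply/funext => x; ring.
rewrite distrC -RintB//.
have E : (fun x => g_ n x * u x - w x * u x) = (fun x => (g_ n x - w x) * u x).
  by apply/funext => x; ring.
rewrite E.
have i1 : integ m (fun x => 2^-1 * (l * (g_ n x - w x) ^+ 2) + 2^-1 * (l^-1 * u x ^+ 2)).
  by apply: integD; apply: integZ; exact: integZ.
apply: (@le_trans _ _ (\int[m]_x (2^-1 * (l * (g_ n x - w x) ^+ 2) + 2^-1 * (l^-1 * u x ^+ 2)))).
  apply: (le_norm_Rint _ i1); first exact: integ_measurable du.
  move=> x; rewrite normrM -(real_normK (num_real (u x))).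
  rewrite -(real_normK (num_real (g_ n x - w x))).
  set p := `|_ - _|; set q := `|_|.
  rewrite -subr_ge0 (_ : _ - _ = 2^-1 * l * (p - q / l) ^+ 2).
    by rewrite mulr_ge0 ?sqr_ge0// mulr_ge0// ltW.
  by field; rewrite gt_eqF.
rewrite RintD; [|by apply: integZ; exact: integZ..].
rewrite !RintZ//; [|exact: integZ..]; rewrite -/U.
have h1 : l * \int[m]_x (g_ n x - w x) ^+ 2 <= e.
  rewrite mulrC -ler_pdivlMr// -lee_fin -integ_fin//; exact: ltW.
have h2 : l^-1 * U <= e.
  rewrite /l invf_div mulrAC ler_pdivrMr ?ltr_pwDr// ler_wpM2l ?(ltW e0)//.
  by rewrite lerDl.
lra.
Qed.

Lemma cvg_integral_sqr (f_ g_ : nat -> T -> R) :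
  (forall n, measurable_fun setT (f_ n)) -> (forall n, measurable_fun setT (g_ n)) ->
  (\int[m]_x (f_ n x ^+ 2 + g_ n x ^+ 2)%:E)%E @[n --> \oo] --> 0%E ->
  (\int[m]_x (f_ n x ^+ 2)%:E)%E @[n --> \oo] --> 0%E /\
  (\int[m]_x (g_ n x ^+ 2)%:E)%E @[n --> \oo] --> 0%E.
Proof.
move=> mf mg c; split; apply: (squeeze_cvge _ (cvg_cst 0%E) c);
  apply: nearW => n; (apply/andP; split;
    [by apply: integral_ge0 => x _; rewrite lee_fin sqr_ge0|]);
  apply: ge0_le_integral => //.
- by move=> x _; rewrite lee_fin sqr_ge0.
- by apply/measurable_EFinP; exact: measurable_funX.
- by apply/measurable_EFinP; apply: measurable_funD; exact: measurable_funX.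
- by move=> x _; rewrite lee_fin lerDl sqr_ge0.
- by move=> x _; rewrite lee_fin sqr_ge0.
- by apply/measurable_EFinP; exact: measurable_funX.
- by apply/measurable_EFinP; apply: measurable_funD; exact: measurable_funX.
- by move=> x _; rewrite lee_fin lerDr sqr_ge0.
Qed.

End L2Pairing.

Section ComplexParts.
Context {R : realType}.
Notation C := (complex.complex R).
Notation Re := complex.Re.
Notation Im := complex.Im.
Implicit Types z : C.

Lemma ReM z1 z2 : Re (z1 * z2) = Re z1 * Re z2 - Im z1 * Im z2.
Proof. by case: z1 z2 => a b [c d]. Qed.

Lemma ImM z1 z2 : Im (z1 * z2) = Re z1 * Im z2 + Im z1 * Re z2.
Proof. by case: z1 z2 => a b [c d]. Qed.

Lemma ReD z1 z2 : Re (z1 + z2) = Re z1 + Re z2.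
Proof. by case: z1 z2 => a b [c d]. Qed.

Lemma ImD z1 z2 : Im (z1 + z2) = Im z1 + Im z2.
Proof. by case: z1 z2 => a b [c d]. Qed.

Lemma ReN z : Re (- z) = - Re z. Proof. by case: z. Qed.

Lemma ImN z : Im (- z) = - Im z. Proof. by case: z. Qed.

Lemma complex_ext z1 z2 : Re z1 = Re z2 -> Im z1 = Im z2 -> z1 = z2.
Proof. by case: z1 z2 => a b [c d] /= -> ->. Qed.

Lemma cmod2 z : cmod z ^+ 2 = Re z ^+ 2 + Im z ^+ 2.
Proof. by rewrite sqr_sqrtr// addr_ge0// sqr_ge0. Qed.

End ComplexParts.

(** * The Fourier transform paired with test functions *)

Section FourierPairing.
Context {R : realType}.
Notation C := (complex.complex R).
Notation Re := complex.Re.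
Notation Im := complex.Im.
Notation LT := (@LT R).
Notation leb := (@leb R).
Notation c0 := (Num.sqrt (2 * pi))^-1.

Lemma L2_parts (f : R -> C) : L2 f ->
  [/\ measurable_fun setT (fun x : LT => Re (f x)),
      measurable_fun setT (fun x : LT => Im (f x)),
      integ leb (fun x : LT => Re (f x) ^+ 2) &
      integ leb (fun x : LT => Im (f x) ^+ 2)].
Proof.
move=> [[mr mi] f2]; have mr2 := measurable_funX 2 mr.
have mi2 := measurable_funX 2 mi.
have s : integ leb (fun x : LT => Re (f x) ^+ 2 + Im (f x) ^+ 2).
  apply: (integ_ge0P (measurable_funD mr2 mi2)).
    by move=> x; rewrite addr_ge0// sqr_ge0.
  rewrite [X in (X < _)%E](_ : _ =
      \int[leb]_x lf (fun x => ((cmod (f x)) ^+ 2)%:E) x)%E//.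
  by apply: eq_integral => x _; rewrite /lf cmod2.
split => //.
- by apply: (integ_le mr2 s) => x; rewrite ger0_norm ?sqr_ge0// lerDl sqr_ge0.
- by apply: (integ_le mi2 s) => x; rewrite ger0_norm ?sqr_ge0// lerDr sqr_ge0.
Qed.

Lemma TR_swap b (f g : LT -> R) : integ leb f -> integ leb g ->
  \int[leb]_x (f x * TR b g x) = \int[leb]_x (g x * TR b f x).
Proof.
move=> fi gi; rewrite (kernel_swap (kernel_cs b) fi gi).
apply: eq_Rint => y; congr (_ * _).
by apply: eq_Rint => x; congr (cs b _ * _); exact: mulrC.
Qed.

(** A square integrable function becomes integrable when cut off to [[-n, n]], the interval of
    [FTtrunc]. *)
Definition trunc (n : nat) (a : R -> R) (x : R) : R :=
  \1_(`[- n%:R, n%:R] : set R) x * a x.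

Lemma indic_itv_int (i j : R) :
  integ leb (fun x : LT => \1_(`[i, j] : set R) x) /\
  measurable_fun setT (fun x : LT => \1_(`[i, j] : set R) x : R).
Proof.
have mI : measurable (`[i, j]%classic : set (measurableTypeR R)) by exact: measurable_itv.
have mf : measurable_fun setT (fun x : LT => \1_(`[i, j] : set R) x : R).
  exact: (measurable_indic (borel_LT mI)).
split => //; apply: (integ_ge0P mf) => //.
have := @integral_indic _ LT R leb setT measurableT _ (borel_LT mI).
rewrite setIT => ->; rewrite [X in (X < _)%E](_ : _ = lebesgue_measure (`[i, j]%classic : set R))//.
by rewrite lebesgue_measure_itv; case: ifP; rewrite ?ltry// /= -EFinB ltry.
Qed.

Lemma trunc_int n (a : LT -> R) : measurable_fun setT a ->
  integ leb (fun x => a x ^+ 2) -> integ leb (trunc n a : LT -> R).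
Proof.
move=> ma a2; have [Ii mI] := indic_itv_int (- n%:R) n%:R.
apply: (integM2 mI ma _ a2); move: Ii; congr (integ _ _).
by apply/funext => x; rewrite indicE; case: (_ \in _); rewrite ?expr1n ?expr0n.
Qed.

Lemma cvg_trunc (a : R -> R) x : trunc n a x @[n --> \oo] --> a x.
Proof.
apply: cvg_near_cst; near=> n.
rewrite /trunc indicE mem_set ?mul1r//= in_itv/= -ler_norml.
by near: n; exact: nbhs_infty_ger.
Unshelve. all: by end_near. Qed.

Lemma trunc_le n (a : R -> R) x : `|trunc n a x| <= `|a x|.
Proof.
by rewrite /trunc indicE; case: (_ \in _); rewrite ?mul1r// mul0r normr0.
Qed.

Lemma FTtruncE (phi : R -> C) n xi : L2 phi ->
  Re (FTtrunc phi n xi) = c0 * (TR false (trunc n (fun x => Re (phi x))) xi +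
                                TR true (trunc n (fun x => Im (phi x))) xi) /\
  Im (FTtrunc phi n xi) = c0 * (TR false (trunc n (fun x => Im (phi x))) xi -
                                TR true (trunc n (fun x => Re (phi x))) xi).
Proof.
move=> /L2_parts[mr mi r2 i2].
have ri := trunc_int n mr r2; have ii := trunc_int n mi i2.
split.
- transitivity (c0 * \int[leb]_x (\1_(`[- n%:R, n%:R] : set R) x *
      Re (phi x * expi (- (xi * x))))).
    rewrite /FTtrunc ReM /= mul0r subr0; congr (_ * _).
    exact: (Rint_indic leb (ls `[- n%:R, n%:R])).
  congr (_ * _); rewrite -RintD; [|exact: kernel_integ (kernel_cs _) _..].
  apply: eq_Rint => x; rewrite /trunc ReM /= cosN sinN; ring.
- transitivity (c0 * \int[leb]_x (\1_(`[- n%:R, n%:R] : set R) x *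
      Im (phi x * expi (- (xi * x))))).
    rewrite /FTtrunc ImM /= mul0r addr0; congr (_ * _).
    exact: (Rint_indic leb (ls `[- n%:R, n%:R])).
  congr (_ * _); rewrite -RintB; [|exact: kernel_integ (kernel_cs _) _..].
  apply: eq_Rint => x; rewrite /trunc ImM /= cosN sinN; ring.
Qed.

(** L2 convergence of [FTtrunc phi n] gives the left-hand sides. For each [n] the transform moves
    onto [u] by [TR_swap]; since [TR b u] is square integrable by [TR_L2], its product with a part
    of [phi] is integrable and dominates the truncated products. *)
Lemma is_FT_pairing (phi phihat : R -> C) (u : LT -> R) :
  L2 phi -> is_FT phi phihat -> integ leb u -> integ leb (fun x => u x ^+ 2) ->
  \int[leb]_x (Re (phihat x) * u x) =
    c0 * (\int[leb]_x (Re (phi x) * TR false u x) +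
          \int[leb]_x (Im (phi x) * TR true u x)) /\
  \int[leb]_x (Im (phihat x) * u x) =
    c0 * (\int[leb]_x (Im (phi x) * TR false u x) -
          \int[leb]_x (Re (phi x) * TR true u x)).
Proof.
move=> L2phi [L2h FT] ui u2; have mu := integ_measurable ui.
have [mr mi r2 i2] := L2_parts L2phi; have [mr' mi' r2' i2'] := L2_parts L2h.
have ri n := trunc_int n mr r2; have ii n := trunc_int n mi i2.
have mT b n (a : LT -> R) : integ leb (trunc n a : LT -> R) ->
    measurable_fun setT (TR b (trunc n a) : LT -> R).
  by move=> h; exact: (measurable_TR b (integ_measurable h)).
have mRF n : measurable_fun setT (fun x : LT => Re (FTtrunc phi n x)).
  under eq_fun do rewrite (FTtruncE n _ L2phi).1.
  exact: (measurable_funM (measurable_cst c0) (measurable_funD (mT _ _ _ (ri n)) (mT _ _ _ (ii n)))).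
have mIF n : measurable_fun setT (fun x : LT => Im (FTtrunc phi n x)).
  under eq_fun do rewrite (FTtruncE n _ L2phi).2.
  exact: (measurable_funM (measurable_cst c0) (measurable_funB (mT _ _ _ (ii n)) (mT _ _ _ (ri n)))).
have cT b (a : LT -> R) : measurable_fun setT a -> integ leb (fun x => a x ^+ 2) ->
    \int[leb]_x (u x * TR b (trunc n a) x) @[n --> \oo] --> \int[leb]_x (a x * TR b u x).
  move=> ma a2; have [T2 _] := TR_L2 b ui u2; have mTu := measurable_TR b mu.
  have ai n := trunc_int n ma a2.
  have -> : (fun n => \int[leb]_x (u x * TR b (trunc n a) x)) =
            (fun n => \int[leb]_x (trunc n a x * TR b u x)).
    by apply/funext => n; rewrite TR_swap.
  have aT := integM2 ma mTu a2 T2.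
  apply: (Rint_dct (f_ := fun n (x : LT) => trunc n a x * TR b u x) _ (integ_measurable aT)
    (integrable_norm aT) _ _).2.
  - by move=> n; exact: (measurable_funM (integ_measurable (ai n)) mTu).
  - apply: aeW => x; apply: cvgM; first exact: cvg_trunc.
    exact: cvg_cst.
  - by move=> n x; rewrite /= [leLHS]normrM [leRHS]normrM; apply: ler_wpM2r;
    [exact: normr_ge0|exact: trunc_le].
have : (\int[leb]_x ((Re (FTtrunc phi n x) - Re (phihat x)) ^+ 2 +
    (Im (FTtrunc phi n x) - Im (phihat x)) ^+ 2)%:E)%E @[n --> \oo] --> 0%E.
  apply: cvg_trans FT; apply: near_eq_cvg; apply: nearW => n.
  by apply: eq_integral => x _; rewrite /lf cmod2 ReD ImD ReN ImN.
move=> /(@cvg_integral_sqr _ LT R leb _ _ (fun n => measurable_funB (mRF n) mr')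
  (fun n => measurable_funB (mIF n) mi'))[dR dI].
split.
- apply: (cvg_unique _ (cvg_Rint_L2 mRF mr' mu r2' u2 dR)); first exact: Rhausdorff.
  have -> : (fun n => \int[leb]_x (Re (FTtrunc phi n x) * u x)) =
    (fun n => c0 * (\int[leb]_x (u x * TR false (trunc n (fun x => Re (phi x))) x) +
      \int[leb]_x (u x * TR true (trunc n (fun x => Im (phi x))) x))).
    apply/funext => n; have uT b (g : LT -> R) : integ leb g -> integ leb (fun x => u x * TR b g x).
      move=> gi; exact: (integ_mulb ui (measurable_TR b (integ_measurable gi)) (fun x => TR_bound b x gi)).
    rewrite -RintD ?uT// -RintZ; last by apply: integD; exact: uT.
    by apply: eq_Rint => x; rewrite (FTtruncE n _ L2phi).1; ring.
  by apply: cvgMr; apply: cvgD; exact: cT.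
- apply: (cvg_unique _ (cvg_Rint_L2 mIF mi' mu i2' u2 dI)); first exact: Rhausdorff.
  have -> : (fun n => \int[leb]_x (Im (FTtrunc phi n x) * u x)) =
    (fun n => c0 * (\int[leb]_x (u x * TR false (trunc n (fun x => Im (phi x))) x) -
      \int[leb]_x (u x * TR true (trunc n (fun x => Re (phi x))) x))).
    apply/funext => n; have uT b (g : LT -> R) : integ leb g -> integ leb (fun x => u x * TR b g x).
      move=> gi; exact: (integ_mulb ui (measurable_TR b (integ_measurable gi)) (fun x => TR_bound b x gi)).
    rewrite -RintB ?uT// -RintZ; last by apply: integB; exact: uT.
    by apply: eq_Rint => x; rewrite (FTtruncE n _ L2phi).2; ring.
  by apply: cvgMr; apply: cvgB; exact: cT.
Qed.

End FourierPairing.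

(** * Fourier transforms of positive definite functions *)

Section PositiveDefinite.
Context {R : realType}.
Notation C := (complex.complex R).
Notation Re := complex.Re.
Notation Im := complex.Im.
Notation LT := (@LT R).
Notation leb := (@leb R).

(** The new row and the new column run through the distances 1 to n, and the new diagonal entry adds
    [g 0]. *)
Lemma distn_sum_recr (g : nat -> R) (n : nat) :
  \sum_(j < n.+1) \sum_(k < n.+1) g `|j - k|%N =
  \sum_(j < n) \sum_(k < n) g `|j - k|%N + (g 0%N + 2 * \sum_(0 <= d < n) g d.+1).
Proof.
have E : \sum_(j < n) g `|j - n|%N = \sum_(0 <= d < n) g d.+1.
  rewrite big_mkord (reindex_inj rev_ord_inj) /=; apply: eq_bigr => j _.
  by congr g; have := ltn_ord j; lia.
rewrite big_ord_recr /= big_ord_recr /= distnn.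
under eq_bigr do rewrite big_ord_recr /=.
rewrite big_split /= E.
have -> : \sum_(k < n) g `|n - k|%N = \sum_(0 <= d < n) g d.+1.
  by rewrite -E; apply: eq_bigr => k _; rewrite distnC.
ring.
Qed.

(** The double sum [S] has increments [g 0 + 2 * s n], where [s n] adds the B_d / d for d from 1 to
    n. As B_d is at most [- eta] from some rank on, [s] tends to -oo with the harmonic series, and
    [S] eventually becomes negative. *)
Lemma cvg_harmonic_mulD_lt0 (B : nat -> R) (L : R) : B @ \oo --> L -> L < 0 ->
  forall g0, (forall n, 0 <= \sum_(j < n) \sum_(k < n)
    (if `|j - k|%N is d.+1 then B d.+1 / d.+1%:R else g0)) -> False.
Proof.
move=> BL L0 g0 S0.
pose g d := if d is d'.+1 then B d'.+1 / d'.+1%:R else g0.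
pose S n := \sum_(j < n) \sum_(k < n) g `|j - k|%N.
pose s n := \sum_(0 <= d < n) g d.+1.
have SE n : S n.+1 = S n + (g 0%N + 2 * s n) by exact: distn_sum_recr.
have sS n : s n.+1 = s n + g n.+1 by rewrite /s big_nat_recr.
pose eta : R := - L / 2.
have eta0 : 0 < eta by rewrite divr_gt0// oppr_gt0.
have [d0 _ Bd0] : \forall d \near \oo, B d <= - eta.
  by apply: (cvgr_le _ BL); rewrite /eta; lra.
(* [t] does not increase beyond [d0], so [s n] stays below [t d0] minus [eta] times the harmonic
   sum. *)
pose t n := s n + eta * series harmonic n.
have tle n : t (d0 + n)%N <= t d0.
  elim: n => [|n IH]; first by rewrite addn0.
  rewrite addnS; apply: le_trans IH; rewrite /t seriesSr sS mulrDr.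
  have : g (d0 + n).+1 + eta * harmonic (d0 + n)%N <= 0.
    rewrite /g /harmonic -mulrDl pmulr_lle0 ?invr_gt0//.
    by have := Bd0 (d0 + n).+1 (leqW (leq_addr _ _)); lra.
  lra.
have H : series (@harmonic R) @ \oo --> +oo.
  apply: nondecreasing_dvgn_lt; last exact: dvg_harmonic.
  by apply/nondecreasing_seqP => n; rewrite seriesSr lerDl harmonic_ge0.
(* Past this threshold [s] is at most -|g 0| - 1, and every increment of [S] is then at most -1. *)
have [n1 _ Hn1] : \forall n \near \oo, (t d0 + `|g 0%N| + 1) / eta <= series harmonic n.
  by move/cvgryPge : H; apply.
pose n2 := (d0 + n1)%N.
have Sle m : S (n2 + m)%N <= S n2 - m%:R.
  elim: m => [|m IH]; first by rewrite addn0 subr0.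
  rewrite addnS SE -natr1.
  have h1 : s (n2 + m)%N + eta * series harmonic (n2 + m)%N <= t d0.
    by rewrite /n2 -addnA; exact: tle.
  have h2 : t d0 + `|g 0%N| + 1 <= eta * series harmonic (n2 + m)%N.
    rewrite mulrC -ler_pdivrMr//; apply: Hn1.
    by rewrite /n2 /= -addnA addnCA leq_addr.
  have := ler_norm (g 0%N); have := normr_ge0 (g 0%N); lra.
have h1 := Sle (Num.bound (S n2)).
have h2 : 0 <= S (n2 + Num.bound (S n2))%N by exact: S0.
have b0 : 0 <= (Num.bound (S n2))%:R :> R by [].
have S20 : 0 <= S n2 by lra.
by have := archi_boundP S20; lra.
Qed.

(* Averaging the hypothesis over s in [-1, 1] gives nonnegative sums whose (j, k)
   term is B_d / d with d = |j - k| and B_d the integral of be over [-d, d]; if the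
   B_d had a negative limit, the divergence of the harmonic series would drive
   these sums to -oo. *)
Lemma integral_ge0_of_posdef (be : LT -> R) : integ leb be ->
  (forall x : R, be (- x) = be x) ->
  (forall n (s : R), 0 <= \sum_(j < n) \sum_(k < n) be (s * (j%:R - k%:R))) ->
  0 <= \int[leb]_x be x.
Proof.
move=> bi bev bpos; rewrite leNgt; apply/negP => L0.
have mb := integ_measurable bi.
have [Ii mI] := indic_itv_int (- 1 : R) 1.
have ti n : integ leb (trunc n be : LT -> R).
  have [_ mIn] := indic_itv_int (- n%:R : R) n%:R.
  have := integ_mulb bi mIn (M := 1); rewrite /trunc.
  under [X in _ -> integ _ X]eq_fun do rewrite mulrC.
  by apply => x; rewrite indicE; case: (_ \in _); rewrite ?normr1 ?normr0.
pose B (n : nat) := \int[leb]_x trunc n be x.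
have BL : B @ \oo --> \int[leb]_x be x.
  apply: (Rint_dct (f_ := fun n (x : LT) => trunc n be x) _ mb (integrable_norm bi) _ _).2.
  - by move=> n; exact: integ_measurable (ti n).
  - by apply: aeW => x; exact: cvg_trunc.
  - by move=> n x; exact: trunc_le.
apply: (cvg_harmonic_mulD_lt0 BL L0 (g0 := \int[leb]_x (\1_(`[- 1, 1] : set R) x * be 0))) => n.
pose h (j k : nat) (s : LT) := \1_(`[- 1, 1] : set R) s * be ((s : R) * (j%:R - k%:R)) : R.
have hE (j k : nat) : integ leb (h j k) /\ \int[leb]_x h j k x =
  if `|j - k|%N is d.+1 then B d.+1 / d.+1%:R
  else \int[leb]_x (\1_(`[- 1, 1] : set R) x * be 0).
  have bjk s : be (s * (j%:R - k%:R)) = be (s * `|j - k|%N%:R).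
    have [jk|kj] := leqP j k.
      by rewrite distnEr// natrB// -bev; congr be; ring.
    by rewrite distnEl 1?ltnW// natrB// ltnW.
  case: (`|j - k|%N) bjk => [|d] bjk.
    have -> : h j k = (fun x => \1_(`[- 1, 1] : set R) x * be 0).
      by apply/funext => s; rewrite /h bjk mulr0.
    split => //; under [X in integ _ X]eq_fun do rewrite mulrC.
    exact: integZ.
  have d0 : d.+1%:R != 0 :> R by rewrite pnatr_eq0.
  have -> : h j k = (fun x => trunc d.+1 be (aff d.+1%:R 0 x)).
    apply/funext => s; rewrite /h /trunc bjk /aff addr0 (mulrC s); congr (_ * _).
    have dp : 0 < d.+1%:R :> R by [].
    rewrite !indicE; congr ((nat_of_bool _)%:R).
    apply/idP/idP; rewrite !inE /= !in_itv /= -(ler_pM2l dp (- 1)) -(ler_pM2l dp s);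
      by rewrite mulrN1 mulr1.
  split; first exact: (integ_aff 0 d0 (ti d.+1)).
  by rewrite (Rint_aff 0 d0 (ti d.+1)) mulrC normr_nat.
have E : \sum_(j < n) \sum_(k < n) (if `|j - k|%N is d.+1 then B d.+1 / d.+1%:R
   else \int[leb]_x (\1_(`[- 1, 1] : set R) x * be 0)) =
   \int[leb]_x \sum_(j < n) \sum_(k < n) h j k x.
  have h1 (j : 'I_n) : integ leb (fun x => \sum_(k < n) h j k x).
    by apply: integ_sum => k; exact: (hE j k).1.
  rewrite (Rint_sum _ h1); apply: eq_bigr => j _.
  rewrite (Rint_sum _ (fun k : 'I_n => (hE j k).1)); apply: eq_bigr => k _.
  by rewrite (hE j k).2.
rewrite E; apply: Rint_ge0 => s.
have -> : \sum_(j < n) \sum_(k < n) h j k s =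
  \1_(`[- 1, 1] : set R) s * \sum_(j < n) \sum_(k < n) be ((s : R) * (j%:R - k%:R)).
  by rewrite mulr_sumr; apply: eq_bigr => j _; rewrite mulr_sumr.
by rewrite mulr_ge0// indicE.
Qed.

(** The defining sums are real. A single point shows that [phi 0] is real; at the points [x] and 0,
    the coefficients (1, 1) give the relation of imaginary parts and (1, i) that of real parts. *)
Lemma posdef_hermitian (phi : R -> C) : posdef phi -> forall x,
  Re (phi (- x)) = Re (phi x) /\ Im (phi (- x)) = - Im (phi x).
Proof.
move=> P x.
have P0 := P 1%N (fun=> 0) (fun=> 1).
have P1 := P 2%N (fun i => if i == ord0 then x else 0) (fun=> 1).
have P2 := P 2%N (fun i => if i == ord0 then x else 0)
  (fun i => if i == ord0 then 1 else complex.Complex 0 1).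
move: P0 P1 P2; rewrite !lecE => /andP[/eqP + _] /andP[/eqP + _] /andP[/eqP + _].
rewrite !big_ord_recr !big_ord0 /= !subr0 !sub0r !subrr !(ReD, ImD, ReM, ImM) /=.
rewrite ?(mul0r, mul1r, mulr0, mulr1, oppr0, addr0, add0r, subr0, sub0r, mulrN1, opprK, mulN1r).
move=> P0 P1 P2.
by split; lra.
Qed.

(** The points [s * j] with coefficients [expi (- (s * j * xi))] modulate [phi] by the frequency
    [xi]. Integration in [xi] against a nonnegative [u] then yields the sums for [phi] times the
    transform of [u]. *)
Lemma posdef_sum (phi : R -> C) : posdef phi -> forall n (s xi : R),
  0 <= \sum_(j < n) \sum_(k < n)
    (Re (phi (s * (j%:R - k%:R))) * cos (s * (j%:R - k%:R) * xi) +
     Im (phi (s * (j%:R - k%:R))) * sin (s * (j%:R - k%:R) * xi)).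
Proof.
move=> P n s xi.
have := P n (fun j => s * j%:R) (fun j => expi (- (s * j%:R * xi))).
rewrite lecE => /andP[_].
rewrite (_ : Re 0 = 0)//; congr (_ <= _).
have sumRe I (r : seq I) (F : I -> C) : Re (\sum_(i <- r) F i) = \sum_(i <- r) Re (F i).
  by elim/big_ind2: _ => // ? ? ? ? <- <-; rewrite ReD.
rewrite sumRe; apply: eq_bigr => j _; rewrite sumRe; apply: eq_bigr => k _.
rewrite ReM ReM ImM /= !cosN !sinN.
have -> : s * (j%:R - k%:R) * xi = s * j%:R * xi - s * k%:R * xi by ring.
rewrite cosB sinB (_ : s * j%:R - s * k%:R = s * (j%:R - k%:R)); last by ring.
ring.
Qed.

End PositiveDefinite.

(** * The transform of a positive definite function is real and nonnegative *)

Section FourierNonneg.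
Context {R : realType}.
Notation C := (complex.complex R).
Notation Re := complex.Re.
Notation Im := complex.Im.
Notation LT := (@LT R).
Notation leb := (@leb R).
Notation c0 := (Num.sqrt (2 * pi))^-1.

Lemma trunc_sqr_int n (a : LT -> R) : measurable_fun setT a ->
  integ leb (fun x => a x ^+ 2) -> integ leb (fun x : LT => trunc n a x ^+ 2).
Proof.
move=> ma a2; have mt := integ_measurable (trunc_int n ma a2).
apply: (integ_le (measurable_funX 2 mt) a2) => x.
by rewrite normrX -[leRHS](real_normK (num_real _)) lerXn2r ?nnegrE// trunc_le.
Qed.

(** Test functions have to be integrable, so a square integrable [f] is tested against its own
    truncations, and the intervals [[-n, n]] exhaust the line. *)
Lemma ae_trunc0 (f : LT -> R) : measurable_fun setT f ->
  integ leb (fun x => f x ^+ 2) ->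
  (forall n, \int[leb]_x trunc n f x ^+ 2 <= 0) -> {ae leb, forall x, f x = 0}.
Proof.
move=> mf f2 le0.
have h n : {ae leb, forall x : LT, trunc n f x = 0}.
  exact: (sqr_int0_ae (integ_measurable (trunc_int n mf f2)) (trunc_sqr_int n mf f2) (le0 n)).
move/ae_foralln : h; apply: filterS => x fx.
have := @cvg_trunc R f x; rewrite (_ : (fun n => _) = cst 0); last exact/funext.
by move/(cvg_unique (@Rhausdorff R)) => /(_ _ (cvg_cst 0)).
Qed.

Lemma TR_even u x : TR false u (- x) = TR false u x :> R.
Proof. by apply: eq_Rint => y; rewrite /cs mulNr cosN. Qed.



Lemma TR_odd (u : LT -> R) x : integ leb u -> TR true u (- x) = - TR true u x.
Proof.
move=> ui; rewrite /TR -[RHS]mulN1r -RintZ; last exact: (kernel_integ (x : LT) (kernel_cs true) ui).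
by apply: eq_Rint => y; rewrite /cs mulNr sinN; ring.
Qed.

Lemma Rint_odd (f : LT -> R) : integ leb f -> (forall x : R, f (- x) = - f x) ->
  \int[leb]_x f x = 0.
Proof.
move=> fi fo.
have N1 : -1 != 0 :> R by rewrite oppr_eq0 oner_eq0.
have := Rint_aff 0 N1 fi; rewrite normrN1 invr1 mul1r.
have -> : \int[leb]_x f (aff (-1) 0 x) = \int[leb]_x (-1 * f x).
  by apply: eq_Rint => x; rewrite /aff addr0 !mulN1r fo.
by rewrite RintZ//; lra.
Qed.

Section PosdefFourier.
Variables (phi phihat : R -> C).
Hypotheses (L2phi : L2 phi) (FT : is_FT phi phihat) (P : posdef phi).
(* Re phi is even and Im phi is odd, so pairing Im phihat with any test function
   yields integrals of odd functions. *)
Lemma posdef_FT_im0 : {ae leb, forall x, Im (phihat x) = 0}.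
Proof.
have [mr mi r2 i2] := L2_parts L2phi; have [mr' mi' r2' i2'] := L2_parts FT.1.
apply: (ae_trunc0 mi' i2') => n.
pose u : LT -> R := trunc n (fun x : R => Im (phihat x)).
have ui : integ leb u := trunc_int n mi' i2'.
have u2 : integ leb (fun x => u x ^+ 2) := trunc_sqr_int n mi' i2'.
have mu := integ_measurable ui.
have -> : \int[leb]_x trunc n (fun x => Im (phihat x)) x ^+ 2 =
    \int[leb]_x (Im (phihat x) * u x).
  apply: eq_Rint => x; rewrite /u /trunc indicE.
  by case: (_ \in _); rewrite ?mul1r ?mul0r ?mulr0 ?expr0n.
rewrite (is_FT_pairing L2phi FT ui u2).2.
have [C2 _] := TR_L2 false ui u2; have [S2 _] := TR_L2 true ui u2.
rewrite !Rint_odd ?subr0 ?mulr0//.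
- exact: (integM2 mr (measurable_TR true mu) r2 S2).
- by move=> x; rewrite (posdef_hermitian P x).1 TR_odd// mulrN.
- exact: (integM2 mi (measurable_TR false mu) i2 C2).
- by move=> x; rewrite (posdef_hermitian P x).2 TR_even mulNr.
Qed.

Lemma posdef_FT_pairing_ge0 (u : LT -> R) : integ leb u ->
  integ leb (fun x => u x ^+ 2) -> (forall x, 0 <= u x) ->
  0 <= \int[leb]_x (Re (phihat x) * u x).
Proof.
move=> ui u2 u0; have mu := integ_measurable ui.
have [mr mi r2 i2] := L2_parts L2phi.
have [C2 _] := TR_L2 false ui u2; have [S2 _] := TR_L2 true ui u2.
have i1 := integM2 mr (measurable_TR false mu) r2 C2.
have i3 := integM2 mi (measurable_TR true mu) i2 S2.
rewrite (is_FT_pairing L2phi FT ui u2).1 mulr_ge0//.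
rewrite -RintD//; apply: integral_ge0_of_posdef.
- exact: integD.
- move=> x; rewrite (posdef_hermitian P x).1 (posdef_hermitian P x).2.
  by rewrite TR_even TR_odd// mulrNN.
- move=> n s.
  pose t (j k : 'I_n) : R := s * (j%:R - k%:R).
  have cu c (y : R) : integ leb (fun x : LT => cs c (y * x) * u x).
    exact: (kernel_integ (y : LT) (kernel_cs c) ui).
  pose G (j k : 'I_n) (x : LT) : R := Re (phi (t j k)) * (cs false (t j k * x) * u x) +
    Im (phi (t j k)) * (cs true (t j k * x) * u x).
  have Gi j k : integ leb (G j k) by apply: integD; apply: integZ; exact: cu.
  have GE j k : Re (phi (t j k)) * TR false u (t j k) +
      Im (phi (t j k)) * TR true u (t j k) = \int[leb]_x G j k x.
    rewrite RintD; [|by apply: integZ; exact: cu..].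
    by rewrite !RintZ; [|exact: cu..].
  under eq_bigr => j _ do under eq_bigr => k _ do rewrite (GE j k).
  under eq_bigr => j _ do rewrite -(Rint_sum _ (Gi j)).
  have Gj (j : 'I_n) : integ leb (fun x => \sum_(k < n) G j k x) by apply: integ_sum => k.
  rewrite -(Rint_sum _ Gj); apply: Rint_ge0 => x.
  (* At each frequency [x] the integrand is [u x] times the sum of [posdef_sum]. *)
  have -> : \sum_(j < n) \sum_(k < n) G j k x =
    u x * \sum_(j < n) \sum_(k < n)
      (Re (phi (s * (j%:R - k%:R))) * cos (s * (j%:R - k%:R) * x) +
       Im (phi (s * (j%:R - k%:R))) * sin (s * (j%:R - k%:R) * x)).
    rewrite mulr_sumr; apply: eq_bigr => j _; rewrite mulr_sumr; apply: eq_bigr => k _.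
    by rewrite /G /cs /t; ring.
  by rewrite mulr_ge0//; exact: posdef_sum.
Qed.

(** Let [u] be a truncation of the negative part [f] of [Re phihat]. The pairing with [u] equals
    minus the integral of [u ^+ 2], yet it is nonnegative, so [f] vanishes. *)
Lemma posdef_FT_re_ge0 : {ae leb, forall x, 0 <= Re (phihat x)}.
Proof.
have [mr' mi' r2' i2'] := L2_parts FT.1.
pose f (x : LT) : R := Num.max (- Re (phihat x)) 0.
have f0 x : 0 <= f x by rewrite /f le_max lexx orbT.
have mf : measurable_fun setT f.
  apply: measurable_maxr; last exact: measurable_cst.
  exact: (measurableT_comp (@oppr_measurable R setT) mr').
have fle x : f x ^+ 2 <= Re (phihat x) ^+ 2.
  by rewrite /f; case: (leP (- Re (phihat x)) 0) => ?; rewrite ?sqrrN// expr0n sqr_ge0.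
have f2 : integ leb (fun x => f x ^+ 2).
  by apply: (integ_le (measurable_funX 2 mf) r2') => x; rewrite ger0_norm ?sqr_ge0.
have : {ae leb, forall x, f x = 0}.
  apply: (ae_trunc0 mf f2) => n.
  pose u : LT -> R := trunc n f.
  have ui : integ leb u := trunc_int n mf f2.
  have u2 : integ leb (fun x => u x ^+ 2) := trunc_sqr_int n mf f2.
  have u0 x : 0 <= u x by rewrite /u /trunc mulr_ge0// indicE.
  have := posdef_FT_pairing_ge0 ui u2 u0.
  have -> : \int[leb]_x (Re (phihat x) * u x) = - \int[leb]_x u x ^+ 2.
    rewrite -mulN1r -RintZ//; apply: eq_Rint => x; rewrite mulN1r /u /trunc indicE.
    case: (_ \in _); rewrite ?mul1r ?mul0r ?mulr0 ?expr0n ?oppr0//=.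
    by rewrite /f; case: (leP (- Re (phihat x)) 0) => ?; rewrite ?mulr0 ?expr0n ?oppr0//=; ring.
  by rewrite oppr_ge0.
apply: filterS => x; rewrite /f; case: (leP (- Re (phihat x)) 0) => //.
  by rewrite oppr_le0.
by move=> h1 h2; move: h1; rewrite h2 ltxx.
Qed.

End PosdefFourier.
End FourierNonneg.

(** * Fourier inversion *)

Section VanishingIntegrals.
Context {R : realType}.
Notation LT := (@LT R).
Notation BT := (measurableTypeR R).
Notation leb := (@leb R).

Lemma ae_neq (x0 : R) : {ae leb, forall x : LT, x <> x0}.
Proof.
exists [set x0]; split.
- exact: (borel_LT (measurable_set1 x0)).
- exact: (lebesgue_measure_set1 x0).
- by move=> x /= /contrapT.
Qed.

(** The Borel sets over which [trunc n f] integrates to 0 form a Dynkin class containing the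
    pi-system of rays. Lebesgue sets follow up to null sets, and a function whose integral over
    every measurable set is 0 vanishes almost everywhere. *)
Lemma integral_itv0_ae0 (f : LT -> R) n : integ leb (trunc n f : LT -> R) ->
  (forall i j : R, \int[leb]_x (\1_(`[i, j] : set R) x * f x) = 0) ->
  {ae leb, forall x, trunc n f x = 0}.
Proof.
move=> ti f0; have mt := integ_measurable ti.
pose P (A : set LT) := \int[leb]_x (\1_A x * trunc n f x) = 0.
have m1 (A : set LT) : measurable A -> measurable_fun setT (\1_A : LT -> R).
  by move=> mA; exact: (measurable_indic mA).
have i1 (A : set LT) : measurable A -> integ leb (fun x => \1_A x * trunc n f x).
  move=> mA; apply: (integ_le (measurable_funM (m1 _ mA) mt) (integrable_norm ti)) => x.
  by rewrite /= indicE; case: (_ \in _); rewrite ?mul1r ?mul0r ?normr0.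
have iS (A : set LT) : measurable A -> leb.-integrable A (EFin \o (trunc n f : LT -> R)).
  by move=> mA; apply: (integrableS measurableT mA _ ti).
have PT : P setT.
  rewrite /P -[RHS](f0 (- n%:R) n%:R); apply: eq_Rint => x.
  by rewrite indicT mul1r.
(* Truncation turns the ray into a bounded interval, to which the hypothesis applies. *)
have PG (x : R) : P `[x, +oo[%classic.
  have := f0 (Num.max x (- n%:R)) n%:R; apply: etrans.
  have -> : (`[Num.max x (- n%:R), n%:R]%classic : set R) = `[x, +oo[ `&` `[- n%:R, n%:R].
    apply/seteqP; split => z /=; rewrite !in_itv/= ge_max andbT.
      by move=> /andP[/andP[-> ->] ->].
    by move=> [-> /andP[-> ->]].
  by apply: eq_Rint => y; rewrite /trunc mulrA indicI.
have PB (A : set R) : measurable (A : set BT) -> P A.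
  move=> mA; have mA' : <<s @RGenCInfty.G R >> A.
    by have := mA; rewrite [X in X A](RGenCInfty.measurableE R).
  apply: (@dynkin_induction _ BT (@RGenCInfty.G R) P) mA' => {A mA}.
  - exact: (RGenCInfty.measurableE R).
  - move=> _ _ [x ->] [y ->]; exists (Num.max x y).
    by apply/seteqP; split => z /=; rewrite !in_itv/= !andbT ge_max; [move=> [-> ->]|move/andP].
  - exact: PT.
  - by move=> _ [x ->]; exact: PG.
  - move=> S /borel_LT mS PS; rewrite /P.
    have := RintB ti (i1 S mS); rewrite [X in _ - X]PS subr0.
    have -> : \int[leb]_x trunc n f x = 0.
      by rewrite -[RHS]PT; apply: eq_Rint => x; rewrite indicT mul1r.
    apply: etrans; apply: eq_Rint => x; rewrite !indicE in_setC.
    by case: (x \in S); rewrite /= ?mul1r ?mul0r ?subrr ?subr0.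
  - move=> F0 mF tF PF; pose F : (set LT)^nat := F0.
    have mF' k : measurable (F k) by exact: (borel_LT (mF k)).
    have {}tF : trivIset setT F := tF.
    have E : \int[leb]_(x in \bigcup_k F k) trunc n f x = 0.
      rewrite /Rintegral (integral_bigcup tF mF' (iS _ (bigcupT_measurable _ mF'))).
      rewrite eseries0// => i _ _.
      have := integrable_fin_num (mF' i) (iS _ (mF' i)).
      move/fineK => <-; have := PF i; rewrite /P -Rint_indic /Rintegral => ->.
      by [].
    by move: E; rewrite Rint_indic.
pose E0 := integral_ae_eq (mu := leb) measurableT (f := EFin \o trunc n f) (g := cst 0%E) ti
  (measurable_cst 0%E).
have : ae_eq leb setT (EFin \o (trunc n f : LT -> R)) (cst 0%E).
  apply: E0 => E _ mE; rewrite integral0.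
  have [B [N [mB mN N0 [BE EN]]]] := LT_decomp mE.
  have h : \int[leb]_(x in E) trunc n f x = 0.
    rewrite Rint_indic; have := PB _ mB; rewrite /P; apply: etrans.
    apply: eq_ae_Rint.
    - exact: (integ_measurable (i1 _ mE)).
    - exact: (integ_measurable (i1 _ (borel_LT mB))).
    - exists N; split; [exact: borel_LT|exact: N0|].
      move=> x /= ne; apply: EN; apply/not_implyP => EB; apply: ne.
      congr (_ * _); rewrite !indicE; congr ((nat_of_bool _)%:R).
      by apply/idP/idP; rewrite !inE; [move/EB|move/BE].
  have := integrable_fin_num mE (iS _ mE).
  by move/fineK => <-; rewrite -[fine _]/(\int[leb]_(x in E) trunc n f x) h.
by apply: filterS => x /(_ I) [].
Qed.

End VanishingIntegrals.

(** * Inversion by Poisson integrals of intervals *)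

Section FourierInversion.
Context {R : realType}.
Notation C := (complex.complex R).
Notation Re := complex.Re.
Notation Im := complex.Im.
Notation LT := (@LT R).
Notation BT := (measurableTypeR R).
Notation leb := (@leb R).
Notation c0 := (Num.sqrt (2 * pi))^-1.

Lemma is_derive_atan_shift (eps x y : R) : 0 < eps ->
  is_derive y 1 (fun y => 2 * atan ((y - x) / eps)) (pois eps (x - y)).
Proof.
move=> e0.
have d1 : is_derive y 1 (fun y => (y - x) / eps) eps^-1.
  have := is_deriveD (is_derive_mulr eps^-1 y) (is_derive_cst (- (x / eps)) y 1).
  rewrite addr0; congr is_derive; apply/funext => z.
  by rewrite !fctE; field; rewrite gt_eqF.
have d2 := @is_derive1_comp R atan (fun y => (y - x) / eps) y _ _ (is_derive1_atan _) d1.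
have := @is_deriveZ R R R _ 2 y 1 _ d2.
move/is_derive_eq; apply.
rewrite /GRing.scale /= /pois.
have D0 : eps ^+ 2 + (x - y) ^+ 2 != 0.
  by rewrite gt_eqF// ltr_pwDl ?sqr_ge0// exprn_gt0.
have -> : 1 + ((y - x) / eps) ^+ 2 = (eps ^+ 2 + (x - y) ^+ 2) / eps ^+ 2.
  by field; rewrite gt_eqF.
by field; rewrite D0 gt_eqF.
Qed.

Lemma continuous_pois (eps x : R) : 0 < eps -> continuous (fun y => pois eps (x - y)).
Proof.
move=> e0 y; rewrite /pois.
apply: (@continuousM _ _ (fun=> 2 * eps) (fun y : R => (eps ^+ 2 + (x - y) ^+ 2)^-1)).
  exact: cst_continuous.
apply: (@continuousV _ _ (fun y : R => eps ^+ 2 + (x - y) ^+ 2)).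
  by rewrite gt_eqF// ltr_pwDl ?sqr_ge0// exprn_gt0.
apply: continuousD; first exact: cst_continuous.
apply: (@continuous_comp _ _ _ (fun y => x - y) (fun z => z ^+ 2)); last exact: exprn_continuous.
by apply: continuousB; [exact: cst_continuous|exact: cvg_id].
Qed.

(** This is 2 pi times the harmonic extension of the indicator of [[i, j]] to height [eps]. *)
Definition poisI (i j eps x : R) : R := \int[leb]_y (\1_(`[i, j] : set R) y * pois eps (x - y)).

Lemma poisIE (i j eps x : R) : 0 < eps -> i < j ->
  poisI i j eps x = 2 * atan ((j - x) / eps) - 2 * atan ((i - x) / eps).
Proof.
move=> e0 ij; rewrite /poisI -Rint_indic /Rintegral ge0_integral_leb; last 3 first.
- exact: measurable_itv.
- apply: measurable_funTS; apply/measurable_EFinP.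
  have mp := continuous_measurable_fun (@continuous_pois eps x e0); exact: mp.
- by move=> y _; rewrite lee_fin pois_ge0// ltW.
have dF y := is_derive_atan_shift x y e0.
have cF y : {for y, continuous (fun y : R => 2 * atan ((y - x) / eps))}.
  by have [dFy _] := dF y; apply: differentiable_continuous; apply/derivable1_diffP.
rewrite (@continuous_FTC2 R _ (fun y : R => 2 * atan ((y - x) / eps)))//.
- by apply: continuous_subspaceT; exact: continuous_pois.
- split.
  + by move=> y _; have [] := dF y.
  + by apply: cvg_at_right_filter; exact: cF.
  + by apply: cvg_at_left_filter; exact: cF.
- by move=> y _; rewrite derive1E; have [] := dF y.
Qed.

Lemma cvg_atan_sg (t : R) : atan (t / n.+1%:R^-1) @[n --> \oo] --> Num.sg t * (pi / 2).
Proof.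
have pos (s : R) : 0 < s -> atan (s / n.+1%:R^-1) @[n --> \oo] --> pi / 2.
  move=> s0; have h0 : (n.+1%:R : R) @[n --> \oo] --> +oo.
    by have := @cvgr_idn R; rewrite -cvg_shiftS.
  have h : s / n.+1%:R^-1 @[n --> \oo] --> +oo.
    have g : (fun x => s * x) x @[x --> +oo] --> +oo by exact: gt0_cvgMry.
    have E := cvg_comp _ _ h0 g.
    apply: cvg_trans E; apply: near_eq_cvg; apply: nearW => n /=.
    by rewrite invrK.
  exact: (cvg_comp _ _ h (@cvgy_atan R)).
have [t0|t0|->] := ltgtP t 0.
- rewrite ltr0_sg// mulN1r; have nt : 0 < - t by rewrite oppr_gt0.
  have -> : (fun n => atan (t / n.+1%:R^-1)) = - (fun n => atan (- t / n.+1%:R^-1)).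
    by apply/funext => n; rewrite fctE mulNr atanN opprK.
  exact: cvgN (pos _ nt).
- by rewrite gtr0_sg// mul1r; exact: pos.
- rewrite sgr0 mul0r; under eq_fun do rewrite mul0r atan0.
  exact: cvg_cst.
Qed.

(** For [i < j] this is the pointwise limit of [poisI] as [eps] tends to 0: 2 pi inside the
    interval, 0 outside, and pi at the two end points, a null set. *)
Definition atan_step (i j x : R) : R := pi * (Num.sg (j - x) - Num.sg (i - x)).

Lemma cvg_poisI (i j x : R) : i < j ->
  poisI i j n.+1%:R^-1 x @[n --> \oo] --> atan_step i j x.
Proof.
move=> ij.
have E n : poisI i j n.+1%:R^-1 x =
    2 * atan ((j - x) / n.+1%:R^-1) - 2 * atan ((i - x) / n.+1%:R^-1).
  by rewrite poisIE// invr_gt0.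
under eq_fun do rewrite E.
have -> : atan_step i j x = 2 * (Num.sg (j - x) * (pi / 2)) - 2 * (Num.sg (i - x) * (pi / 2)).
  by rewrite /atan_step; field.
by apply: cvgB; apply: cvgMr; exact: cvg_atan_sg.
Qed.

Lemma atan_stepE (i j x : R) : i < j -> x <> i -> x <> j ->
  atan_step i j x = 2 * pi * \1_(`[i, j] : set R) x.
Proof.
move=> ij xi xj; rewrite /atan_step indicE.
have [xlti|xgti|//] := ltgtP x i.
- rewrite memNset; last by rewrite /= in_itv/= leNgt xlti.
  by rewrite !gtr0_sg ?subr_gt0// ?subrr ?mulr0// (lt_trans xlti).
have [xltj|xgtj|//] := ltgtP x j.
- rewrite mem_set; last by rewrite /= in_itv/= !ltW.
  by rewrite gtr0_sg ?subr_gt0// ltr0_sg ?subr_lt0//= mulr1; ring.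
- rewrite memNset; last by rewrite /= in_itv/= [x <= j]leNgt xgtj andbF.
  by rewrite !ltr0_sg ?subr_lt0// ?subrr ?mulr0// (lt_trans _ xgtj).
Qed.

Lemma poisI_ge0 (i j eps x : R) : 0 < eps -> 0 <= poisI i j eps x.
Proof.
by move=> e0; apply: Rint_ge0 => y; rewrite indicE mulr_ge0// pois_ge0// ltW.
Qed.

Lemma integ_poisI (i j eps x : R) : 0 < eps ->
  integ leb (fun y : LT => \1_(`[i, j] : set R) y * pois eps (x - y)).
Proof.
move=> e0; have [Ii mI] := indic_itv_int i j.
have [pi _] := pois_int (- x) e0.
have := integ_mulb pi mI (M := 1); have h : forall y : LT, `|\1_(`[i, j] : set R) y : R| <= 1.
  by move=> y; rewrite indicE; case: (_ \in _); rewrite ?normr1 ?normr0.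
move/(_ h); congr (integ leb _); apply/funext => y.
by rewrite mulrC -poisN opprB.
Qed.

(** Uniformity in [eps] is what dominated convergence requires. The bound is square integrable,
    hence integrable against a part of [phi]. *)
Lemma poisI_bound (i j : R) : i < j -> exists k : R, 0 <= k /\
  forall eps x, 0 < eps -> eps <= 1 -> poisI i j eps x <= k * (1 + x ^+ 2)^-1.
Proof.
move=> ij; pose M := `|i| + `|j| + 1.
have M1 : 1 <= M by rewrite /M lerDr addr_ge0.
(* For |x| <= 2 M, [k1] combines [poisI <= 2 * pi] with the maximum of 1 + x^2. For larger |x|, the
   distance to the interval is at least |x| / 2, so the kernel is at most 8 / x^2; with 1 + x^2 <= 2
   x^2 this gives [k2]. *)
pose k1 := 2 * pi * (1 + 4 * M ^+ 2); pose k2 := 16 * (j - i).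
have p0 : 0 <= pi :> R := pi_ge0 R.
have k10 : 0 <= k1 by rewrite /k1 !mulr_ge0// addr_ge0// mulr_ge0// sqr_ge0.
have k20 : 0 <= k2 by rewrite /k2 mulr_ge0// subr_ge0 ltW.
exists (k1 + k2); split; first exact: addr_ge0.
move=> eps x e0 e1.
have x0 : 0 < 1 + x ^+ 2 by rewrite ltr_pwDl// sqr_ge0.
rewrite ler_pdivlMr//.
have [xM|xM] := leP `|x| (2 * M).
  have h : poisI i j eps x <= 2 * pi.
    rewrite poisIE//; have := atan_ltpi2 ((j - x) / eps).
    have := atan_gtNpi2 ((i - x) / eps); lra.
  have x2 : x ^+ 2 <= 4 * M ^+ 2.
    rewrite -real_normK ?num_real// (_ : 4 * M ^+ 2 = (2 * M) ^+ 2); last by ring.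
    by rewrite lerXn2r ?nnegrE// mulr_ge0// (le_trans _ M1).
  have h0 := poisI_ge0 i j x e0.
  apply: (@le_trans _ _ k1); last by rewrite lerDl.
  by rewrite /k1; apply: ler_pM => //; [exact: ltW|rewrite lerD2l].
have [Ii mI] := indic_itv_int i j.
have xsq : 4 * M ^+ 2 <= x ^+ 2.
  rewrite -[x ^+ 2]real_normK ?num_real// (_ : 4 * M ^+ 2 = (2 * M) ^+ 2); last by ring.
  by rewrite lerXn2r ?nnegrE// ?mulr_ge0// ?(le_trans _ M1)// ltW.
have xx1 : 1 <= x ^+ 2 by nra.
have xx0 : 0 < x ^+ 2 by lra.
have h : poisI i j eps x <= 8 / x ^+ 2 * (j - i).
  have -> : 8 / x ^+ 2 * (j - i) = \int[leb]_y (8 / x ^+ 2 * \1_(`[i, j] : set R) y).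
    rewrite RintZ//; congr (_ * _).
    have := Rint_indic leb (`[i, j]%classic : set LT) (cst 1).
    rewrite Rintegral_cst; last exact: (borel_LT (measurable_itv _)).
    rewrite mul1r (_ : fine _ = j - i).
      by move=> ->; apply: eq_Rint => y; rewrite mulr1.
    transitivity (fine (lebesgue_measure (`[i, j]%classic : set R))) => //.
    by rewrite lebesgue_measure_itv /= lte_fin ij.
  apply: le_Rint; [exact: integ_poisI|exact: integZ|move=> y].
  rewrite indicE mulrC; case: (boolP (y \in _)) => yI; last by rewrite !mulr0.
  move: yI; rewrite inE /= in_itv/= => /andP[iy yj].
  have yM : `|y| <= M.
    rewrite /M ler_norml; apply/andP; split.
      have := ler_norm (- i); rewrite normrN; have := normr_ge0 j; lra.
    have := ler_norm j; have := normr_ge0 i; lra.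
  rewrite !mulr1 /pois ler_pdivrMr; last by rewrite ltr_pwDl ?sqr_ge0// exprn_gt0.
  have xy : `|x| / 2 <= `|x - y|.
    by have := lerB_dist x y; have := normr_ge0 y; lra.
  have xy2 : x ^+ 2 / 4 <= (x - y) ^+ 2.
    rewrite -(real_normK (num_real x)) -(real_normK (num_real (x - y))).
    by have := normr_ge0 x; nra.
  rewrite mulrAC ler_pdivlMr//.
  have e2 : 0 <= eps ^+ 2 by rewrite sqr_ge0.
  by nra.
apply: (@le_trans _ _ k2); last by rewrite lerDr.
have xi0 : 0 < (x ^+ 2)^-1 by rewrite invr_gt0.
apply: (@le_trans _ _ (8 / x ^+ 2 * (j - i) * (1 + x ^+ 2))).
  by apply: ler_wpM2r; [exact: ltW|exact: h].
rewrite /k2 (_ : 8 / x ^+ 2 * (j - i) * (1 + x ^+ 2) = 8 * (j - i) * ((1 + x ^+ 2) / x ^+ 2)).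
  have h2 : (1 + x ^+ 2) / x ^+ 2 <= 2 by rewrite ler_pdivrMr//; lra.
  rewrite (_ : 16 * (j - i) = 8 * (j - i) * 2); last by ring.
  by apply: ler_wpM2l; rewrite // mulr_ge0// subr_ge0 ltW.
by field; rewrite -sqrf_eq0 gt_eqF.
Qed.

Section Inversion.
Variables (phi phihat : R -> C).
Hypotheses (L2phi : L2 phi) (FT : is_FT phi phihat) (P : posdef phi).
Hypothesis wi : integ leb (fun x : LT => Re (phihat x)).
Variable b : bool.
Let ab (x : R) : R := if b then Im (phi x) else Re (phi x).
Let w (x : R) : R := Re (phihat x).

Let abN x : ab (- x) = (-1) ^+ b * ab x.
Proof.
rewrite /ab; have [h1 h2] := posdef_hermitian P x.
by case: b; rewrite ?h1 ?h2 ?expr1 ?mulN1r ?mul1r.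
Qed.

Let mab : measurable_fun setT (ab : LT -> R) /\ integ leb (fun x : LT => ab x ^+ 2).
Proof. by rewrite /ab; have [mr mi r2 i2] := L2_parts L2phi; case: b. Qed.

Let cs_damp_int eps (c : bool) x : 0 < eps -> integ leb (fun y : LT => cs c (x * y) * damp eps y).
Proof.
move=> e0; have [di _] := damp_int e0.
exact: (kernel_integ (x : LT) (kernel_cs c) di).
Qed.

Variables (i j : R).
Hypothesis ij : i < j.
Let J (x : LT) : R := \1_(`[i, j] : set R) x.
Let Ji : integ leb J. Proof. by have [] := indic_itv_int i j. Qed.
(** The transform of kind [b] of this test function is the even or odd part of the Poisson integral
    of [[i, j]], and its other transform vanishes by parity. *)
Let u eps (x : LT) : R := damp eps x * TR b J x.

Let u_int eps : 0 < eps -> integ leb (u eps) /\ integ leb (fun x => u eps x ^+ 2).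
Proof.
move=> e0; have [di _] := damp_int e0.
have mT := measurable_TR b (integ_measurable Ji).
have ui : integ leb (u eps) := integ_mulb di mT (fun x => TR_bound b x Ji).
split=> //.
have mu := integ_measurable ui.
have ub (x : LT) : `|u eps x| <= \int[leb]_y `|J y|.
  rewrite /u normrM -[leRHS]mul1r; apply: ler_pM => //; last exact: TR_bound.
  by rewrite gtr0_norm ?damp_gt0// damp_le1// ltW.
exact: (integ_mulb ui mu ub).
Qed.

Let TR_u c eps x : 0 < eps -> TR c (u eps) x =
  \int[leb]_y (J y * \int[leb]_z (cs b (z * y) * (cs c (x * z) * damp eps z))).
Proof.
move=> e0; rewrite -(kernel_swap (kernel_cs b) (cs_damp_int c x e0) Ji).
by apply: eq_Rint => z; rewrite /u /TR mulrA.
Qed.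

Let TR_u_same eps x : 0 < eps -> TR b (u eps) x =
  2^-1 * (poisI i j eps x + (-1) ^+ b * poisI i j eps (- x)).
Proof.
move=> e0; rewrite TR_u//.
have pI (y : R) := integ_poisI i j (y : R) e0.
rewrite -RintZ// -RintD//; last exact: integZ.
rewrite -RintZ; last by apply: integD => //; exact: integZ.
apply: eq_Rint => y; rewrite -/(J y).
under eq_Rint do rewrite (mulrC x).
by rewrite Rint_cscs// -(poisN eps (- x - y)) opprB opprK (addrC y); ring.
Qed.

Let TR_u_other eps x : 0 < eps -> TR (~~ b) (u eps) x = 0.
Proof.
move=> e0; rewrite TR_u//.
have -> : (fun y : LT => J y * \int[leb]_z (cs b (z * y) * (cs (~~ b) (x * z) * damp eps z))) =
    (fun=> 0); last by rewrite /Rintegral integral0.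
apply/funext => y; rewrite Rint_odd ?mulr0//.
  have := integ_mulb (cs_damp_int (~~ b) x e0) (kernel_measurable2 (y : LT) (kernel_cs b))
    (fun z => (kernel_cs b).2 z y).
  by congr (integ leb _); apply/funext => z; rewrite mulrC.
move=> z; rewrite /damp normrN mulrN mulNr.
by case: b; rewrite /cs /= sinN cosN; ring.
Qed.

Let mpoisI eps : 0 < eps -> measurable_fun setT (fun x : LT => poisI i j eps x).
Proof.
move=> e0.
have ca (k : R) : continuous (fun x => 2 * atan ((k - x) / eps)).
  move=> x; apply: (@continuousM _ _ (fun=> 2) (fun x => atan ((k - x) / eps))).
    exact: cst_continuous.
  apply: (@continuous_comp _ _ _ (fun x => (k - x) / eps) atan); last exact: continuous_atan.
  apply: (@continuousM _ _ (fun x => k - x) (fun=> eps^-1)); last exact: cst_continuous.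
  by apply: continuousB; [exact: cst_continuous|exact: cvg_id].
have cp : continuous (fun x => 2 * atan ((j - x) / eps) - 2 * atan ((i - x) / eps)).
  by move=> x; exact: cvgB (ca j x) (ca i x).
have := continuous_LT cp; congr (measurable_fun setT _); apply/funext => x.
by rewrite poisIE.
Qed.

Let poisI_dom : exists2 D : LT -> R, integ leb (fun x => `|ab x * D x|) &
  forall eps x, 0 < eps -> eps <= 1 -> 0 <= poisI i j eps x <= D x.
Proof.
have [k [k0 kb]] := poisI_bound ij; have [oi _] := @oneDsqrV_int R.
have Di := integZ k oi; have mD := integ_measurable Di.
exists (fun x : LT => k * (1 + (x : R) ^+ 2)^-1).
  apply: integrable_norm; apply: (integM2 mab.1 mD mab.2).
  have := integ_mulb Di mD (M := k); apply => x.
  have x1 : (1 + (x : R) ^+ 2)^-1 <= 1.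
    by rewrite invf_le1 ?lerDl ?sqr_ge0// ltr_pwDl// sqr_ge0.
  have x0 : 0 <= (1 + (x : R) ^+ 2)^-1 by rewrite invr_ge0 addr_ge0// sqr_ge0.
  by rewrite ger0_norm ?mulr_ge0// -[leRHS]mulr1 ler_wpM2l.
by move=> eps x e0 e1; rewrite poisI_ge0//= kb.
Qed.

Let ab_poisI_int eps : 0 < eps -> eps <= 1 ->
  integ leb (fun x : LT => ab x * poisI i j eps x).
Proof.
move=> e0 e1; have [D Di Db] := poisI_dom.
apply: (integ_le (measurable_funM mab.1 (mpoisI e0)) Di) => x.
have /andP[p0 pD] := Db eps x e0 e1.
rewrite [leLHS]normrM [leRHS]normrM ler_wpM2l// ger0_norm//.
by rewrite ger0_norm// (le_trans p0).
Qed.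

(** [ab] has the parity [(-1) ^+ b], so the reflected half of [TR_u_same] contributes as much as the
    other half. *)
Let ab_TR_u eps : 0 < eps -> eps <= 1 ->
  \int[leb]_x (ab x * TR b (u eps) x) = \int[leb]_x (ab x * poisI i j eps x).
Proof.
move=> e0 e1; have apI := ab_poisI_int e0 e1.
have N1 : -1 != 0 :> R by rewrite oppr_eq0 oner_eq0.
have apI' : integ leb (fun x : LT => ab (- x) * poisI i j eps (- x)).
  have := integ_aff 0 N1 apI.
  by congr (integ leb _); apply/funext => x; rewrite /aff mulN1r addr0.
transitivity (\int[leb]_x (2^-1 * (ab x * poisI i j eps x) +
    2^-1 * (ab (- x) * poisI i j eps (- x)))).
  by apply: eq_Rint => x; rewrite TR_u_same// abN; ring.
rewrite RintD; [|exact: integZ..]; rewrite !RintZ//.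
have -> : \int[leb]_x (ab (- x) * poisI i j eps (- x)) = \int[leb]_x (ab x * poisI i j eps x).
  have := Rint_aff 0 N1 apI.
  rewrite normrN1 invr1 mul1r; apply: etrans; apply: eq_Rint => x.
  by rewrite /aff mulN1r addr0.
by field.
Qed.

Let pairing eps : 0 < eps -> eps <= 1 -> \int[leb]_x (w x * u eps x) =
  c0 * \int[leb]_x (ab x * poisI i j eps x).
Proof.
move=> e0 e1; have [ui u2] := u_int e0.
rewrite -ab_TR_u// /w (is_FT_pairing L2phi FT ui u2).1.
have z (f : LT -> R) : \int[leb]_x (f x * TR (~~ b) (u eps) x) = 0.
  transitivity (\int[leb]_x (0 : R)); last by rewrite /Rintegral integral0.
  by apply: eq_Rint => x; rewrite TR_u_other// mulr0.
move: (u eps) z => U z; rewrite /ab.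
by case: b z => /= z; rewrite z ?add0r ?addr0.
Qed.

(** Both sides of [pairing] converge as [eps] tends to 0: the left one to the pairing of [w] with
    [TR b J], that is of [J] with [TR b w], and the right one to [c0 * (2 * pi)] times the integral
    of [ab] over the interval. The normalisation [c0 * c0 * 2 * pi = 1] matches them. *)
Lemma FT_inversion_itv :
  \int[leb]_x (\1_(`[i, j] : set R) x * (ab x - c0 * TR b w x)) = 0.
Proof.
have mw := integ_measurable wi; have mJ := integ_measurable Ji.
have mTJ := measurable_TR b mJ; have mTw := measurable_TR b mw.
pose e (n : nat) : R := n.+1%:R^-1.
have e0 n : 0 < e n by rewrite invr_gt0.
have e1 n : e n <= 1 by rewrite invf_le1// ler1n.
have lim1 : \int[leb]_x (w x * u (e n) x) @[n --> \oo] --> \int[leb]_x (w x * TR b J x).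
  have wT : integ leb (fun x => w x * TR b J x) := integ_mulb wi mTJ (fun x => TR_bound b x Ji).
  apply: (Rint_dct (f_ := fun n (x : LT) => w x * u (e n) x) _ (integ_measurable wT)
    (integrable_norm wT) _ _).2.
  - by move=> n; exact: (measurable_funM mw (integ_measurable (u_int (e0 n)).1)).
  - apply: aeW => x; apply: cvgM; first exact: cvg_cst.
    rewrite -[X in _ --> X]mul1r; apply: cvgM; first exact: cvg_damp1.
    exact: cvg_cst.
  - move=> n x; rewrite /= [leLHS]normrM [leRHS]normrM; apply: ler_wpM2l => //.
    rewrite /u normrM -[leRHS]mul1r; apply: ler_wpM2r => //.
    by rewrite gtr0_norm ?damp_gt0// damp_le1// ltW.
have [ma a2] := mab.
have lim2 : \int[leb]_x (ab x * poisI i j (e n) x) @[n --> \oo] -->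
    \int[leb]_x (ab x * atan_step i j x).
  have [D Di Db] := poisI_dom.
  have mst : measurable_fun setT (fun x : LT => atan_step i j x).
    apply: (measurable_fun_cvg (h := fun n (x : LT) => poisI i j (e n) x)).
      by move=> n; exact: (mpoisI (e0 n)).
    by move=> x _; exact: cvg_poisI.
  apply: (Rint_dct (f_ := fun n (x : LT) => ab x * poisI i j (e n) x) _ (measurable_funM ma mst) Di _ _).2.
  - by move=> n; exact: (measurable_funM ma (mpoisI (e0 n))).
  - apply: aeW => x; apply: cvgM; first exact: cvg_cst.
    exact: cvg_poisI.
  - move=> n x; have /andP[p0 pD] := Db _ x (e0 n) (e1 n).
    rewrite [leLHS]normrM [leRHS]normrM ler_wpM2l// ger0_norm//.
    by rewrite ger0_norm// (le_trans p0).
have E : \int[leb]_x (w x * TR b J x) = c0 * \int[leb]_x (ab x * atan_step i j x).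
  apply: (cvg_unique _ lim1); first exact: Rhausdorff.
  have -> : (fun n => \int[leb]_x (w x * u (e n) x)) =
      (fun n => c0 * \int[leb]_x (ab x * poisI i j (e n) x)).
    by apply/funext => n; exact: (pairing (e0 n) (e1 n)).
  exact: cvgMr.
have aJ : integ leb (fun x => ab x * J x).
  apply: (integM2 ma mJ a2); move: Ji; congr (integ _ _).
  by apply/funext => x; rewrite /J indicE; case: (_ \in _); rewrite ?expr1n ?expr0n.
have E2 : \int[leb]_x (ab x * atan_step i j x) = 2 * pi * \int[leb]_x (ab x * J x).
  rewrite -RintZ//; apply: eq_ae_Rint.
  - apply: (measurable_funM ma).
    apply: (measurable_fun_cvg (h := fun n (x : LT) => poisI i j (e n) x)).
      by move=> n; exact: (mpoisI (e0 n)).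
    by move=> x _; exact: cvg_poisI.
  - exact: (integ_measurable (integZ _ aJ)).
  - apply: filterS2 (ae_neq i) (ae_neq j) => x xi xj.
    by rewrite atan_stepE// /J; ring.
have JT : integ leb (fun x => J x * TR b w x) := integ_mulb Ji mTw (fun x => TR_bound b x wi).
transitivity (\int[leb]_x (ab x * J x - c0 * (J x * TR b w x))).
  by apply: eq_Rint => x; rewrite /J; ring.
rewrite RintB//; last exact: integZ.
rewrite RintZ// TR_swap// E E2 !mulrA.
have cc : c0 * c0 * 2 * pi = 1 :> R.
  rewrite -mulrA -invfM -expr2 sqr_sqrtr ?mulr_ge0 ?pi_ge0// mulVf//.
  by rewrite mulf_neq0// gt_eqF// pi_gt0.
by rewrite cc mul1r subrr.
Qed.

End Inversion.

(** The difference of the two sides is square integrable by [TR_L2], hence integrable on bounded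
    intervals, and its integrals over intervals vanish. *)
Lemma FT_inversion (phi phihat : R -> C) b : L2 phi -> is_FT phi phihat -> posdef phi ->
  integ leb (fun x : LT => Re (phihat x)) ->
  {ae leb, forall x, (if b then Im (phi x) else Re (phi x)) =
    c0 * TR b (fun x => Re (phihat x)) x}.
Proof.
move=> L2phi FT P wi.
have [mr' mi' r2' i2'] := L2_parts FT.1.
pose ab (x : R) : R := if b then Im (phi x) else Re (phi x).
have [ma a2] : measurable_fun setT (ab : LT -> R) /\ integ leb (fun x : LT => ab x ^+ 2).
  by rewrite /ab => {ab}; have [mr mi r2 i2] := L2_parts L2phi; case: b.
have [T2 _] := TR_L2 b wi r2'.
have mT := measurable_TR b (integ_measurable wi).
pose f (x : LT) : R := ab x - c0 * TR b (fun x => Re (phihat x)) x.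
have mf : measurable_fun setT f := measurable_funB ma (measurable_funM (measurable_cst c0) mT).
have f2 : integ leb (fun x => f x ^+ 2).
  have mcT : measurable_fun setT (fun x : LT => - c0 * TR b (fun x => Re (phihat x)) x).
    exact: (measurable_funM (measurable_cst (- c0)) mT).
  have -> : (fun x => f x ^+ 2) =
      (fun x => (ab x + - c0 * TR b (fun x => Re (phihat x)) x) ^+ 2).
    by apply/funext => x; rewrite /f mulNr.
  apply: (integ_sqrD ma mcT a2); have := integZ (c0 ^+ 2) T2; congr (integ _ _).
  by apply/funext => x; ring.
have h n : {ae leb, forall x, trunc n f x = 0}.
  apply: integral_itv0_ae0; first exact: trunc_int.
  move=> i j; have [ij|ji] := ltP i j.
    exact: (FT_inversion_itv L2phi FT P wi b ij).
  transitivity (\int[leb]_x (0 : R)); last by rewrite /Rintegral integral0.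
  apply: eq_ae_Rint.
  - exact: (measurable_funM (indic_itv_int i j).2 mf).
  - exact: measurable_cst.
  - apply: filterS (ae_neq i) => x xi; rewrite indicE memNset ?mul0r//.
    rewrite /= in_itv/= => /andP[ix xj]; apply: xi; apply/eqP.
    by rewrite eq_le ix (le_trans xj).
move/ae_foralln : h; apply: filterS => x fx.
have := @cvg_trunc R f x; rewrite (_ : (fun n => _) = cst 0); last exact/funext.
move/(cvg_unique (@Rhausdorff R)) => /(_ _ (cvg_cst 0)) /eqP.
by rewrite subr_eq0 => /eqP.
Qed.

End FourierInversion.

(** * Weighted approximation by trigonometric polynomials *)

Section TrigPolynomials.
Context {R : realType}.
Notation C := (complex.complex R).
Notation Re := complex.Re.
Notation Im := complex.Im.
Notation LT := (@LT R).

(** Frequencies may repeat, so sums and products are plain list operations. The minus sign makes the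
    frequency [j] act under the inverse transform as translation by [j]. *)
Definition trigpoly (l : seq (int * C)) (x : R) : C :=
  \sum_(jc <- l) jc.2 * expi (- (jc.1%:~R * x)).

Lemma expiD (x y : R) : expi (x + y) = expi x * expi y.
Proof.
by apply: complex_ext; rewrite ?ReM ?ImM /= ?cosD ?sinD//; ring.
Qed.

Lemma trigpoly_cat l1 l2 x : trigpoly (l1 ++ l2) x = trigpoly l1 x + trigpoly l2 x.
Proof. by rewrite /trigpoly big_cat. Qed.

Lemma trigpoly_mul l1 l2 x : trigpoly l1 x * trigpoly l2 x =
  trigpoly [seq (p.1 + q.1, p.2 * q.2) | p <- l1, q <- l2] x.
Proof.
rewrite /trigpoly big_allpairs_dep mulr_suml; apply: eq_bigr => p _.
rewrite mulr_sumr; apply: eq_bigr => q _ /=.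
by rewrite intrD mulrDl opprD expiD; ring.
Qed.

Lemma trigpoly_parts l : exists M : R, [/\
  measurable_fun setT (fun x : LT => Re (trigpoly l x)),
  measurable_fun setT (fun x : LT => Im (trigpoly l x)) &
  forall x, `|Re (trigpoly l x)| <= M /\ `|Im (trigpoly l x)| <= M].
Proof.
elim: l => [|[j c] l [M [mr mi b]]].
  exists 0; rewrite /trigpoly; split.
  - by under eq_fun do rewrite big_nil; exact: measurable_cst.
  - by under eq_fun do rewrite big_nil; exact: measurable_cst.
  - by move=> x; rewrite big_nil normr0.
exists (`|Re c| + `|Im c| + M).
have E x : trigpoly ((j, c) :: l) x = c * expi (- (j%:~R * x)) + trigpoly l x.
  by rewrite /trigpoly big_cons.
have mc b' : measurable_fun setT (fun x : LT => cs b' (- (j%:~R * (x : R)))).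
  have cc : continuous (fun x : R => cs b' (- (j%:~R * x))).
    move=> x; apply: (@continuous_comp R R R (fun x : R => - (j%:~R * x)) (cs b')).
      by apply: continuousN; exact: continuous_mulr.
    exact: continuous_cs.
  exact: (continuous_LT cc).
split.
- under eq_fun do rewrite E ReD ReM.
  apply: measurable_funD mr.
  exact: (measurable_funB (measurable_funM (measurable_cst (Re c)) (mc false))
    (measurable_funM (measurable_cst (Im c)) (mc true))).
- under eq_fun do rewrite E ImD ImM.
  apply: measurable_funD mi.
  exact: (measurable_funD (measurable_funM (measurable_cst (Re c)) (mc true))
    (measurable_funM (measurable_cst (Im c)) (mc false))).
- move=> x; rewrite E ReD ReM ImD ImM; have [b1 b2] := b x.
  have h (u v : R) b' : `|u| <= 1 -> `|v| <= 1 ->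
      `|Re c * u + (-1) ^+ b' * (Im c * v)| <= `|Re c| + `|Im c|.
    move=> u1 v1; apply: (le_trans (ler_normD _ _)); rewrite normrMsign !normrM.
    by apply: lerD; rewrite -[leRHS]mulr1 ler_wpM2l.
  split; apply: (le_trans (ler_normD _ _)); apply: lerD => //.
    by have := h (cos (- (j%:~R * x))) (sin (- (j%:~R * x))) true (cos_max _) (sin_max _); rewrite expr1 mulN1r.
  by have := h (sin (- (j%:~R * x))) (cos (- (j%:~R * x))) false (sin_max _) (cos_max _); rewrite expr0 mul1r.
Qed.

(** The approximation is carried out among real functions, while the complex form is the one that
    acts by translations. *)
Definition real_trigpoly (p : R -> R) := exists l, forall x, RtoC (p x) = trigpoly l x.

Lemma real_trigpoly_bmeas p : real_trigpoly p ->
  measurable_fun setT (p : LT -> R) /\ exists M, forall x, `|p x| <= M.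
Proof.
move=> [l pl]; have [M [mr _ b]] := trigpoly_parts l.
have E x : p x = Re (trigpoly l x) by rewrite -pl.
split; last by exists M => x; rewrite E; exact: (b x).1.
by have := mr; congr (measurable_fun setT _); apply/funext => x; rewrite E.
Qed.

Lemma real_trigpoly_cst c : real_trigpoly (fun=> c).
Proof.
exists [:: (0, RtoC c)] => x; rewrite /trigpoly big_seq1 /= mul0r oppr0.
by apply: complex_ext; rewrite ?ReM ?ImM /= cos0 sin0; ring.
Qed.

Lemma real_trigpolyD p q : real_trigpoly p -> real_trigpoly q ->
  real_trigpoly (fun x => p x + q x).
Proof.
move=> [l pl] [k qk]; exists (l ++ k) => x; rewrite trigpoly_cat -pl -qk.
by apply: complex_ext; rewrite ?ReD ?ImD /= ?addr0.
Qed.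

Lemma real_trigpolyM p q : real_trigpoly p -> real_trigpoly q ->
  real_trigpoly (fun x => p x * q x).
Proof.
move=> [l pl] [k qk]; exists [seq (u.1 + v.1, u.2 * v.2) | u <- l, v <- k] => x.
rewrite -trigpoly_mul -pl -qk.
by apply: complex_ext; rewrite ?ReM ?ImM /= ?mul0r ?mulr0 ?subr0 ?addr0.
Qed.

Lemma real_trigpoly_cos : real_trigpoly cos.
Proof.
exists [:: (1, RtoC 2^-1); (-1, RtoC 2^-1)] => x.
rewrite /trigpoly !big_cons big_nil /= mul1r mulN1r opprK.
by apply: complex_ext; rewrite !(ReD, ImD, ReM, ImM) /= cosN sinN; field.
Qed.

Lemma real_trigpoly_sin : real_trigpoly sin.
Proof.
exists [:: (1, complex.Complex 0 2^-1); (-1, complex.Complex 0 (- 2^-1))] => x.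
rewrite /trigpoly !big_cons big_nil /= mul1r mulN1r opprK.
by apply: complex_ext; rewrite !(ReD, ImD, ReM, ImM) /= cosN sinN; field.
Qed.

End TrigPolynomials.

(** * Periodic functions as limits of trigonometric polynomials in L2 of [W dx] *)

Section TrigApproximation.
Context {R : realType}.
Notation LT := (@LT R).
Notation BT := (measurableTypeR R).
Notation leb := (@leb R).
Variable W : LT -> R.
Hypotheses (W0 : forall x, 0 <= W x) (Wi : integ leb W).

Definition bmeas (Q : R -> R) := measurable_fun setT (Q : LT -> R) /\
  exists M, forall x, `|Q x| <= M.

(** A squared distance, whence the factors 2 in the triangle inequalities. *)
Definition wdist (Q p : R -> R) := \int[leb]_x (W x * (Q x - p x) ^+ 2).

Definition approx (Q : R -> R) := bmeas Q /\
  forall e, 0 < e -> exists2 p, real_trigpoly p & wdist Q p <= e.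

Lemma bmeasD P Q : bmeas P -> bmeas Q -> bmeas (fun x => P x + Q x).
Proof.
move=> [mP [M PM]] [mQ [N QN]]; split; first exact: measurable_funD mP mQ.
by exists (M + N) => x; rewrite (le_trans (ler_normD _ _))// lerD.
Qed.

Lemma bmeasM P Q : bmeas P -> bmeas Q -> bmeas (fun x => P x * Q x).
Proof.
move=> [mP [M PM]] [mQ [N QN]]; split; first exact: measurable_funM mP mQ.
by exists (M * N) => x; rewrite normrM ler_pM.
Qed.

Lemma bmeas_cst c : bmeas (fun=> c).
Proof. by split; [exact: measurable_cst|exists `|c|]. Qed.

Lemma bmeas_trig p : real_trigpoly p -> bmeas p.
Proof. exact: real_trigpoly_bmeas. Qed.

Lemma bmeasB P Q : bmeas P -> bmeas Q -> bmeas (fun x => P x - Q x).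
Proof.
move=> bP bQ; have := bmeasD bP (bmeasM (bmeas_cst (-1)) bQ).
by under eq_fun do rewrite mulN1r.
Qed.

Lemma wint Q : bmeas Q -> integ leb (fun x => W x * Q x).
Proof. by move=> [mQ [M QM]]; exact: (integ_mulb Wi mQ QM). Qed.

Lemma wint2 P Q : bmeas P -> bmeas Q -> integ leb (fun x => W x * (P x - Q x) ^+ 2).
Proof.
by move=> bP bQ; have b := bmeasB bP bQ; have := wint (bmeasM b b).
Qed.

Lemma wdist_add P Q p q : bmeas P -> bmeas Q -> bmeas p -> bmeas q ->
  wdist (fun x => P x + Q x) (fun x => p x + q x) <= 2 * wdist P p + 2 * wdist Q q.
Proof.
move=> bP bQ bp bq; have i1 := wint2 bP bp; have i2 := wint2 bQ bq.
rewrite /wdist -!RintZ// -RintD; [|exact: integZ..].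
apply: le_Rint.
- exact: wint2 (bmeasD bP bQ) (bmeasD bp bq).
- by apply: integD; exact: integZ.
- move=> x; have := sqr_ge0 ((P x - p x) - (Q x - q x)); have := W0 x.
  by nra.
Qed.

Lemma wdist_triangle P Q p : bmeas P -> bmeas Q -> bmeas p ->
  wdist P p <= 2 * wdist P Q + 2 * wdist Q p.
Proof.
move=> bP bQ bp; have i1 := wint2 bP bQ; have i2 := wint2 bQ bp.
rewrite /wdist -!RintZ// -RintD; [|exact: integZ..].
apply: le_Rint.
- exact: wint2.
- by apply: integD; exact: integZ.
- move=> x; have := sqr_ge0 ((P x - Q x) - (Q x - p x)); have := W0 x.
  by nra.
Qed.

Lemma wdistM_le P p q M : bmeas P -> bmeas p -> bmeas q -> 0 <= M ->
  (forall x, `|q x| <= M) ->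
  wdist (fun x => P x * q x) (fun x => p x * q x) <= M ^+ 2 * wdist P p.
Proof.
move=> bP bp bq M0 qM; have i1 := wint2 bP bp.
rewrite /wdist -!RintZ//; apply: le_Rint.
- exact: wint2 (bmeasM bP bq) (bmeasM bp bq).
- exact: integZ.
- move=> x; have q2 : q x ^+ 2 <= M ^+ 2.
    by rewrite -[q x ^+ 2](real_normK (num_real _)) lerXn2r ?nnegrE.
  have -> : W x * (P x * q x - p x * q x) ^+ 2 = W x * (P x - p x) ^+ 2 * q x ^+ 2.
    by ring.
  rewrite (mulrC (M ^+ 2)).
  by apply: ler_wpM2l => //; rewrite mulr_ge0 ?sqr_ge0.
Qed.

Lemma approx_trig p : real_trigpoly p -> approx p.
Proof.
move=> tp; split; first exact: bmeas_trig.
move=> e e0; exists p => //; rewrite /wdist.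
rewrite (_ : \int[leb]_x _ = 0) ?ltW//.
transitivity (\int[leb]_x (0 : R)); last by rewrite /Rintegral integral0.
by apply: eq_Rint => x; rewrite subrr expr0n mulr0.
Qed.

Lemma approx_cst c : approx (fun=> c).
Proof. exact: approx_trig (real_trigpoly_cst c). Qed.

Lemma approxD P Q : approx P -> approx Q -> approx (fun x => P x + Q x).
Proof.
move=> [bP aP] [bQ aQ]; split; first exact: bmeasD.
move=> e e0; have e4 : 0 < e / 4 by rewrite divr_gt0.
have [p tp pe] := aP _ e4; have [q tq qe] := aQ _ e4.
exists (fun x => p x + q x); first exact: real_trigpolyD.
apply: (le_trans (wdist_add bP bQ (bmeas_trig tp) (bmeas_trig tq))).
lra.
Qed.

Lemma approxM P Q : approx P -> approx Q -> approx (fun x => P x * Q x).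
Proof.
move=> [bP aP] [bQ aQ]; split; first exact: bmeasM.
move=> e e0; have e4 : 0 < e / 4 by rewrite divr_gt0.
have [_ [M QM]] := bQ; have M0 : 0 <= M by exact: le_trans (QM 0).
have M2 : 0 < M ^+ 2 + 1 by rewrite ltr_wpDl ?sqr_ge0.
(* [p] is fixed before [q], because the bound [N] of [p] enters the accuracy required of [q]. *)
have [p tp pe] := aP _ (divr_gt0 e4 M2).
have bp := bmeas_trig tp; have [_ [N pN]] := bp.
have N0 : 0 <= N by exact: le_trans (pN 0).
have N2 : 0 < N ^+ 2 + 1 by rewrite ltr_wpDl ?sqr_ge0.
have [q tq qe] := aQ _ (divr_gt0 e4 N2); have bq := bmeas_trig tq.
exists (fun x => p x * q x); first exact: real_trigpolyM.
apply: (le_trans (wdist_triangle (bmeasM bP bQ) (bmeasM bp bQ) (bmeasM bp bq))).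
have h1 := wdistM_le bP bp bQ M0 QM.
have h2 : wdist (fun x => p x * Q x) (fun x => p x * q x) <= N ^+ 2 * wdist Q q.
  have := wdistM_le bQ bq bp N0 pN; congr (_ <= _).
  by apply: eq_Rint => x; ring.
have h3 : M ^+ 2 * wdist P p <= e / 4.
  apply: (@le_trans _ _ (M ^+ 2 * (e / 4 / (M ^+ 2 + 1)))).
    by rewrite ler_wpM2l ?sqr_ge0.
  rewrite mulrA ler_pdivrMr// mulrC ler_wpM2l ?(ltW e4)//.
  by rewrite lerDl.
have h4 : N ^+ 2 * wdist Q q <= e / 4.
  apply: (@le_trans _ _ (N ^+ 2 * (e / 4 / (N ^+ 2 + 1)))).
    by rewrite ler_wpM2l ?sqr_ge0.
  rewrite mulrA ler_pdivrMr// mulrC ler_wpM2l ?(ltW e4)//.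
  by rewrite lerDl.
lra.
Qed.

Lemma approxB P Q : approx P -> approx Q -> approx (fun x => P x - Q x).
Proof.
move=> aP aQ; have := approxD aP (approxM (approx_cst (-1)) aQ).
by under eq_fun do rewrite mulN1r.
Qed.

Lemma approx_lim (Q_ : nat -> R -> R) (Q : R -> R) (M : R) : (forall n, approx (Q_ n)) ->
  (forall n x, `|Q_ n x| <= M) -> (forall x, Q_ n x @[n --> \oo] --> Q x) -> approx Q.
Proof.
move=> aQ QM cQ.
have mQ : measurable_fun setT (Q : LT -> R).
  apply: (measurable_fun_cvg (h := fun n (x : LT) => Q_ n x)).
    by move=> n; exact: (aQ n).1.1.
  by move=> x _; exact: cQ.
have QM' x : `|Q x| <= M.
  have c : `|Q_ n x| @[n --> \oo] --> `|Q x| by apply: cvg_norm; exact: cQ.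
  rewrite -(cvg_lim (@Rhausdorff R) c); apply: limr_le; first exact: (cvgP _ c).
  by apply: nearW => n; exact: QM.
have bQ : bmeas Q by split => //; exists M.
split => // e e0.
have c : wdist Q (Q_ n) @[n --> \oo] --> (0 : R).
  rewrite (_ : 0 = \int[leb]_x (0 : R)); last by rewrite /Rintegral integral0.
  apply: (Rint_dct (f_ := fun n (x : LT) => W x * (Q x - Q_ n x) ^+ 2)
    (f := fun _ : LT => (0 : R)) _ (measurable_cst (0 : R))
    (integZ ((M + M) ^+ 2) Wi) _ _).2.
  - by move=> n; exact: integ_measurable (wint2 bQ (aQ n).1).
  - apply: aeW => x; rewrite -[X in _ --> X](mulr0 (W x)); apply: cvgMr.
    rewrite -[X in _ --> X](mulr0 0) -(subrr (Q x)).
    by apply: cvgM; apply: cvgB (cQ x); exact: cvg_cst.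
  - move=> n x; rewrite ger0_norm; last exact: mulr_ge0 (W0 x) (sqr_ge0 _).
    rewrite mulrC; apply: ler_wpM2r; first exact: W0.
    rewrite -[leLHS](real_normK (num_real _)).
    have MM : 0 <= M + M by rewrite addr_ge0// (le_trans _ (QM' 0)).
    by rewrite lerXn2r ?nnegrE// (le_trans (ler_normB _ _))// lerD.
have e4 : 0 < e / 4 by rewrite divr_gt0.
have [n _ /(_ n (leqnn n))] : \forall n \near \oo, wdist Q (Q_ n) <= e / 4.
  exact: (cvgr_le _ c).
move=> hn; have [p tp pe] := (aQ n).2 _ e4.
exists p => //; apply: (le_trans (wdist_triangle bQ (aQ n).1 (bmeas_trig tp))).
lra.
Qed.

Lemma approx_ae P Q : approx P -> bmeas Q -> {ae leb, forall x : LT, P x = Q x} -> approx Q.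
Proof.
move=> [bP aP] bQ PQ; split => // e e0; have [p tp pe] := aP _ e0.
exists p => //; have bp := bmeas_trig tp; rewrite (_ : wdist Q p = wdist P p)//.
apply: eq_ae_Rint.
- exact: integ_measurable (wint2 bQ bp).
- exact: integ_measurable (wint2 bP bp).
- by apply: filterS PQ => x PQx; rewrite PQx.
Qed.

(* The iteration t <- t (3 - t^2) / 2 converges to the sign of t on [-1, 1]. *)
Definition sgn_step (t : R) : R := t * (3 - t ^+ 2) / 2.

Lemma sgn_stepN t : sgn_step (- t) = - sgn_step t.
Proof. by rewrite /sgn_step sqrrN; ring. Qed.

Lemma iter_sgn_stepN n t : iter n sgn_step (- t) = - iter n sgn_step t.
Proof. by elim: n => //= n ->; rewrite sgn_stepN. Qed.

(** The distance to 1 contracts: [1 - sgn_step s = (1 - s / 2 - s ^+ 2 / 2) * (1 - s)], and the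
    first factor is at most [1 - t / 2] because the iterates stay above [t]. *)
Lemma iter_sgn_step_itv n t : 0 <= t <= 1 ->
  t <= iter n sgn_step t <= 1 /\ 1 - iter n sgn_step t <= (1 - t / 2) ^+ n.
Proof.
move=> /andP[t0 t1]; elim: n => [|n [/andP[h1 h2] h3]].
  by rewrite /= lexx t1 expr0; split => //; lra.
rewrite /= /sgn_step; move: (iter n sgn_step t) h1 h2 h3 => s h1 h2 h3.
have a : 0 <= s * (1 - s) * (1 + s) by rewrite !mulr_ge0//; lra.
have b : 0 <= (1 - s) ^+ 2 * (2 + s) by rewrite mulr_ge0 ?sqr_ge0//; lra.
split; first by apply/andP; split; rewrite ?ler_pdivlMr ?ler_pdivrMr//; nra.
have p0 : 0 <= (1 - t / 2) ^+ n by rewrite exprn_ge0//; lra.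
rewrite (exprS (1 - t / 2)); apply: (@le_trans _ _ ((1 - t / 2) * (1 - s))); last first.
  by apply: ler_wpM2l => //; lra.
have -> : 1 - s * (3 - s ^+ 2) / 2 = (1 - s / 2 - s ^+ 2 / 2) * (1 - s) by field.
apply: ler_wpM2r; first by lra.
by have := sqr_ge0 s; lra.
Qed.

Lemma cvg_iter_sgn_step t : `|t| <= 1 -> iter n sgn_step t @[n --> \oo] --> Num.sg t.
Proof.
have pos s : 0 < s <= 1 -> iter n sgn_step s @[n --> \oo] --> (1 : R).
  move=> /andP[s0 s1]; have s01 : 0 <= s <= 1 by rewrite ltW.
  have c : 1 - (1 - s / 2) ^+ n @[n --> \oo] --> 1 - (0 : R).
    apply: cvgB; first exact: cvg_cst.
    by apply: cvg_expr; rewrite ger0_norm; lra.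
  rewrite subr0 in c; apply: (@squeeze_cvgr _ _ _ _ (fun n => 1 - (1 - s / 2) ^+ n) (cst 1)); last 2 first.
  - exact: c.
  - exact: cvg_cst.
  apply: nearW => n; have [/andP[_ ->] h] := iter_sgn_step_itv n s01.
  by rewrite andbT; lra.
move=> t1; have [t0|t0|->] := ltgtP t 0.
- rewrite ltr0_sg//.
  have -> : (fun n => iter n sgn_step t) = - (fun n => iter n sgn_step (- t)).
    by apply/funext => n; rewrite fctE -iter_sgn_stepN opprK.
  by apply: cvgN; apply: pos; move: t1; rewrite ltr0_norm// oppr_gt0 t0.
- by rewrite gtr0_sg//; apply: pos; rewrite t0; move: t1; rewrite gtr0_norm.
- rewrite sgr0 (_ : (fun n => _) = cst 0); first exact: cvg_cst.
  by apply/funext => n; elim: n => //= n ->; rewrite /sgn_step mul0r mul0r.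
Qed.

Lemma approx_sg Q : approx Q -> (forall x, `|Q x| <= 1) -> approx (fun x => Num.sg (Q x)).
Proof.
move=> aQ Q1; apply: (@approx_lim (fun n x => iter n sgn_step (Q x)) _ 1).
- elim=> [|n IH]; first exact: aQ.
  exact: (approxM (approxM IH (approxB (approx_cst 3) (approxM IH IH))) (approx_cst 2^-1)).
- move=> n x; have [Q0|Q0] := leP 0 (Q x).
    have h : 0 <= Q x <= 1 by rewrite Q0; move: (Q1 x); rewrite ger0_norm.
    have [/andP[h1 h2] _] := iter_sgn_step_itv n h.
    by rewrite ger0_norm// (le_trans Q0).
  have h : 0 <= - Q x <= 1.
    by rewrite oppr_ge0 (ltW Q0); move: (Q1 x); rewrite ltr0_norm.
  have [/andP[h1 h2] _] := iter_sgn_step_itv n h.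
  rewrite -normrN -iter_sgn_stepN ger0_norm// (le_trans _ h1)//.
  by rewrite oppr_ge0 ltW.
- by move=> x; exact: cvg_iter_sgn_step.
Qed.

Definition approx_set (A : set R) := approx (\1_A : R -> R).

Lemma approx_set_gt0 Q : approx Q -> (forall x, `|Q x| <= 1) ->
  approx_set [set x | 0 < Q x].
Proof.
move=> aQ Q1; have aS := approx_sg aQ Q1.
(* On the values of the sign, (s + s^2) / 2 is 1 at s = 1 and 0 at s = 0 and s = -1. *)
have := approxM (approxD aS (approxM aS aS)) (approx_cst 2^-1).
rewrite /approx_set; congr approx; apply/funext => x; rewrite indicE.
have [h|h|h] := ltgtP (Q x) 0.
- by rewrite ltr0_sg// memNset ?mulr0n /=; [ring|apply/negP; rewrite -leNgt ltW].
- by rewrite gtr0_sg// mem_set//= mulr1n; field.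
- by rewrite h sgr0 memNset /=; [ring|rewrite h ltxx].
Qed.

Lemma approx_setC A : approx_set A -> approx_set (~` A).
Proof.
move=> aA; have := approxB (approx_cst 1) aA; rewrite /approx_set.
congr approx; apply/funext => x; rewrite !indicE in_setC.
by case: (x \in A); rewrite /= ?subrr ?subr0.
Qed.

Lemma approx_setI A B : approx_set A -> approx_set B -> approx_set (A `&` B).
Proof. by move=> aA aB; have := approxM aA aB; rewrite /approx_set indicI. Qed.

Lemma approx_set0 : approx_set set0.
Proof. by have := approx_cst 0; rewrite /approx_set indic0. Qed.

(** The indicator of the complement is the limit of the finite products of the indicators of the
    complements. *)
Lemma approx_set_bigcup (F : nat -> set R) : (forall n, approx_set (F n)) ->
  approx_set (\bigcup_n F n).
Proof.
move=> aF; rewrite -[X in approx_set X]setCK setC_bigcup; apply: approx_setC.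
pose Q_ n (x : R) : R := \prod_(k < n) \1_(~` F k) x.
have Q01 n x : 0 <= Q_ n x <= 1.
  rewrite /Q_; elim: n => [|n /andP[h1 h2]]; first by rewrite big_ord0 ler01 lexx.
  rewrite big_ord_recr /= indicE.
  by case: (_ \in _); rewrite /= ?mulr1n ?mulr0n ?mulr1 ?mulr0 ?h1 ?h2 ?lexx ?ler01.
apply: (@approx_lim Q_ _ 1).
- elim=> [|n IH].
    by rewrite /Q_; under eq_fun do rewrite big_ord0; exact: approx_cst.
  by rewrite /Q_; under eq_fun do rewrite big_ord_recr /=; exact: approxM IH (approx_setC (aF n)).
- by move=> n x; have /andP[h1 h2] := Q01 n x; rewrite ger0_norm.
- move=> x; apply: cvg_near_cst; rewrite indicE.
  have [h|/existsNP[k /not_implyP[_ h]]] := pselect (forall k, True -> (~` F k) x).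
    apply: nearW => n; rewrite mem_set//= /Q_; apply: big1 => k _.
    by rewrite indicE mem_set//; exact: h.
  rewrite memNset/=; last by move=> /(_ k I).
  near=> n; have kn : (k < n)%N by near: n; exact: nbhs_infty_gt.
  by rewrite /Q_ (bigD1 (Ordinal kn))//= indicE memNset// mul0r.
Unshelve. all: by end_near. Qed.

(* The representative of x modulo 2 pi in ]-pi, pi]. *)
Definition angle (x : R) : R := if 0 <= sin x then acos (cos x) else - acos (cos x).

Lemma cos_itv (x : R) : -1 <= cos x <= 1.
Proof. by rewrite cos_geN1 cos_le1. Qed.

Lemma acos_cos_gt (x a : R) : 0 <= a <= pi -> (a < acos (cos x)) = (cos x < cos a).
Proof.
move=> /andP[a0 ap]; have ci := cos_itv x.
rewrite -{2}(@acosK R (cos x)); last by rewrite in_itv.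
rewrite ltr_cos// in_itv/= ?a0//.
by rewrite acos_ge0// acos_lepi.
Qed.

(** Inequalities between sine, cosine and constants describe the set: sin x >= 0 and cos x < cos a
    when 0 <= a < pi; sin x >= 0 or cos x > cos a when -pi <= a < 0. *)
Lemma approx_angle_gt a : approx_set [set x | a < angle x].
Proof.
have bd (u v : R) : `|u| <= 1 -> `|v| <= 1 -> `|(u - v) / 2| <= 1.
  move=> u1 v1; rewrite normrM [X in _ * X]ger0_norm// ler_pdivrMr//.
  by have := ler_normB u v; lra.
have hv (u : R) : (0 < u / 2) = (0 < u) by rewrite pmulr_lgt0.
(* Halving keeps the difference in [-1, 1], where the iteration towards the sign converges. *)
have half f g : real_trigpoly f -> real_trigpoly g ->
    (forall x, `|f x| <= 1) -> (forall x, `|g x| <= 1) -> approx_set [set x | g x < f x].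
  move=> tf tg f1 g1.
  have := @approx_set_gt0 (fun x => (f x - g x) / 2)
    (approxM (approxB (approx_trig tf) (approx_trig tg)) (approx_cst 2^-1))
    (fun x => bd _ _ (f1 x) (g1 x)).
  by congr approx_set; apply/seteqP; split => x /=; rewrite hv subr_gt0.
have z1 : `|0 : R| <= 1 by rewrite normr0.
have sneg : approx_set [set x : R | sin x < 0].
  exact: half (real_trigpoly_cst 0) (real_trigpoly_sin) (fun=> z1) (@sin_max R).
have [ap|pa] := leP pi a.
  rewrite (_ : [set x | _] = set0); first exact: approx_set0.
  apply/seteqP; split => x //=; rewrite /angle; have ci := cos_itv x.
  have h1 := acos_lepi ci; have h2 := acos_ge0 ci; have h3 := pi_gt0 R.
  by case: ifP => _ h4; exfalso; lra.
have [a0|a0] := leP 0 a.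
  have := approx_setI (approx_setC sneg)
    (half _ _ (real_trigpoly_cst (cos a)) (@real_trigpoly_cos R) (fun=> cos_max a) (@cos_max R)).
  congr approx_set; apply/seteqP; split => x /=; rewrite /angle.
    move=> [s0 ca]; rewrite leNgt; move/negP : s0 => ->.
    by rewrite acos_cos_gt// a0 ltW.
  case: ifPn => [s0 h|s0 h].
    by rewrite -acos_cos_gt ?a0 ?ltW//; split => //; apply/negP; rewrite -leNgt.
  by have := acos_ge0 (cos_itv x); lra.
have [aN|aN] := ltP a (- pi).
  rewrite (_ : [set x | _] = ~` set0); first exact/approx_setC/approx_set0.
  rewrite setC0; apply/seteqP; split => // x _; rewrite /= /angle; have ci := cos_itv x.
  have h1 := acos_lepi ci; have h2 := acos_ge0 ci; have h3 := pi_gt0 R.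
  by case: ifP => _; lra.
have := approx_setC (approx_setI sneg (approx_setC
    (half _ _ (@real_trigpoly_cos R) (real_trigpoly_cst (cos a)) (@cos_max R) (fun=> cos_max a)))).
have Na : 0 <= - a <= pi by rewrite oppr_ge0 ltW//= lerNl.
have E x : (cos a < cos x) = (acos (cos x) < - a).
  have ci := cos_itv x.
  rewrite -(cosN a) -{1}(@acosK R (cos x)); last by rewrite in_itv.
  by rewrite ltr_cos// in_itv/= ?acos_ge0 ?acos_lepi.
congr approx_set; apply/seteqP; split => x /=; rewrite E /angle.
  move=> h; case: ifPn => s0; first by have := acos_ge0 (cos_itv x); lra.
  have : acos (cos x) < - a by apply: contrapT => ac; apply: h; split; [rewrite ltNge|exact: ac].
  by lra.
move=> h [s0 ac]; apply: ac; move: h; rewrite leNgt s0 /=; lra.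
Qed.

Lemma approx_angle_borel (A : set R) : measurable (A : set BT) ->
  approx_set (angle @^-1` A).
Proof.
move=> mA; have mA' : <<s @RGenOInfty.G R >> A.
  by have := mA; rewrite [X in X A](RGenOInfty.measurableE R).
move: A mA' {mA}.
apply: (@smallest_sub _ (sigma_algebra setT) _ [set A | approx_set (angle @^-1` A)]).
  split => /=.
  - by rewrite preimage_set0; exact: approx_set0.
  - by move=> A; rewrite setTD -preimage_setC; exact: approx_setC.
  - by move=> F aF; rewrite preimage_bigcup; exact: approx_set_bigcup.
move=> _ [a ->] /=.
rewrite (_ : _ @^-1` _ = [set x | a < angle x]); first exact: approx_angle_gt.
by apply/seteqP; split => x /=; rewrite in_itv/= andbT.
Qed.

Lemma angle_id (x : R) : - pi < x <= pi -> angle x = x.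
Proof.
move=> /andP[h1 h2]; rewrite /angle; have [x0|x0] := leP 0 x.
  by rewrite sin_ge0_pi ?x0// cosK// in_itv/= x0.
have s0 : sin x < 0.
  by rewrite -oppr_gt0 -sinN sin_gt0_pi// oppr_gt0 x0 /= ltrNl.
by rewrite leNgt s0 /= cosKN ?opprK// !ltW.
Qed.

Section Periodic.
Variable f : R -> R.
Hypothesis pf : forall x, f (x + 2 * pi) = f x.

Lemma periodic_nat n x : f (x + 2 * pi * n%:R) = f x.
Proof.
elim: n => [|n IH]; first by rewrite mulr0 addr0.
by rewrite -[n.+1%:R]natr1 mulrDr mulr1 addrA pf.
Qed.

Lemma periodic_int (k : int) x : f (x + 2 * pi * k%:~R) = f x.
Proof.
case: (intP k) => [|n|n].
- by rewrite mulr0 addr0.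
- exact: periodic_nat.
- by rewrite -[LHS](periodic_nat n.+1) intrN mulrN subrK.
Qed.

End Periodic.

Lemma mod2pi (x : R) : exists k : int, - pi < x - 2 * pi * k%:~R <= pi.
Proof.
have p0 := pi_gt0 R; have pp : 0 < 2 * pi :> R by rewrite mulr_gt0.
exists (Num.ceil ((x - pi) / (2 * pi))).
have := Num.Theory.ceil_itv ((x - pi) / (2 * pi)).
rewrite intrB ltr_pdivlMr// ler_pdivrMr// => /andP[h1 h2].
by apply/andP; split; lra.
Qed.

Lemma periodic_angle (f : R -> R) : (forall x, f (x + 2 * pi) = f x) ->
  forall x, f (angle x) = f x.
Proof.
move=> pf x; have [k hk] := mod2pi x.
have pa y : angle (y + 2 * pi) = angle y.
  by rewrite /angle (_ : 2 * pi = pi *+ 2) ?sinD2pi ?cosD2pi// mulr_natl.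
have -> : angle x = x - 2 * pi * k%:~R.
  rewrite -(angle_id hk) -[in LHS](subrK (2 * pi * k%:~R) x).
  exact: (periodic_int pa).
by rewrite -(periodic_int pf k) subrK.
Qed.

(** Periodicity makes [A] the preimage of itself under [angle], but [approx_angle_borel] handles
    only its Borel part [B]. The error lies in the preimage of [N] under [angle], covered by the
    translates of [N] by multiples of 2 pi, a null set. *)
Lemma approx_periodic_set (A : set LT) : measurable A ->
  (forall x, A (x + 2 * pi) <-> A x) -> approx_set A.
Proof.
move=> mA pA; have [B [N [mB mN N0 [BA AN]]]] := LT_decomp mA.
have AY x : A (angle x) <-> A x.
  have := @periodic_angle (\1_A : R -> R) _ x; rewrite !indicE.
  have h y : (y + 2 * pi \in A) = (y \in A) by apply/idP/idP; rewrite !inE pA.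
  move=> /(_ (fun y => congr1 (fun b : bool => b%:R) (h y))) /eqP.
  rewrite eqr_nat => /eqP/eqP e.
  suff e' : (angle x \in A) = (x \in A).
    by split => xA; apply/set_mem; [rewrite -e'|rewrite e']; exact: mem_set.
  by move: e; case: (angle x \in A); case: (x \in A).
apply: (approx_ae (approx_angle_borel mB)).
  split; first exact: (measurable_indic mA).
  by exists 1 => x; rewrite indicE; case: (_ \in _); rewrite /= ?mulr1n ?mulr0n ?normr1 ?normr0.
have nN (k : int) : leb.-negligible ((aff 1 (2 * pi * k%:~R)) @^-1` N : set LT).
  apply: aff_null; first exact: oner_neq0.
  by exists N; split => //; exact: borel_LT.
have nU : leb.-negligible (\bigcup_n ((aff 1 (2 * pi * n%:R)) @^-1` N `|`
    (aff 1 (2 * pi * (- n%:Z)%:~R)) @^-1` N) : set LT).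
  by apply: negligible_bigcup => n; apply: negligibleU; [exact: (nN n)|exact: nN].
apply: negligibleS nU => x /= ne.
have NY : N (angle x).
  apply: AN; apply/not_implyP => h; apply: ne; rewrite !indicE; congr ((nat_of_bool _)%:R).
  by apply/idP/idP; rewrite !inE /=; [move/BA/AY|move/AY/h].
have [k hk] := mod2pi x.
have Ax : angle x = aff 1 (2 * pi * (- k)%:~R) x.
  have pa y : angle (y + 2 * pi) = angle y.
    by rewrite /angle (_ : 2 * pi = pi *+ 2) ?sinD2pi ?cosD2pi// mulr_natl.
  rewrite /aff mul1r intrN mulrN -(angle_id hk) -[in LHS](subrK (2 * pi * k%:~R) x).
  exact: (periodic_int pa).
move: NY; rewrite Ax; case: (intP k) => [|n|n] h.
- by exists 0%N => //; left.
- by exists n.+1 => //; right.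
- by exists n.+1 => //; left; move: h; rewrite opprK.
Qed.

(* Binary expansion of a function with values in [0, 1]. *)
Lemma approx_periodic01 (Q : R -> R) : measurable_fun setT (Q : LT -> R) ->
  (forall x, Q (x + 2 * pi) = Q x) -> (forall x, 0 <= Q x <= 1) -> approx Q.
Proof.
move=> mQ pQ Q01.
have key n : exists q : R -> R, [/\ approx q, forall x, q (x + 2 * pi) = q x &
    forall x, 0 <= q x /\ q x <= Q x <= q x + 2^-1 ^+ n].
  elim: n => [|n [q [aq pq qQ]]].
    exists (fun=> 0); split => //; first exact: approx_cst.
    by move=> x; rewrite add0r expr0.
  pose A := [set x : LT | q x + 2^-1 ^+ n.+1 <= Q x].
  have mA : measurable A.
    have := measurable_fun_ler (measurable_funD aq.1.1 (measurable_cst (2^-1 ^+ n.+1 : R))) mQ.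
    by move=> /(_ measurableT [set true] I); rewrite setTI.
  have aA : approx_set A.
    by apply: approx_periodic_set => // x; rewrite /A /= pq pQ.
  exists (fun x => q x + 2^-1 ^+ n.+1 * \1_A x); split.
  - exact: approxD aq (approxM (approx_cst _) aA).
  - move=> x; rewrite pq !indicE; congr (_ + _ * (nat_of_bool _)%:R).
    by apply/idP/idP; rewrite !inE /A /= pq pQ.
  - have e : (2^-1 ^+ n = 2^-1 ^+ n.+1 + 2^-1 ^+ n.+1 :> R) by rewrite exprS; field.
    have e0 : 0 < 2^-1 ^+ n.+1 :> R by rewrite exprn_gt0.
    move=> x; have [q0 /andP[h1 h2]] := qQ x; rewrite indicE.
    have [h|h] := leP (q x + 2^-1 ^+ n.+1) (Q x).
      rewrite mem_set//= mulr1n mulr1; split; first by lra.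
      by rewrite h /=; lra.
    rewrite memNset/=; last by rewrite /A /= leNgt h.
    by rewrite mulr0n mulr0 addr0; split => //; rewrite h1 ltW.
have {key} := choice key; move=> [q_ hq].
apply: (@approx_lim q_ _ 1).
- by move=> n; have [] := hq n.
- move=> n x; have [_ _ /(_ x)[q0 /andP[h1 _]]] := hq n.
  by rewrite ger0_norm// (le_trans h1)//; have /andP[] := Q01 x.
- move=> x.
  have c : Q x - 2^-1 ^+ n @[n --> \oo] --> Q x - (0 : R).
    apply: cvgB; first exact: cvg_cst.
    by apply: cvg_expr; rewrite ger0_norm ?invr_ge0// invf_lt1// ltr1n.
  rewrite subr0 in c.
  apply: (@squeeze_cvgr _ _ _ _ (fun n => Q x - 2^-1 ^+ n) (cst (Q x))); last 2 first.
  + exact: c.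
  + exact: cvg_cst.
  apply: nearW => n; have [_ _ /(_ x)[_ /andP[h1 h2]]] := hq n.
  by rewrite h1 andbT lerBlDr.
Qed.

Lemma approx_periodic (Q : R -> R) M : measurable_fun setT (Q : LT -> R) ->
  (forall x, Q (x + 2 * pi) = Q x) -> (forall x, 0 <= Q x <= M) -> approx Q.
Proof.
move=> mQ pQ QM.
have M1 : 0 < `|M| + 1 by rewrite ltr_wpDl.
have := @approx_periodic01 (fun x => (`|M| + 1)^-1 * Q x).
move=> [||x|b a].
- exact: (measurable_funM (measurable_cst ((`|M| + 1)^-1 : R)) mQ).
- by move=> x; rewrite pQ.
- have /andP[h1 h2] := QM x; apply/andP; split.
    by rewrite mulr_ge0// invr_ge0 ltW.
  by rewrite mulrC ler_pdivrMr// mul1r (le_trans h2)//; have := ler_norm M; lra.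
have := approxM (approx_cst (`|M| + 1)) (conj b a); congr approx.
by apply/funext => x; rewrite mulrA divff ?mul1r// gt_eqF.
Qed.

End TrigApproximation.

(** * Spaces generated by integer translates *)

Section SquareNorms.
Context d (T : measurableType d) (R : realType) (m : {measure set T -> \bar R}).
Implicit Types u v : T -> R.

Lemma ge0_integral_sqrD u1 u2 v1 v2 :
  measurable_fun setT u1 -> measurable_fun setT u2 ->
  measurable_fun setT v1 -> measurable_fun setT v2 ->
  (\int[m]_x ((u1 x + v1 x) ^+ 2 + (u2 x + v2 x) ^+ 2)%:E <=
   2%:E * \int[m]_x (u1 x ^+ 2 + u2 x ^+ 2)%:E +
   2%:E * \int[m]_x (v1 x ^+ 2 + v2 x ^+ 2)%:E)%E.
Proof.
move=> mu1 mu2 mv1 mv2.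
have msq (a b : T -> R) : measurable_fun setT a -> measurable_fun setT b ->
    measurable_fun setT (fun x : T => (a x ^+ 2 + b x ^+ 2)%:E).
  by move=> ma mb; apply/measurable_EFinP; apply: measurable_funD; exact: measurable_funX.
have sq0 (a b : T -> R) x : (0 <= (a x ^+ 2 + b x ^+ 2)%:E)%E.
  by rewrite lee_fin addr_ge0// sqr_ge0.
rewrite -!ge0_integralZl//; last 2 first.
- exact: msq.
- exact: msq.
rewrite -ge0_integralD//; last 4 first.
- by move=> x _; rewrite mule_ge0.
- by apply: measurable_funeM; exact: msq.
- by move=> x _; rewrite mule_ge0.
- by apply: measurable_funeM; exact: msq.
apply: ge0_le_integral => //.
- by move=> x _; rewrite lee_fin addr_ge0// sqr_ge0.
- by apply: msq; exact: measurable_funD.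
- by apply: emeasurable_funD; apply: measurable_funeM; exact: msq.
- move=> x _; rewrite -!EFinM -EFinD lee_fin.
  have := sqr_ge0 (u1 x - v1 x); have := sqr_ge0 (u2 x - v2 x); lra.
Qed.

(** Integrability makes the inverse transform an absolutely convergent integral at each point;
    square integrability gives its L2 bound. *)
Definition l12 u := integ m u /\ integ m (fun x => u x ^+ 2).

Lemma l12D u v : l12 u -> l12 v -> l12 (fun x => u x + v x).
Proof.
move=> [u1 u2] [v1 v2]; split; first exact: integD.
exact: (integ_sqrD (integ_measurable u1) (integ_measurable v1) u2 v2).
Qed.

Lemma l12_mulb u v M : l12 u -> measurable_fun setT v -> (forall x, `|v x| <= M) ->
  l12 (fun x => v x * u x).
Proof.
move=> [u1 u2] mv vM; split.
  by have := integ_mulb u1 mv vM; congr (integ m _); apply/funext => x; rewrite mulrC.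
have v2 x : `|v x ^+ 2| <= M ^+ 2.
  have M0 : 0 <= M by exact: le_trans (normr_ge0 _) (vM x).
  by rewrite normrX; apply: lerXn2r; rewrite ?nnegrE.
have := integ_mulb u2 (measurable_funX 2 mv) v2; congr (integ m _).
by apply/funext => x; rewrite exprMn mulrC.
Qed.

Lemma l12N u : l12 u -> l12 (fun x => - u x).
Proof.
move=> [u1 u2]; split; first exact: integN.
by under [X in integ m X]eq_fun do rewrite sqrrN.
Qed.

Lemma l12B u v : l12 u -> l12 v -> l12 (fun x => u x - v x).
Proof. by move=> hu hv; apply: l12D => //; exact: l12N. Qed.

End SquareNorms.

(** * The inverse transform and inclusions between translation spaces *)

Section InverseFourier.
Context {R : realType}.
Notation C := (complex.complex R).
Notation Re := complex.Re.
Notation Im := complex.Im.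
Notation LT := (@LT R).
Notation leb := (@leb R).
Notation c0 := (Num.sqrt (2 * pi))^-1.

Definition L12 (G : R -> C) := l12 leb (fun x : LT => Re (G x)) /\
  l12 leb (fun x : LT => Im (G x)).

Definition bmeasC (p : R -> C) := bmeas (fun x => Re (p x)) /\ bmeas (fun x => Im (p x)).

Lemma L12D F G : L12 F -> L12 G -> L12 (fun x => F x + G x).
Proof.
move=> [Fr Fi] [Gr Gi]; split.
  by under [X in l12 _ X]eq_fun do rewrite ReD; exact: l12D.
by under [X in l12 _ X]eq_fun do rewrite ImD; exact: l12D.
Qed.

Lemma L12M p G : bmeasC p -> L12 G -> L12 (fun x => p x * G x).
Proof.
move=> [[mr [Mr br]] [mi [Mi bi]]] [Gr Gi]; split.
  under [X in l12 _ X]eq_fun do rewrite ReM.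
  by apply: l12B; [exact: (l12_mulb Gr mr br)|exact: (l12_mulb Gi mi bi)].
under [X in l12 _ X]eq_fun do rewrite ImM.
by apply: l12D; [exact: (l12_mulb Gi mr br)|exact: (l12_mulb Gr mi bi)].
Qed.

Lemma bmeasC_trig l : bmeasC (@trigpoly R l).
Proof.
have [M [mr mi b]] := trigpoly_parts l.
by split; split => //; exists M => x; have [] := b x.
Qed.

Lemma invFTE G x : L12 G ->
  Re (invFT G x) = c0 * (TR false (fun y => Re (G y)) x - TR true (fun y => Im (G y)) x) /\
  Im (invFT G x) = c0 * (TR false (fun y => Im (G y)) x + TR true (fun y => Re (G y)) x).
Proof.
move=> [[r _] [i _]]; rewrite /invFT /Cint ReM ImM /= !mul0r subr0 addr0.
have h b (f : LT -> R) : integ leb f -> integ leb (fun y : LT => cs b (x * y) * f y).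
  by move=> fi; exact: (kernel_integ (x : LT) (kernel_cs b) fi).
split; congr (_ * _).
- rewrite /TR -RintB; [|exact: h..].
  by apply: eq_Rint => y; rewrite /lf ReM /cs /= (mulrC x); ring.
- rewrite /TR -RintD; [|exact: h..].
  by apply: eq_Rint => y; rewrite /lf ImM /cs /= (mulrC x); ring.
Qed.

Lemma measurable_invFT G : L12 G ->
  measurable_fun setT (fun x : LT => Re (invFT G x)) /\
  measurable_fun setT (fun x : LT => Im (invFT G x)).
Proof.
move=> LG; have [[r _] [i _]] := LG.
have mr := integ_measurable r; have mi := integ_measurable i.
split.
  under eq_fun do rewrite (invFTE _ LG).1.
  exact: (measurable_funM (measurable_cst c0) (measurable_funB (measurable_TR false mr) (measurable_TR true mi))).
under eq_fun do rewrite (invFTE _ LG).2.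
exact: (measurable_funM (measurable_cst c0) (measurable_funD (measurable_TR false mi) (measurable_TR true mr))).
Qed.

Lemma half_sqr_le (p q u v : R) :
  2^-1 * ((p - v) ^+ 2 + (u + q) ^+ 2) <= p ^+ 2 + q ^+ 2 + (u ^+ 2 + v ^+ 2).
Proof. by have := sqr_ge0 (p + v); have := sqr_ge0 (u - q); lra. Qed.

Lemma four_bounds (a b c d X Y : R) : a <= 2 * pi * X -> b <= 2 * pi * X ->
  c <= 2 * pi * Y -> d <= 2 * pi * Y -> a + b + (c + d) <= 4 * (X + Y) * pi.
Proof. lra. Qed.

(** Each part of [G] enters through two transforms, and each transform costs 2 pi by [TR_L2].
    Expanding the squares costs a factor 2, and [2 * c0 ^+ 2 = pi^-1]; the product of these factors
    is 4. *)
Lemma invFT_L2 G : L12 G ->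
  (\int[leb]_x (Re (invFT G x) ^+ 2 + Im (invFT G x) ^+ 2)%:E <=
   (4 * \int[leb]_x (Re (G x) ^+ 2 + Im (G x) ^+ 2))%:E)%E.
Proof.
move=> LG; have [[r r2] [i i2]] := LG.
have [a1 b1] := TR_L2 false r r2; have [a2 b2] := TR_L2 true r r2.
have [a3 b3] := TR_L2 false i i2; have [a4 b4] := TR_L2 true i i2.
have cc : c0 ^+ 2 = (2 * pi)^-1 :> R.
  by rewrite exprVn sqr_sqrtr// mulr_ge0// pi_ge0.
have [mr mi] := measurable_invFT LG.
pose S (x : LT) : R := pi^-1 * ((TR false (fun y => Re (G y)) x ^+ 2 + TR true (fun y => Re (G y)) x ^+ 2) +
   (TR false (fun y => Im (G y)) x ^+ 2 + TR true (fun y => Im (G y)) x ^+ 2)).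
have ri2 := integD a1 a2; have ii2 := integD a3 a4.
have Si : integ leb S := integZ _ (integD ri2 ii2).
have Sle x : Re (invFT G x) ^+ 2 + Im (invFT G x) ^+ 2 <= S x.
  rewrite (invFTE _ LG).1 (invFTE _ LG).2 !exprMn cc /S invfM -mulrDr.
  rewrite (mulrC 2^-1) -mulrA; apply: ler_wpM2l; first by rewrite invr_ge0 pi_ge0.
  exact: half_sqr_le.
have i12 : integ leb (fun x => Re (invFT G x) ^+ 2 + Im (invFT G x) ^+ 2).
  apply: (integ_le (measurable_funD (measurable_funX 2 mr) (measurable_funX 2 mi)) Si) => x.
  by rewrite ger0_norm ?addr_ge0 ?sqr_ge0//; exact: Sle.
rewrite integ_fin// lee_fin; apply: (le_trans (le_Rint i12 Si Sle)).
rewrite /S (RintZ _ (integD ri2 ii2)) (RintD ri2 ii2) (RintD a1 a2) (RintD a3 a4) (RintD r2 i2).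
rewrite mulrC ler_pdivrMr ?pi_gt0//.
exact: four_bounds b1 b2 b3 b4.
Qed.

Lemma invFTD F G x : L12 F -> L12 G -> invFT (fun y => F y + G y) x = invFT F x + invFT G x.
Proof.
move=> LF LG; have LFG := L12D LF LG.
have TRD b (f g : LT -> R) : integ leb f -> integ leb g ->
    TR b (fun y => f y + g y) x = TR b f x + TR b g x.
  move=> fi gi; rewrite /TR -RintD.
  - by apply: eq_Rint => y; rewrite mulrDr.
  - exact: (kernel_integ (x : LT) (kernel_cs b) fi).
  - exact: (kernel_integ (x : LT) (kernel_cs b) gi).
have [[Fr _] [Fi _]] := LF; have [[Gr _] [Gi _]] := LG.
have hr : (fun y => Re (F y + G y)) = (fun y => Re (F y) + Re (G y)).
  by apply/funext => y; rewrite ReD.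
have hi : (fun y => Im (F y + G y)) = (fun y => Im (F y) + Im (G y)).
  by apply/funext => y; rewrite ImD.
apply: complex_ext.
  by rewrite ReD !(invFTE _ _).1// hr hi !TRD//; ring.
by rewrite ImD !(invFTE _ _).2// hr hi !TRD//; ring.
Qed.

Lemma invFT_shift (c : C) (j x : R) G : L12 G ->
  invFT (fun y => c * expi (- (j * y)) * G y) x = c * invFT G (x - j).
Proof.
move=> LG; rewrite /invFT mulrCA; congr (_ * _).
have [[Gr _] [Gi _]] := LG.
have E y : c * expi (- (j * y)) * G y * expi (y * x) = c * (G y * expi (y * (x - j))).
  by rewrite mulrBr expiD (mulrC j); ring.
have ib b (f : LT -> R) : integ leb f -> integ leb (fun y : LT => cs b ((x - j) * y) * f y).
  by move=> fi; exact: (kernel_integ (x - j : LT) (kernel_cs b) fi).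
have ri : integ leb (fun y : LT => Re (G y * expi (y * (x - j)))).
  have := integB (ib false _ Gr) (ib true _ Gi); congr (integ leb _).
  by apply/funext => y; rewrite ReM /cs /= (mulrC (x - j)); ring.
have ii : integ leb (fun y : LT => Im (G y * expi (y * (x - j)))).
  have := integD (ib false _ Gi) (ib true _ Gr); congr (integ leb _).
  by apply/funext => y; rewrite ImM /cs /= (mulrC (x - j)); ring.
apply: complex_ext; rewrite ?ReM ?ImM /Cint /= /lf /ls.
  rewrite -!RintZ// -RintB; [|exact: integZ..].
  by apply: eq_Rint => y; rewrite E ReM.
rewrite -!RintZ// -RintD; [|exact: integZ..].
by apply: eq_Rint => y; rewrite E ImM.
Qed.

(** The counterpart of multiplication by [trigpoly l] on the Fourier side. *)
Definition comb (l : seq (int * C)) (g : R -> C) (x : R) : C :=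
  \sum_(jc <- l) jc.2 * g (x - jc.1%:~R).

Lemma comb_cons j c l g x : comb ((j, c) :: l) g x = c * g (x - j%:~R) + comb l g x.
Proof. by rewrite /comb big_cons. Qed.

Lemma trigpoly_cons j c (l : seq (int * C)) x :
  trigpoly ((j, c) :: l) x = c * expi (- (j%:~R * x)) + trigpoly l x.
Proof. by rewrite /trigpoly big_cons. Qed.

Lemma invFT_trigpoly l G x : L12 G ->
  invFT (fun y => trigpoly l y * G y) x = comb l (invFT G) x.
Proof.
move=> LG; elim: l => [|[j c] l IH].
  rewrite /comb big_nil /invFT /trigpoly.
  under [X in Cint _ X]eq_fun do rewrite big_nil !mul0r.
  rewrite (_ : Cint _ _ = 0) ?mulr0//.
  by rewrite /Cint /= /Rintegral /lf integral0.
rewrite comb_cons -IH -invFT_shift// -invFTD.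
- by congr (invFT _ x); apply/funext => y; rewrite trigpoly_cons mulrDl.
- have := L12M (bmeasC_trig [:: (j, c)]) LG; congr L12; apply/funext => y.
  by rewrite /trigpoly big_seq1.
- exact: L12M (bmeasC_trig l) LG.
Qed.

Lemma comb_ae l (g h : R -> C) : {ae leb, forall x : LT, g x = h x} ->
  {ae leb, forall x : LT, comb l g x = comb l h x}.
Proof.
move=> gh; elim: l => [|[j c] l IH].
  by apply: aeW => x; rewrite /comb !big_nil.
have := aff_ae (- j%:~R) (oner_neq0 R) gh.
apply: (filterS2 _ _ IH) => x IHx hx; rewrite !comb_cons IHx; congr (_ * _ + _).
by move: hx; rewrite /aff mul1r.
Qed.

Lemma measurable_comb l (g : R -> C) :
  measurable_fun setT (fun x : LT => Re (g x)) ->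
  measurable_fun setT (fun x : LT => Im (g x)) ->
  measurable_fun setT (fun x : LT => Re (comb l g x)) /\
  measurable_fun setT (fun x : LT => Im (comb l g x)).
Proof.
move=> mr mi; elim: l => [|[j c] l [IHr IHi]].
  rewrite /comb; split; under eq_fun do rewrite big_nil; exact: measurable_cst.
have sh (f : LT -> R) : measurable_fun setT f -> measurable_fun setT (fun x : LT => f ((x : R) - j%:~R)).
  move=> mf; have := measurableT_comp mf (measurable_aff (- j%:~R) (oner_neq0 R)).
  by congr (measurable_fun setT _); apply/funext => x; rewrite /= /aff mul1r.
have mc (k : R) (f : LT -> R) := measurable_funM (measurable_cst k : measurable_fun [set: LT] _).
split.
  under eq_fun do rewrite comb_cons ReD ReM.
  apply: measurable_funD IHr.
  exact: (measurable_funB (measurable_funM (measurable_cst (Re c)) (sh _ mr)) (measurable_funM (measurable_cst (Im c)) (sh _ mi))).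
under eq_fun do rewrite comb_cons ImD ImM.
apply: measurable_funD IHi.
exact: (measurable_funD (measurable_funM (measurable_cst (Re c)) (sh _ mi)) (measurable_funM (measurable_cst (Im c)) (sh _ mr))).
Qed.

(* In Vspace the coefficient depends only on the translate, so repeated translates
   have to be merged. *)
Lemma comb_collect (l : seq (int * C)) : exists (s : seq int) (c : int -> C),
  forall g x, comb l g x = \sum_(j <- s) c j * g (x - j%:~R).
Proof.
exists (undup [seq jc.1 | jc <- l]), (fun k => \sum_(jc <- l | jc.1 == k) jc.2) => g x.
under eq_bigr do rewrite mulr_suml.
rewrite (exchange_big_dep xpredT)//=; apply: eq_big_seq => -[j c] jl.
rewrite (big_rem j) /= ?mem_undup; last by apply/mapP; exists (j, c).
rewrite eqxx big1_seq ?addr0// => k /andP[/eqP <-].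
by rewrite mem_rem_uniq ?undup_uniq// inE eqxx.
Qed.

Lemma L2dist2E (f g : R -> C) : L2dist2 f g =
  (\int[leb]_x ((Re (f x) - Re (g x)) ^+ 2 + (Im (f x) - Im (g x)) ^+ 2)%:E)%E.
Proof.
by apply: eq_integral => x _; rewrite /lf cmod2 ReD ImD ReN ImN.
Qed.

(** Outer factors 2 come from the triangle inequality for squares, 4 from [invFT_L2], and
    [2 * Mp ^+ 2] bounds the squared modulus of the trigonometric polynomial. The first term is
    below eps / 2 and the second at most eps / 4. *)
Lemma vspace_bound (A w Mp eps : R) : 0 < eps -> A < eps / 4 ->
  w <= eps / (64 * (Mp ^+ 2 + 1)) -> 2 * A + 2 * (4 * (2 * Mp ^+ 2 * w)) < eps.
Proof.
move=> e0 Ae; have M0 := sqr_ge0 Mp.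
rewrite ler_pdivlMr; last by lra.
have [w0|w0] := leP w 0; last by nra.
by have := mulr_ge0_le0 M0 w0; lra.
Qed.

(* A combination of translates of g1 is invFT (p * Q * G2) with p a trigonometric
   polynomial, and Q may be replaced by a trigonometric polynomial close to it in
   the L2 norm of weight |G2|^2. *)
Lemma Vspace_sub (g1 g2 G1 G2 : R -> C) (Q : R -> R) (M : R) :
  measurable_fun setT (fun x : LT => Re (g1 x)) ->
  measurable_fun setT (fun x : LT => Im (g1 x)) ->
  measurable_fun setT (fun x : LT => Re (g2 x)) ->
  measurable_fun setT (fun x : LT => Im (g2 x)) ->
  L12 G1 -> L12 G2 ->
  {ae leb, forall x : LT, g1 x = invFT G1 x} ->
  {ae leb, forall x : LT, g2 x = invFT G2 x} ->
  {ae leb, forall x : LT, G1 x = RtoC (Q x) * G2 x} ->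
  measurable_fun setT (Q : LT -> R) ->
  (forall x, Q (x + 2 * pi) = Q x) -> (forall x, 0 <= Q x <= M) ->
  Vspace g1 `<=` Vspace g2.
Proof.
move=> mr1 mi1 mr2 mi2 LG1 LG2 e1 e2 eQ mQ pQ QM f [L2f fV].
split; [exact: L2f|move=> eps eps0].
have e4 : 0 < eps / 4 by rewrite divr_gt0.
have [s [c fsc]] := fV _ e4.
pose l1 := [seq (j, c j) | j <- s].
have h1E : (fun x => \sum_(j <- s) c j * g1 (x - j%:~R)) = comb l1 g1.
  by apply/funext => x; rewrite /comb big_map.
rewrite h1E in fsc.
have [Mp [_ _ bp]] := trigpoly_parts l1.
pose W (x : LT) : R := Re (G2 x) ^+ 2 + Im (G2 x) ^+ 2.
have W0 x : 0 <= W x by rewrite addr_ge0// sqr_ge0.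
have [[r2 rr2] [i2 ii2]] := LG2.
have Wi : integ leb W by exact: integD.
have [bQ aQ] := approx_periodic W0 Wi mQ pQ QM.
have Mp0 : 0 < 64 * (Mp ^+ 2 + 1) by rewrite mulr_gt0// ltr_wpDl ?sqr_ge0.
have [q [lq qE] qle] := aQ _ (divr_gt0 eps0 Mp0).
pose l2 := [seq (u.1 + v.1, u.2 * v.2) | u <- l1, v <- lq].
have l2E x : trigpoly l2 x = trigpoly l1 x * RtoC (q x) by rewrite -trigpoly_mul qE.
have [s2 [c2 sc2]] := comb_collect l2.
exists s2, c2.
rewrite (_ : (fun x => \sum_(j <- s2) _) = comb l2 g2); last by apply/funext => x; rewrite sc2.
(* Negated coefficients turn the difference of the two combinations into a sum, to which additivity
   of [invFT] applies. *)
pose ml2 := [seq (u.1, - u.2) | u <- l2].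
have ml2E x : trigpoly ml2 x = - trigpoly l2 x.
  by rewrite /ml2 /trigpoly big_map -sumrN; apply: eq_bigr => u _; rewrite mulNr.
have cml2 h x : comb ml2 h x = - comb l2 h x.
  by rewrite /ml2 /comb big_map -sumrN; apply: eq_bigr => u _; rewrite mulNr.
pose D x := trigpoly l1 x * G1 x + trigpoly ml2 x * G2 x.
have LD1 := L12M (bmeasC_trig l1) LG1; have LD2 := L12M (bmeasC_trig ml2) LG2.
have LD : L12 D by exact: L12D LD1 LD2.
have [mh1r mh1i] := measurable_comb l1 mr1 mi1.
have [mh2r mh2i] := measurable_comb l2 mr2 mi2.
have [[mfr mfi] _] := L2f.
have hD : {ae leb, forall x : LT, comb l1 g1 x - comb l2 g2 x = invFT D x}.
  apply: (filterS2 _ _ (comb_ae l1 e1) (comb_ae l2 e2)) => x -> ->.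
  by rewrite invFTD// !invFT_trigpoly// cml2.
have [[_ Dr2] [_ Di2]] := LD.
have [mir mii] := measurable_invFT LD.
have DQ : {ae leb, forall x : LT, Re (D x) ^+ 2 + Im (D x) ^+ 2 <=
    2 * Mp ^+ 2 * (W x * (Q x - q x) ^+ 2)}.
  apply: filterS eQ => x eQx.
  have -> : D x = trigpoly l1 x * (RtoC (Q x - q x) * G2 x).
    rewrite /D ml2E l2E eQx; have -> : RtoC (Q x - q x) = RtoC (Q x) - RtoC (q x).
      by apply: complex_ext; rewrite ?ReD ?ReN ?ImD ?ImN //= subr0.
    by rewrite mulrBl mulrBr mulNr -mulrA.
  have [br bi] := bp x.
  set a := trigpoly l1 x in br bi *.
  have -> : Re (a * (RtoC (Q x - q x) * G2 x)) ^+ 2 + Im (a * (RtoC (Q x - q x) * G2 x)) ^+ 2 =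
      (Re a ^+ 2 + Im a ^+ 2) * (W x * (Q x - q x) ^+ 2).
    by rewrite !(ReM, ImM) /= /W; ring.
  apply: ler_wpM2r; first by rewrite mulr_ge0// sqr_ge0.
  have sq (u : R) : `|u| <= Mp -> u ^+ 2 <= Mp ^+ 2.
    by move=> uM; rewrite -(real_normK (num_real u)); apply: lerXn2r; rewrite ?nnegrE// (le_trans _ uM).
  by rewrite mulr_natl mulr2n; apply: lerD; exact: sq.
have mW := integ_measurable Wi.
have bq : bmeas q by apply: real_trigpoly_bmeas; exists lq.
have Ei : integ leb (fun x : LT => W x * (Q x - q x) ^+ 2) by exact: wint2.
have D2i : integ leb (fun x : LT => Re (D x) ^+ 2 + Im (D x) ^+ 2) by exact: integD.
have D2 : \int[leb]_x (Re (D x) ^+ 2 + Im (D x) ^+ 2) <= 2 * Mp ^+ 2 * wdist W Q q.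
  rewrite /wdist -RintZ// -lee_fin -!integ_fin//; last exact: integZ.
  apply: ae_ge0_le_integral.
  - exact: measurableT.
  - by move=> x _; rewrite lee_fin addr_ge0// sqr_ge0.
  - exact/measurable_EFinP/(integ_measurable D2i).
  - by move=> x _; rewrite lee_fin; exact: (mulr_ge0 (mulr_ge0 (ler0n _ 2) (sqr_ge0 Mp)) (mulr_ge0 (W0 x) (sqr_ge0 _))).
  - exact/measurable_EFinP/(integ_measurable (integZ _ Ei)).
  - by apply: filterS DQ => x Dx _; rewrite lee_fin.
have d12 : (\int[leb]_x ((Re (comb l1 g1 x) - Re (comb l2 g2 x)) ^+ 2 +
      (Im (comb l1 g1 x) - Im (comb l2 g2 x)) ^+ 2)%:E <=
    (4 * (2 * Mp ^+ 2 * wdist W Q q))%:E)%E.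
  have -> : (\int[leb]_x ((Re (comb l1 g1 x) - Re (comb l2 g2 x)) ^+ 2 +
      (Im (comb l1 g1 x) - Im (comb l2 g2 x)) ^+ 2)%:E =
      \int[leb]_x (Re (invFT D x) ^+ 2 + Im (invFT D x) ^+ 2)%:E)%E.
    apply: ae_eq_integral.
    - exact: measurableT.
    - exact/measurable_EFinP/(measurable_funD (measurable_funX 2 (measurable_funB mh1r mh2r)) (measurable_funX 2 (measurable_funB mh1i mh2i))).
    - exact/measurable_EFinP/(measurable_funD (measurable_funX 2 mir) (measurable_funX 2 mii)).
    - by apply: filterS hD => x <- _; rewrite ReD ImD ReN ImN.
  by apply: (le_trans (invFT_L2 LD)); rewrite lee_fin ler_pM2l.
move: fsc; rewrite !L2dist2E => fsc.
have T := ge0_integral_sqrD leb (measurable_funB mfr mh1r) (measurable_funB mfi mh1i)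
  (measurable_funB mh1r mh2r) (measurable_funB mh1i mh2i).
have fin : (0 <= \int[leb]_x ((Re (f x) - Re (comb l1 g1 x)) ^+ 2 +
    (Im (f x) - Im (comb l1 g1 x)) ^+ 2)%:E)%E.
  by apply: integral_ge0 => x _; rewrite lee_fin addr_ge0// sqr_ge0.
set A := (\int[leb]_x _)%E in fsc fin; set B := (\int[leb]_x _)%E in d12.
rewrite [leLHS](_ : _ = \int[leb]_x ((Re (f x) - Re (comb l2 g2 x)) ^+ 2 +
    (Im (f x) - Im (comb l2 g2 x)) ^+ 2)%:E)%E in T; last first.
  by apply: eq_integral => x _; rewrite !subrKA.
apply: (le_lt_trans T).
have Afin : A \is a fin_num by rewrite ge0_fin_numE// (lt_trans fsc)// ltry.
apply: (@le_lt_trans _ _ (2%:E * A + 2%:E * (4 * (2 * Mp ^+ 2 * wdist W Q q))%:E)%E).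
  by apply: leeD => //; rewrite lee_pmul2l.
move: fsc; rewrite -(fineK Afin) -!EFinM -EFinD !lte_fin => fsc.
exact: vspace_bound eps0 fsc qle.
Qed.

End InverseFourier.

(** * Periodization *)

Section SymmetricSums.
Context {R : realType}.
Implicit Types f a : int -> R.

Definition symsum f (n : nat) : R := \sum_(i < (2 * n).+1) f ((i : nat)%:Z - n%:Z).

Lemma symsumS f n : symsum f n.+1 = f (- n.+1%:Z) + symsum f n + f n.+1.
Proof.
rewrite /symsum (_ : (2 * n.+1).+1 = (2 * n).+3)%N; last by lia.
rewrite big_ord_recl big_ord_recr /= -addrA; congr (_ + (_ + _)).
- by congr f; lia.
- by apply: eq_bigr => i _; congr f; rewrite /bump /=; lia.
- by congr f; rewrite /bump /=; lia.
Qed.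

(** Shifting the index trades the term at -n for the term at n + 1. *)
Lemma symsum_shift f n :
  symsum (fun k => f (k + 1)) n + f (- n%:Z) = symsum f n + f n.+1.
Proof.
rewrite /symsum big_ord_recr [in RHS]big_ord_recl /= addrAC; congr (_ + _).
  rewrite addrC; congr (f _ + _); first by lia.
  by apply: eq_bigr => i _; congr f; rewrite /bump /=; lia.
by congr f; lia.
Qed.

Lemma symsum_ge0 f n : (forall k, 0 <= f k) -> 0 <= symsum f n.
Proof. by move=> f0; apply: sumr_ge0. Qed.

Lemma symsum_nondecreasing f : (forall k, 0 <= f k) -> nondecreasing_seq (symsum f).
Proof.
by move=> f0; apply/nondecreasing_seqP => n; rewrite symsumS -addrA addrC -addrA lerDl addr_ge0.
Qed.

Lemma symsum_ge f k : (forall k, 0 <= f k) -> f k <= symsum f `|k|%N.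
Proof.
move=> f0; have h : (`|(k + `|k|%N%:Z)%R| < (2 * `|k|).+1)%N by lia.
rewrite /symsum (bigD1 (Ordinal h)) //= (_ : _ - _ = k); last by lia.
by rewrite lerDl sumr_ge0.
Qed.

Lemma symsum_le f a n : (forall k, f k <= a k) -> symsum f n <= symsum a n.
Proof. by move=> fa; apply: ler_sum. Qed.

(** A shifted partial sum still runs over distinct indices. The shift is kept because a point
    outside [Tset] meets the bounds [a] with the index of its own tile added. *)
Lemma symsum_esum (al : int -> \bar R) a m n : (forall k, 0 <= al k)%E ->
  (forall k, al k = (a k)%:E) ->
  ((symsum (fun k => a (k + m)) n)%:E <= \esum_(k in [set: int]) al k)%E.
Proof.
move=> a0 aE; apply: esum_ge.
pose s := [seq ((i : nat)%:Z - n%:Z + m)%R | i : 'I_(2 * n).+1].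
exists [set` s]; first by split => //; exact: finite_seq.
have us : uniq s.
  by rewrite map_inj_uniq ?enum_uniq// => i j ij; apply/val_inj => /=; lia.
rewrite -fsbig_seq// big_map big_enum /= /symsum -sumEFin.
by apply: lee_sum => i _; rewrite aE.
Qed.

Lemma symsum_lim f B : (forall k, 0 <= f k) -> (forall n, symsum f n <= B) ->
  [/\ symsum f n @[n --> \oo] --> limn (symsum f), limn (symsum f) <= B &
    forall k, f k <= limn (symsum f)].
Proof.
move=> f0 fB.
have nd := symsum_nondecreasing f0.
have cf : cvgn (symsum f).
  by apply: nondecreasing_is_cvgn => //; exists B => _ [n _ <-].
split => //; first by apply: limr_le; [apply/cvg_ex; exists (limn (symsum f))|apply: nearW].
by move=> k; apply: (le_trans (symsum_ge k f0)); exact: nondecreasing_cvgn_le.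
Qed.

(** Each partial sum of one family is below the next partial sum of the other, so the two increasing
    limits coincide. This gives the periodicity of the periodization. *)
Lemma symsum_lim_shift f B : (forall k, 0 <= f k) -> (forall n, symsum f n <= B) ->
  (forall n, symsum (fun k => f (k + 1)) n <= B) ->
  limn (symsum (fun k => f (k + 1))) = limn (symsum f).
Proof.
move=> f0 fB gB; pose g k := f (k + 1).
have g0 k : 0 <= g k by exact: f0.
have [cf _ _] := symsum_lim f0 fB; have [cg _ _] := symsum_lim g0 gB.
have ndf := symsum_nondecreasing f0; have ndg := symsum_nondecreasing g0.
have E n : symsum g n + f (- n%:Z) = symsum f n + f n.+1 by exact: symsum_shift.
apply/eqP; rewrite eq_le; apply/andP; split.
- apply: limr_le; first by apply/cvg_ex; exists (limn (symsum g)).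
  apply: nearW => n.
  apply: (@le_trans _ _ (symsum f n.+1)); last by apply: nondecreasing_cvgn_le => //; apply/cvg_ex; exists (limn (symsum f)).
  by rewrite symsumS; have := E n; have := f0 (- n%:Z); have := f0 (- n.+1%:Z); rewrite /g; lra.
- apply: limr_le; first by apply/cvg_ex; exists (limn (symsum f)).
  apply: nearW => n.
  apply: (@le_trans _ _ (symsum g n.+1)); last by apply: nondecreasing_cvgn_le => //; apply/cvg_ex; exists (limn (symsum g)).
  rewrite symsumS; have := E n; have := f0 n.+1; have := g0 n.+1.
  have -> : g (- n.+1%:Z) = f (- n%:Z) by congr f; lia.
  by lra.
Qed.

End SymmetricSums.

(** * Condition (A2) as pointwise bounds *)

Section PeriodizationBounds.
Context {R : realType}.
Notation C := (complex.complex R).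
Notation Re := complex.Re.
Notation Im := complex.Im.
Notation LT := (@LT R).
Notation BT := (measurableTypeR R).
Notation mu := (@lebesgue_measure R).
Notation leb := (@leb R).
Notation lebT := (@lebT R).
Notation Tset := (@Tset R).

Lemma lebT_ae (P : R -> Prop) : (\forall x \ae lebT, P x) ->
  {ae leb, forall x : LT, Tset x -> P x}.
Proof.
move=> [A [mA A0 PA]]; exists (A `&` Tset); split.
- by apply: borel_LT; exact: measurableI mA (@measurable_Tset R).
- by apply: (leb_negligible (measurableI _ _ mA (@measurable_Tset R)) A0 (fun x h => h)).2.
- move=> x /= h; split; last by apply: contrapT => Tx; apply: h.
  by apply: PA => Px; apply: h.
Qed.

Lemma lebT_gt0 : (0 < lebT setT)%E.
Proof.
rewrite /lebT /mrestr setTI /Tset lebesgue_measure_itv/= lte_fin gtrN ?pi_gt0//.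
by rewrite lte_fin opprK addr_gt0// pi_gt0.
Qed.

(** Here [a k] is the essential supremum over the k-th tile, [B] the amalgam norm, and [delta] a
    positive real below the essential infimum. *)
Lemma condA2_bounds (g : R -> C) : condA2 g -> exists (a : int -> R) (B delta : R),
  [/\ 0 < delta, forall k, 0 <= a k,
    forall m n, symsum (fun k => a (k + m)) n <= B &
    {ae leb, forall x : LT, Tset x ->
      (forall k : int, cmod (g (x + 2 * pi * k%:~R)) <= a k) /\ delta <= cmod (g x)}].
Proof.
move=> [[_ Wf] [d0 _]].
have cm0 z : 0 <= cmod z :> R by exact: sqrtr_ge0.
have al0 k : (0 <= locnorm g k)%E.
  by apply: ess_sup_gee; [exact: lebT_gt0|apply: nearW => x; rewrite lee_fin].
have alW k : (locnorm g k <= Wnorm g)%E.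
  by apply: esum_ge; exists [set k]; [split|rewrite fsbig_set1].
have alf k : locnorm g k \is a fin_num.
  by rewrite ge0_fin_numE// (le_lt_trans (alW k)).
have W0 : (0 <= Wnorm g)%E by exact: le_trans (al0 0) (alW 0).
have Wfin : Wnorm g \is a fin_num by rewrite ge0_fin_numE.
(* If [infT g] were +oo, any positive number would serve; 1 is taken. *)
have [delta delta0 dle] : exists2 delta : R, 0 < delta & (delta%:E <= infT g)%E.
  case: (infT g) d0 => [r r0|_|//]; first by exists r.
  by exists 1; rewrite ?ltr01// leey.
pose a k := fine (locnorm g k).
have aE k : locnorm g k = (a k)%:E by rewrite fineK.
exists a, (fine (Wnorm g)), delta; split => //.
- by move=> k; exact: fine_ge0.
- by move=> m n; rewrite -lee_fin fineK//; exact: symsum_esum.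
have h1 k : {ae leb, forall x : LT, Tset x -> cmod (g (x + 2 * pi * k%:~R)) <= a k}.
  apply: lebT_ae; apply: filterS (ess_sup_ge lebT (fun x => (cmod (g (x + 2 * pi * k%:~R)))%:E)) => x.
  by rewrite -[ess_sup _ _]/(locnorm g k) aE lee_fin.
have h2 : {ae leb, forall x : LT, Tset x -> delta <= cmod (g x)}.
  apply: lebT_ae; apply: filterS (ess_inf_le lebT (fun x => (cmod (g x))%:E)) => x.
  by move=> /(le_trans dle); rewrite lee_fin.
have hp := ae_foralln (fun n => h1 (Posz n)); have hn := ae_foralln (fun n => h1 (Negz n)).
apply: (filterS3 _ _ hp hn h2) => x p n d Tx; split; last exact: d.
by case=> k; [exact: p|exact: n].
Qed.

Lemma mod2piT (x : R) : exists k : int, Tset (x - 2 * pi * k%:~R).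
Proof.
have [k /andP[h1 h2]] := mod2pi (- x); exists (- k).
by rewrite /Tset /= in_itv /=; rewrite intrN; apply/andP; split; lra.
Qed.

Lemma ae_translates (P : R -> Prop) : {ae leb, forall x : LT, P x} ->
  {ae leb, forall x : LT, forall k : int, P (x + 2 * pi * k%:~R)}.
Proof.
move=> aP; have h (k : int) : {ae leb, forall x : LT, P (x + 2 * pi * k%:~R)}.
  have H : {ae leb, forall x : LT, P (aff 1 (2 * pi * k%:~R) x)} := aff_ae _ (oner_neq0 R) aP.
  by apply: filterS H => x; rewrite /aff mul1r.
have hp := ae_foralln (fun n => h (Posz n)); have hn := ae_foralln (fun n => h (Negz n)).
by apply: (filterS2 _ _ hp hn) => x p n [] k; [exact: p|exact: n].
Qed.

End PeriodizationBounds.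

(** Tiles have length 2 pi, so [[-n, n]] meets only tiles of index at most n in absolute value, all
    present in the symmetric sum of order [n]. *)
Lemma tile_index (R : realType) (x : R) (n : nat) (m : int) : - n%:R <= x -> x <= n%:R ->
  - pi <= x - 2 * pi * m%:~R -> x - 2 * pi * m%:~R < pi -> (`|m| <= n)%N.
Proof.
move=> h1 h2 h3 h4; have p2 := pi_ge2 R.
have n0 : 0 <= n%:R :> R by [].
have [m1|m1] := leP m n%:Z; last first.
  have : (n%:Z + 1)%:~R <= m%:~R :> R by rewrite ler_int; lia.
  by rewrite intrD; nra.
have [m2|m2] := leP (- n%:Z) m; last first.
  have : m%:~R <= (- n%:Z - 1)%:~R :> R by rewrite ler_int; lia.
  by rewrite intrB intrN; nra.
by lia.
Qed.

(** * The periodization: bounds, periodicity, measurability *)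

Section Periodization.
Context {R : realType}.
Notation C := (complex.complex R).
Notation Re := complex.Re.
Notation Im := complex.Im.
Notation LT := (@LT R).
Notation BT := (measurableTypeR R).
Notation leb := (@leb R).
Notation Tset := (@Tset R).
Notation c0 := (Num.sqrt (2 * pi))^-1.
Variables (g : R -> C) (a : int -> R) (B delta : R).
Hypotheses (d0 : 0 < delta) (a0 : forall k, 0 <= a k)
  (aB : forall m n, symsum (fun k => a (k + m)) n <= B).
Hypotheses (mr : measurable_fun setT (fun x : LT => Re (g x))).
Hypotheses (g_im : {ae leb, forall x : LT, Im (g x) = 0})
  (g_re : {ae leb, forall x : LT, 0 <= Re (g x)})
  (ga : {ae leb, forall x : LT, Tset x ->
    (forall k : int, cmod (g (x + 2 * pi * k%:~R)) <= a k) /\ delta <= cmod (g x)}).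

(** All the almost everywhere information is imposed at every translate at once, which makes the set
    invariant under translation by 2 pi. *)
Definition good x := forall k : int, let y := x + 2 * pi * k%:~R in
  [/\ Im (g y) = 0, 0 <= Re (g y) &
    Tset y -> (forall l : int, cmod (g (y + 2 * pi * l%:~R)) <= a l) /\ delta <= cmod (g y)].

Lemma good_ae : {ae leb, forall x : LT, good x}.
Proof.
have h : {ae leb, forall x : LT, [/\ Im (g x) = 0, 0 <= Re (g x) &
    Tset x -> (forall l : int, cmod (g (x + 2 * pi * l%:~R)) <= a l) /\ delta <= cmod (g x)]}.
  by apply: (filterS3 _ _ g_im g_re ga) => x h1 h2 h3; split.
by apply: filterS (ae_translates h) => x.
Qed.

Lemma good_translate x (m : int) : good x -> good (x + 2 * pi * m%:~R).
Proof.
move=> h k; rewrite -addrA -mulrDr -intrD; exact: h.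
Qed.

Lemma good_period x : good (x + 2 * pi) <-> good x.
Proof.
split=> [|h]; last by have := good_translate 1 h; rewrite mulr1.
by move=> /(good_translate (-1)); rewrite mulrN1 addrK.
Qed.

Let w x (k : int) := Re (g (x + 2 * pi * k%:~R)).

Lemma good_cmod x k : good x -> cmod (g (x + 2 * pi * k%:~R)) = w x k.
Proof.
by move=> /(_ k)[i0 r0 _]; rewrite /cmod i0 expr0n addr0 sqrtr_sqr ger0_norm.
Qed.

(** The translate of [x] that lies in [Tset] gives both bounds: its index shifts the sequence [a],
    and its own term is at least [delta]. *)
Lemma good_bounds x : good x -> [/\ forall k, 0 <= w x k,
  exists m, forall k, w x k <= a (k + m) & exists k, delta <= w x k].
Proof.
move=> gx; split; first by move=> k; have [] := gx k.
  have [m Tm] := mod2piT x; exists m => k.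
  have [_ _] := gx (- m); rewrite intrN mulrN => /(_ Tm)[/(_ (k + m)) + _].
  rewrite (_ : _ + 2 * pi * (k + m)%:~R = x + 2 * pi * k%:~R); last by rewrite intrD; ring.
  by rewrite good_cmod.
have [m Tm] := mod2piT x; exists (- m).
have [_ _] := gx (- m); rewrite -good_cmod// intrN mulrN.
by move=> /(_ Tm)[].
Qed.

Lemma persum_re x n : Re (persum g x n) = symsum (w x) n.
Proof.
rewrite /persum /symsum (big_morph _ ReD (erefl : Re (0 : C) = 0)).
by apply: eq_bigr => i _; rewrite /w intrB.
Qed.

Lemma persum_im x n : good x -> Im (persum g x n) = 0.
Proof.
move=> gx; rewrite /persum (big_morph _ ImD (erefl : Im (0 : C) = 0)).
apply: big1 => i _; have [] := gx ((i : nat)%:Z - n%:Z).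
by rewrite intrB.
Qed.

Lemma good_symsum x n : good x -> symsum (w x) n <= B.
Proof.
by move=> gx; have [_ [m wa] _] := good_bounds gx; exact: le_trans (symsum_le _ wa) (aB m n).
Qed.

(** The terms are real and nonnegative, so the symmetric partial sums increase, stay below [B], and
    have a limit above each term. *)
Lemma good_periodization x : good x -> exists P : R,
  [/\ periodization g x = RtoC P, delta <= P <= B, 0 <= Re (g x) & symsum (w x) n @[n --> \oo] --> P].
Proof.
move=> gx; have [w0 [m wa] [k dk]] := good_bounds gx.
have [cw wB wk] := symsum_lim w0 (fun n => good_symsum n gx).
exists (limn (symsum (w x))); split => //.
- rewrite /periodization /RtoC; congr (complex.Complex _ _).
    by congr (limn _); apply/funext => n; exact: persum_re.
  under [X in limn X]eq_fun do rewrite persum_im//.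
  exact: lim_cst.
- by rewrite wB andbT (le_trans dk)//; exact: wk.
- by have := w0 0; rewrite /w mulr0 addr0.
Qed.

(* The value delta off the good set makes periodicity and the lower bound hold
   everywhere. *)
Definition Pper x := if `[< good x >] then Re (periodization g x) else delta.

Lemma Pper_bounds x : delta <= Pper x <= Num.max delta B.
Proof.
rewrite /Pper; case: asboolP => [gx|_]; last by rewrite lexx le_max lexx.
have [P [-> /andP[dP PB] _ _]] := good_periodization gx.
by rewrite /= dP le_max PB orbT.
Qed.

Lemma Pper_period x : Pper (x + 2 * pi) = Pper x.
Proof.
rewrite /Pper (_ : `[< good (x + 2 * pi) >] = `[< good x >]); last first.
  by apply: asbool_equiv_eq; exact: good_period.
case: asboolP => // gx; have gx' := (good_period x).2 gx.
have [w0 _ _] := good_bounds gx.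
have E : w (x + 2 * pi) = (fun k => w x (k + 1)).
  by apply/funext => k; rewrite /w; congr (Re (g _)); rewrite intrD; ring.
rewrite /periodization /=.
have l y : limn (fun n => Re (persum g y n)) = limn (symsum (w y)).
  by congr (limn _); apply/funext => n; exact: persum_re.
rewrite !l E; apply: (symsum_lim_shift w0 (fun n => good_symsum n gx)) => n.
by rewrite -E; exact: good_symsum.
Qed.

Lemma measurable_good : measurable (good : set LT).
Proof.
rewrite -[X in measurable X]setCK; apply: measurableC.
by apply: completed_lebesgue_measure_is_complete; exact: good_ae.
Qed.

Lemma measurable_Pper : measurable_fun setT (Pper : LT -> R).
Proof.
have mG : measurable_fun setT (\1_good : LT -> R) := measurable_indic measurable_good.
pose u n (x : LT) : R := \1_good x * symsum (w x) n + (1 - \1_good x) * delta.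
have mw n : measurable_fun setT (fun x : LT => symsum (w x) n).
  rewrite /symsum; apply: measurable_sum => i.
  have := measurableT_comp mr (measurable_aff (2 * pi * (((i : nat)%:Z - n%:Z))%:~R) (oner_neq0 R)).
  by congr (measurable_fun setT _); apply/funext => x; rewrite /= /w /aff mul1r.
have mu n : measurable_fun setT (u n).
  exact: (measurable_funD (measurable_funM mG (mw n)) (measurable_funM (measurable_funB (measurable_cst (1 : R)) mG) (measurable_cst delta))).
apply: (measurable_fun_cvg mu) => x _.
rewrite /Pper; case: asboolP => gx.
  rewrite (_ : u ^~ x = symsum (w x)).
    by have [P [-> _ _]] := good_periodization gx.
  by apply/funext => n; rewrite /u indicE mem_set// mul1r subrr mul0r addr0.
rewrite (_ : u ^~ x = fun=> delta); first exact: cvg_cst.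
by apply/funext => n; rewrite /u indicE memNset// mul0r add0r subr0 mul1r.
Qed.

Lemma good_le_a x : good x -> exists m, Tset (x - 2 * pi * m%:~R) /\ Re (g x) <= a m.
Proof.
move=> gx; have [m Tm] := mod2piT x; exists m; split => //.
have [_ _] := gx (- m); rewrite intrN mulrN => /(_ Tm)[/(_ m) + _].
rewrite (_ : x - 2 * pi * m%:~R + 2 * pi * m%:~R = x + 2 * pi * (0 : int)%:~R).
  by rewrite good_cmod// /w mulr0 addr0.
by rewrite mulr0; ring.
Qed.

(** On [[-n, n]] the function is dominated by the sum of [a k] over the tiles of index at most [n].
    The integral of that sum is at most [K * B], with [K] the length of a tile, and Fatou's lemma
    removes the truncation. *)
Lemma integ_re : integ leb (fun x : LT => Re (g x)).
Proof.
pose v (x : LT) : R := `|Re (g x)|.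
have mv : measurable_fun setT v by exact: (measurableT_comp (continuous_measurable_fun (@norm_continuous R R^o)) mr).
have [Ii mI] := @indic_itv_int R (- pi) pi.
pose K := \int[leb]_x (\1_(`[- pi, pi] : set R) x : R).
have K0 : 0 <= K by exact: Rint_ge0.
(* Closed tiles overlap at their end points, which only enlarges the dominating sum. *)
pose tile (k : int) (x : LT) : R := \1_(`[- pi, pi] : set R) (aff 1 (- (2 * pi * k%:~R)) x).
have tilei k : integ leb (tile k) := integ_aff (- (2 * pi * k%:~R)) (oner_neq0 R) Ii.
have tileK k : \int[leb]_x tile k x = K.
  by rewrite /tile (Rint_aff _ (oner_neq0 R) Ii) normr1 invr1 mul1r.
pose u (n : nat) (x : LT) : R := symsum (fun k => a k * tile k x) n.
have ui n : integ leb (u n) by apply: integ_sum => i; exact: integZ.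
have uB n : \int[leb]_x u n x <= K * B.
  rewrite /u /symsum Rint_sum; last by move=> i; exact: integZ.
  have -> : \sum_(i < (2 * n).+1) \int[leb]_x (a ((i : nat)%:Z - n%:Z) * tile ((i : nat)%:Z - n%:Z) x) =
      K * symsum (fun k => a (k + 0)) n.
    by rewrite /symsum mulr_sumr; apply: eq_bigr => i _; rewrite RintZ// tileK addr0 mulrC.
  by apply: ler_wpM2l => //; exact: aB.
have u0 k x : 0 <= a k * tile k x by rewrite mulr_ge0 ?indicE ?ler0n.
have tu n : {ae leb, forall x : LT, trunc n v x <= u n x}.
  apply: (@filterS _ _ (ae_filter_ringOfSetsType leb) _ _ _ good_ae) => x gx; rewrite /trunc indicE.
  have [xn|_] := boolP (_ \in _); last by rewrite mul0r; exact: symsum_ge0.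
  move: xn; rewrite inE /= in_itv /= => /andP[xn1 xn2]; rewrite mul1r.
  have [m [Tm gm]] := good_le_a gx.
  have [_ re0 _] := gx 0; rewrite mulr0 addr0 in re0.
  rewrite /v ger0_norm//; apply: (le_trans gm).
  move: Tm; rewrite /Tset /= in_itv /= => /andP[T1 T2].
  have -> : a m = a m * tile m x.
    by rewrite /tile indicE mem_set ?mulr1// /aff mul1r /= in_itv /= T1 ltW.
  apply: (le_trans (symsum_ge m (u0 ^~ x))).
  apply: symsum_nondecreasing; first exact: (u0 ^~ x).
  exact: tile_index xn1 xn2 T1 T2.
have vint : integ leb v.
  apply: (integ_ge0P mv (fun x => normr_ge0 (Re (g x)))).
  apply: (@le_lt_trans _ _ (K * B)%:E); last exact: ltry.
  have mt n : measurable_fun setT (trunc n v : LT -> R).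
    have [_ mJ] := @indic_itv_int R (- n%:R) n%:R.
    exact: (measurable_funM mJ mv).
  have t0 n x : 0 <= trunc n v x by rewrite /trunc mulr_ge0 ?normr_ge0// indicE ler0n.
  apply: (le_integral_fatou mt t0 (@cvg_trunc R v)) => n.
  apply: (@le_trans _ _ (\int[leb]_x (u n x)%:E)%E); last by rewrite integ_fin// lee_fin.
  apply: ae_ge0_le_integral.
  - exact: measurableT.
  - by move=> x _; rewrite lee_fin.
  - exact/measurable_EFinP/mt.
  - by move=> x _; rewrite lee_fin; exact: symsum_ge0.
  - exact/measurable_EFinP/(integ_measurable (ui n)).
  - by apply: filterS (tu n) => x h _; rewrite lee_fin.
apply: (integ_le mr vint) => x; exact: lexx.
Qed.

End Periodization.

(** * Multipliers between [phihat] and [Lhat phihat] *)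

Section PhiSpaces.
Context {R : realType}.
Notation C := (complex.complex R).
Notation Re := complex.Re.
Notation Im := complex.Im.
Notation LT := (@LT R).
Notation leb := (@leb R).
Notation c0 := (Num.sqrt (2 * pi))^-1.

Lemma RtoC_inv (r : R) : r != 0 -> (RtoC r)^-1 = RtoC r^-1.
Proof.
move=> r0; have rr : RtoC r * RtoC r^-1 = 1.
  by apply: complex_ext; rewrite ?ReM ?ImM /= ?mulfV// !mul0r ?mulr0 ?subr0 ?addr0.
have rn : RtoC r != 0.
  by apply: contra_neq r0 => -[].
by apply: (mulfI rn); rewrite rr mulfV.
Qed.

Lemma RtoCM (r s : R) : RtoC (r * s) = RtoC r * RtoC s.
Proof. by apply: complex_ext; rewrite ?ReM ?ImM /= ?mul0r ?mulr0 ?subr0 ?addr0. Qed.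

(** Completeness of the measure makes [f] measurable. This is how [Lhat phihat], whose formula is
    controlled only off a null set, becomes integrable. *)
Lemma integ_ae_complete (f g : LT -> R) : integ leb g ->
  {ae leb, forall x : LT, f x = g x} -> integ leb f.
Proof.
move=> gi fg; apply: (integ_ae _ gi fg); apply/measurable_EFinP.
apply: (ae_measurable_fun completed_lebesgue_measure_is_complete (f := EFin \o g)).
  by apply: (@filterS _ _ (ae_filter_ringOfSetsType leb) _ _ _ fg) => x /= ->.
exact/measurable_EFinP/(integ_measurable gi).
Qed.

Lemma L12_ae (F G : R -> C) : L12 G -> {ae leb, forall x : LT, F x = G x} -> L12 F.
Proof.
move=> [[r r2] [i i2]] FG.
have h (p : C -> R) : {ae leb, forall x : LT, p (F x) = p (G x)}.
  by apply: (@filterS _ _ (ae_filter_ringOfSetsType leb) _ _ _ FG) => x ->.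
split; split.
- exact: (integ_ae_complete (f := fun x => Re (F x)) r (h (fun z => Re z))).
- exact: (integ_ae_complete (f := fun x => Re (F x) ^+ 2) r2 (h (fun z => Re z ^+ 2))).
- exact: (integ_ae_complete (f := fun x => Im (F x)) i (h (fun z => Im z))).
- exact: (integ_ae_complete (f := fun x => Im (F x) ^+ 2) i2 (h (fun z => Im z ^+ 2))).
Qed.

Lemma TR_ae0 b (h : LT -> R) x : measurable_fun setT h ->
  {ae leb, forall y : LT, h y = 0} -> TR b h x = 0.
Proof.
move=> mh h0; rewrite /TR; transitivity (\int[leb]_x (0:R)).
  apply: eq_ae_Rint.
  - exact: measurable_funM (kernel_measurable1 (x : LT) (kernel_cs b)) mh.
  - exact: measurable_cst.
  - by apply: (@filterS _ _ (ae_filter_ringOfSetsType leb) _ _ _ h0) => y ->; rewrite mulr0.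
by rewrite /Rintegral integral0.
Qed.

(** Composing the inverse with [Num.max e] makes it continuous everywhere and keeps its values on
    the range of [f]. *)
Lemma measurable_inv_ge (f : LT -> R) (e : R) : 0 < e -> (forall x, e <= f x) ->
  measurable_fun setT f -> measurable_fun setT (fun x : LT => (f x)^-1).
Proof.
move=> e0 fe mf.
have ch : continuous (fun y : R => (Num.max e y)^-1).
  move=> y; apply: continuousV; first by rewrite gt_eqF// lt_max e0.
  by apply: continuous_max; [exact: cst_continuous|exact: cvg_id].
have := measurableT_comp (continuous_measurable_fun ch) mf.
by congr (measurable_fun setT _); apply/funext => x /=; rewrite max_r.
Qed.

End PhiSpaces.

Theorem theorem6 (R : realType) (phi phihat : R -> complex.complex R) :
  (* (A1) *) L2 phi -> posdef phi ->
  (* phihat is the Fourier transform of phi *) is_FT phi phihat ->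
  (* (A2) *) condA2 phihat ->
  Vspace phi = Vspace (Lphi phihat).
Proof.
move=> L2phi pd FT A2.
have [mr mi r2 i2] := L2_parts L2phi; have [mr' mi' r2' i2'] := L2_parts FT.1.
have im0 := posdef_FT_im0 L2phi FT pd; have re0 := posdef_FT_re_ge0 L2phi FT pd.
have [a [B [delta [d0 a0 aB ga]]]] := condA2_bounds A2.
have ri := integ_re a0 aB mr' im0 re0 ga.
have LG : L12 phihat.
  by split; split => //; exact: (integ_ae mi' (integ0 _) im0).
pose P := Pper phihat a delta.
have PB x : delta <= P x <= Num.max delta B := Pper_bounds _ _ aB x.
have Pgt0 x : 0 < P x by have /andP[+ _] := PB x; exact: lt_le_trans.
have Pp x : P (x + 2 * pi) = P x := Pper_period _ _ aB x.
have mP : measurable_fun setT (P : LT -> R) := measurable_Pper aB mr' im0 re0 ga.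
pose c0 : R := (Num.sqrt (2 * pi))^-1.
have c0_gt0 : 0 < c0 by rewrite invr_gt0 sqrtr_gt0 mulr_gt0// pi_gt0.
have LE : {ae leb, forall x : LT, Lhat phihat x = RtoC (c0 / P x) * phihat x}.
  apply: (@filterS _ _ (ae_filter_ringOfSetsType leb) _ _ _ (good_ae im0 re0 ga)) => x gx.
  have [p [pE /andP[dp _] _ _]] := good_periodization aB gx.
  have -> : P x = p by rewrite /P /Pper asboolT// pE.
  have p0 : p != 0 by rewrite gt_eqF// (lt_le_trans d0).
  by rewrite /Lhat pE RtoC_inv// RtoCM -!mulrA (mulrC (phihat x)).
have mQ : measurable_fun setT ((fun x => c0 / P x) : LT -> R).
  apply: (measurable_funM (measurable_cst c0)).
  by apply: (measurable_inv_ge d0 _ mP) => x; have /andP[] := PB x.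
have Qb x : 0 <= c0 / P x <= c0 / delta.
  rewrite divr_ge0 ?(ltW c0_gt0) ?(ltW (Pgt0 x))//= ler_pM2l//.
  by rewrite lef_pV2 ?posrE//; have /andP[] := PB x.
have LL : L12 (Lhat phihat).
  apply: L12_ae LE; apply: L12M LG; split; split.
  - exact: mQ.
  - exists (c0 / delta) => x /=; have /andP[h1 h2] := Qb x; by rewrite ger0_norm.
  - exact: measurable_cst.
  - by exists 0 => x; rewrite normr0.
have phiE : {ae leb, forall x : LT, phi x = invFT phihat x}.
  have Fr := FT_inversion false L2phi FT pd ri; have Fi := FT_inversion true L2phi FT pd ri.
  apply: (@filterS2 _ _ (ae_filter_ringOfSetsType leb) _ _ _ _ Fr Fi) => x hr hi.
  have [er ei] := invFTE x LG.
  have T b : TR b (fun y => complex.Im (phihat y)) x = 0 by exact: TR_ae0 mi' im0.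
  apply: complex_ext.
    by rewrite er T subr0; exact: hr.
  by rewrite ei T add0r; exact: hi.
have [mLr mLi] := measurable_invFT LL.
have LphiE : {ae leb, forall x : LT, Lphi phihat x = invFT (Lhat phihat) x} by exact: aeW.
apply/seteqP; split.
(* The two inclusions use reciprocal multipliers, [c0^-1 * P] here and [c0 / P] in the other,
   bounded by the upper and the lower bound of [P] respectively. *)
- pose Q x := c0^-1 * P x.
  have QE : {ae leb, forall x : LT, phihat x = RtoC (Q x) * Lhat phihat x}.
    apply: (@filterS _ _ (ae_filter_ringOfSetsType leb) _ _ _ LE) => x ->.
    rewrite mulrA -RtoCM mulrACA mulVf ?gt_eqF// mul1r divff ?gt_eqF//.
    by apply: complex_ext; rewrite ?ReM ?ImM /= !mul1r mul0r ?subr0 ?addr0.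
  have mQ' : measurable_fun setT (Q : LT -> R) := measurable_funM (measurable_cst c0^-1) mP.
  have Qp x : Q (x + 2 * pi) = Q x by rewrite /Q Pp.
  have QM x : 0 <= Q x <= c0^-1 * Num.max delta B.
    have /andP[_ h] := PB x.
    by rewrite mulr_ge0 ?invr_ge0 ?(ltW c0_gt0) ?(ltW (Pgt0 x))//= ler_pM2l// invr_gt0.
  exact: (Vspace_sub mr mi mLr mLi LG LL phiE LphiE QE mQ' Qp QM).
- have Qp x : c0 / P (x + 2 * pi) = c0 / P x by rewrite Pp.
  exact: (Vspace_sub mLr mLi mr mi LL LG LphiE phiE LE mQ Qp Qb).
Qed.
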